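(* Let $R$ be a commutative ring and let $G$ be a finite, flat, finitely presented and linearly reductive group scheme over $R$. There exists an fppf covering $\mathcal{U}=\{U_i\to\mathrm{Spec}\,R\}_{i\in I}$ such that $G\times_RU_i$ has a good representation theory over $U_i$ for all $i$. If $G$ is étale over $R$ there exists an étale covering with the same property.
   Context: $G$ is linearly reductive over $R$ if the functor of invariants $(-)^G$ from $R$-modules with an action of $G$ ($R[G]$-comodules) to $R$-modules is exact. A linearly reductive $G$ (finite, flat, finitely presented) over a base $S$ has a good representation theory over $S$ if there is a finite collection $I_G$ of locally free sheaves of finite rank on $S$ with an action of $G$ such that, for every geometric point $\mathrm{Spec}\,k\to S$ ($k$ algebraically closed), pullback to $k$ is a bijection from $I_G$ onto a set of representatives of the irreducible representations of $G\times_Sk$. *)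

(* Defs.v *)
From HB Require Import structures.
From mathcomp Require Import all_boot all_algebra.
From mathcomp Require Import boolp.

Set Implicit Arguments.
Unset Strict Implicit.
Unset Printing Implicit Defensive.

Import GRing.Theory.
Local Open Scope ring_scope.
Local Open Scope quotient_scope.

(* Algebras over R are given by structure maps phi : {rmorphism R -> A} between
   possibly trivial rings (comPzRingType): the MathComp algebra structures
   exclude the zero ring, and a tensor product of nonzero rings may be zero.  *)

Section TensorRel.
Variables (R : comPzRingType) (M N : lmodType R).

(* A sequence of pairs stands for the formal sum of the corresponding pure
   tensors; tens_rel is the congruence that defines M (x)_R N. *)
Inductive tens_rel : seq (M * N) -> seq (M * N) -> Prop :=
| tens_rel_refl s : tens_rel s s
| tens_rel_sym s t : tens_rel s t -> tens_rel t s
| tens_rel_trans s t u : tens_rel s t -> tens_rel t u -> tens_rel s u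
| tens_rel_cat s s' t t' :
    tens_rel s s' -> tens_rel t t' -> tens_rel (s ++ t) (s' ++ t')
| tens_rel_comm s t : tens_rel (s ++ t) (t ++ s)
| tens_rel_Dl m m' n : tens_rel [:: (m + m', n)] [:: (m, n); (m', n)]
| tens_rel_Dr m n n' : tens_rel [:: (m, n + n')] [:: (m, n); (m, n')]
| tens_rel_Z a m n : tens_rel [:: (a *: m, n)] [:: (m, a *: n)]
| tens_rel_0 n : tens_rel [:: (0, n)] [::].

Definition tens_relb (s t : seq (M * N)) : bool := `[< tens_rel s t >].

Lemma tens_relb_refl : reflexive tens_relb.
Proof. by move=> s; apply/asboolP; exact: tens_rel_refl. Qed.

Lemma tens_relb_sym : symmetric tens_relb.
Proof.
by move=> s t; apply/asboolP/asboolP; exact: tens_rel_sym.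
Qed.

Lemma tens_relb_trans : transitive tens_relb.
Proof.
move=> t s u /asboolP st /asboolP tu; apply/asboolP.
exact: tens_rel_trans st tu.
Qed.

Canonical tens_equiv :=
  EquivRel tens_relb tens_relb_refl tens_relb_sym tens_relb_trans.

Definition tensor := {eq_quot tens_relb}.

HB.instance Definition _ : EqQuotient _ tens_relb tensor :=
  EqQuotient.on tensor.
HB.instance Definition _ := Choice.on tensor.

Lemma tens_piW (P : tensor -> Prop) :
  (forall s, P (\pi_tensor s)) -> forall t, P t.
Proof. by move=> Ppi t; rewrite -[t]reprK. Qed.

Definition balanced (Z : zmodType) (f : M -> N -> Z) :=
  [/\ forall m m' n, f (m + m') n = f m n + f m' n,
      forall m n n', f m (n + n') = f m n + f m n'
    & forall a m n, f (a *: m) n = f m (a *: n)].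

(* The additive map M (x) N -> Z induced by f; it is meaningful when f is
   balanced, since the sum runs over a chosen representative of t. *)
Definition tlift (Z : zmodType) (f : M -> N -> Z) (t : tensor) : Z :=
  \sum_(p <- repr t) f p.1 p.2.

Definition tens (m : M) (n : N) : tensor := \pi_tensor [:: (m, n)].

Lemma tens_eqP s t : \pi_tensor s = \pi_tensor t <-> tens_rel s t.
Proof.
split; first by move/eqmodP/asboolP.
by move=> st; apply/eqmodP/asboolP.
Qed.

Lemma balanced0l (Z : zmodType) (f : M -> N -> Z) n : balanced f -> f 0 n = 0.
Proof.
by case=> fDl _ _; apply: (addrI (f 0 n)); rewrite -fDl !addr0.
Qed.

Lemma balanced_rel (Z : zmodType) (f : M -> N -> Z) s t : balanced f ->
  tens_rel s t -> \sum_(p <- s) f p.1 p.2 = \sum_(p <- t) f p.1 p.2.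
Proof.
move=> bf; have [fDl fDr fZ] := bf; elim => //=.
- by move=> {}s {}t u _ -> _ ->.
- by move=> {}s s' {}t t' _ Hs _ Ht; rewrite !big_cat /= Hs Ht.
- by move=> {}s {}t; rewrite !big_cat /= addrC.
- by move=> m m' n; rewrite !big_cons !big_nil /= !addr0.
- by move=> m n n'; rewrite !big_cons !big_nil /= !addr0.
- by move=> a m n; rewrite !big_cons !big_nil /= !addr0.
- by move=> n; rewrite big_cons big_nil /= (balanced0l _ bf) addr0.
Qed.

Lemma tlift_pi (Z : zmodType) (f : M -> N -> Z) s : balanced f ->
  tlift f (\pi_tensor s) = \sum_(p <- s) f p.1 p.2.
Proof.
move=> bf; apply: balanced_rel => //; apply/tens_eqP.
by rewrite reprK.
Qed.

Lemma tlift_tens (Z : zmodType) (f : M -> N -> Z) m n : balanced f ->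
  tlift f (tens m n) = f m n.
Proof. by move=> bf; rewrite tlift_pi // big_cons big_nil addr0. Qed.

Definition tens_add (t u : tensor) : tensor := \pi_tensor (repr t ++ repr u).
Definition tens_zero : tensor := \pi_tensor [::].
Definition seq_act (g : M -> M) (s : seq (M * N)) :=
  [seq (g p.1, p.2) | p <- s].
Definition tens_opp (t : tensor) : tensor :=
  \pi_tensor (seq_act -%R (repr t)).
Definition tens_scale (a : R) (t : tensor) : tensor :=
  \pi_tensor (seq_act ( *:%R a) (repr t)).

Lemma pi_cat s t : \pi_tensor (s ++ t) = tens_add (\pi_tensor s) (\pi_tensor t).
Proof.
by apply/tens_eqP; apply: tens_rel_cat; apply/tens_eqP; rewrite reprK.
Qed.

Lemma pi_cons p s :
  \pi_tensor (p :: s) = tens_add (\pi_tensor [:: p]) (\pi_tensor s).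
Proof. by rewrite -cat1s pi_cat. Qed.

Lemma seq_act_rel (g : M -> M) s t :
  (forall m m', g (m + m') = g m + g m') ->
  (forall a m, g (a *: m) = a *: g m) ->
  tens_rel s t -> tens_rel (seq_act g s) (seq_act g t).
Proof.
move=> gD gZ; elim; rewrite /seq_act /=.
- by move=> ?; exact: tens_rel_refl.
- by move=> ? ? _; exact: tens_rel_sym.
- by move=> ? ? ? _ + _; exact: tens_rel_trans.
- by move=> ? ? ? ? _ + _; rewrite !map_cat; exact: tens_rel_cat.
- by move=> ? ?; rewrite !map_cat; exact: tens_rel_comm.
- by move=> *; rewrite gD; exact: tens_rel_Dl.
- by move=> *; exact: tens_rel_Dr.
- by move=> *; rewrite gZ; exact: tens_rel_Z.
- move=> n; have -> : g 0 = 0 by apply: (addrI (g 0)); rewrite -gD !addr0.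
  exact: tens_rel_0.
Qed.

Lemma pi_opp s : tens_opp (\pi_tensor s) = \pi_tensor (seq_act -%R s).
Proof.
apply/tens_eqP; apply: seq_act_rel; last by apply/tens_eqP; rewrite reprK.
- by move=> *; rewrite opprD.
- by move=> *; rewrite scalerN.
Qed.

Lemma pi_scale a s :
  tens_scale a (\pi_tensor s) = \pi_tensor (seq_act ( *:%R a) s).
Proof.
apply/tens_eqP; apply: seq_act_rel; last by apply/tens_eqP; rewrite reprK.
- by move=> *; rewrite scalerDr.
- by move=> *; rewrite !scalerA mulrC.
Qed.

Lemma tens_addA : associative tens_add.
Proof.
elim/tens_piW=> s; elim/tens_piW=> t; elim/tens_piW=> u.
by rewrite -!pi_cat catA.
Qed.

Lemma tens_addC : commutative tens_add.
Proof.
elim/tens_piW=> s; elim/tens_piW=> t; rewrite -!pi_cat; apply/tens_eqP.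
exact: tens_rel_comm.
Qed.

Lemma tens_add0 : left_id tens_zero tens_add.
Proof. by elim/tens_piW=> s; rewrite -pi_cat. Qed.

Lemma tens_addN : left_inverse tens_zero tens_opp tens_add.
Proof.
elim/tens_piW=> s; rewrite pi_opp; elim: s => [|[m n] s IHs].
  by rewrite -pi_cat.
rewrite [\pi_tensor ((m, n) :: s)]pi_cons [seq_act _ _]map_cons.
rewrite -/(seq_act _ s) pi_cons.
rewrite -tens_addA [X in tens_add _ X]tens_addA.
rewrite [tens_add (\pi_tensor (seq_act _ _)) _]tens_addC.
rewrite -[X in tens_add _ X]tens_addA.
rewrite IHs [tens_add _ tens_zero]tens_addC tens_add0 -pi_cat.
apply/tens_eqP; apply: tens_rel_trans (tens_rel_0 n).
by rewrite -(addNr m); exact/tens_rel_sym/tens_rel_Dl.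
Qed.

HB.instance Definition _ :=
  GRing.isZmodule.Build tensor tens_addA tens_addC tens_add0 tens_addN.

Lemma tens_scaleA a b v : tens_scale a (tens_scale b v) = tens_scale (a * b) v.
Proof.
elim/tens_piW: v => s; rewrite !pi_scale /seq_act -map_comp.
by congr (\pi_tensor _); apply: eq_map => -[m n] /=; rewrite scalerA.
Qed.

Lemma tens_scale1 : left_id 1 tens_scale.
Proof.
elim/tens_piW=> s; rewrite pi_scale; congr (\pi_tensor _); rewrite -[RHS]map_id.
by apply: eq_map => -[m n] /=; rewrite scale1r.
Qed.

Lemma tens_scaleDr : right_distributive tens_scale +%R.
Proof.
move=> a; elim/tens_piW=> s; elim/tens_piW=> t.
rewrite -[_ + _]pi_cat -[RHS]/(tens_add _ _) !pi_scale -pi_cat.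
by rewrite /seq_act map_cat.
Qed.

Lemma tens_scaleDl v : {morph tens_scale^~ v : a b / a + b}.
Proof.
move=> a b; elim/tens_piW: v => s.
rewrite -[RHS]/(tens_add _ _) !pi_scale.
elim: s => [|[m n] s IHs]; first by rewrite -pi_cat.
rewrite /seq_act !map_cons ![\pi_tensor (_ :: map _ _)]pi_cons.
rewrite -!/(seq_act _ _) IHs.
have -> : \pi_tensor [:: ((a + b) *: m, n)] =
          tens_add (\pi_tensor [:: (a *: m, n)]) (\pi_tensor [:: (b *: m, n)]).
  by rewrite -pi_cat scalerDl; apply/tens_eqP; exact: tens_rel_Dl.
rewrite -!tens_addA; congr tens_add; rewrite !tens_addA; congr tens_add.
exact: tens_addC.
Qed.

HB.instance Definition _ := GRing.Zmodule_isLmodule.Build R tensor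
  tens_scaleA tens_scale1 tens_scaleDr tens_scaleDl.

Lemma tlift0 (Z : zmodType) (f : M -> N -> Z) : balanced f -> tlift f 0 = 0.
Proof. by move=> bf; rewrite -[0]/(\pi_tensor [::]) tlift_pi // big_nil. Qed.

Lemma tliftD (Z : zmodType) (f : M -> N -> Z) t u : balanced f ->
  tlift f (t + u) = tlift f t + tlift f u.
Proof.
move=> bf; elim/tens_piW: t => s; elim/tens_piW: u => t.
by rewrite -[_ + _]pi_cat !tlift_pi // big_cat.
Qed.

Lemma tlift_sum (Z : zmodType) (f : M -> N -> Z) I (r : seq I)
    (F : I -> tensor) :
  balanced f -> tlift f (\sum_(i <- r) F i) = \sum_(i <- r) tlift f (F i).
Proof.
by move=> bf; apply: big_morph; [move=> t u; exact: tliftD | exact: tlift0].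
Qed.

Lemma tensDl m m' n : tens (m + m') n = tens m n + tens m' n.
Proof.
by rewrite -[RHS]pi_cat; apply/tens_eqP; exact: tens_rel_Dl.
Qed.

Lemma tensDr m n n' : tens m (n + n') = tens m n + tens m n'.
Proof.
by rewrite -[RHS]pi_cat; apply/tens_eqP; exact: tens_rel_Dr.
Qed.

Lemma scale_tens a m n : a *: tens m n = tens (a *: m) n.
Proof. by rewrite -[LHS]/(tens_scale _ _) pi_scale. Qed.

Lemma tensZ a m n : tens (a *: m) n = tens m (a *: n).
Proof. by apply/tens_eqP; exact: tens_rel_Z. Qed.

Lemma tens_balanced : balanced tens.
Proof. by split; [exact: tensDl | exact: tensDr | exact: tensZ]. Qed.

Lemma tensor_ind (P : tensor -> Prop) : P 0 -> (forall m n, P (tens m n)) ->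
  (forall t u, P t -> P u -> P (t + u)) -> forall t, P t.
Proof.
move=> P0 Pt PD; elim/tens_piW => s; elim: s => [//|[m n] s IHs].
by rewrite pi_cons; apply: PD => //; exact: Pt.
Qed.

Lemma tensorE t : tlift tens t = t.
Proof.
elim/tensor_ind: t => [|m n|t u IHt IHu].
- exact: tlift0 tens_balanced.
- exact: tlift_tens tens_balanced.
- by rewrite tliftD ?IHt ?IHu //; exact: tens_balanced.
Qed.

Lemma eq_tlift (Z : zmodType) (f g : M -> N -> Z) t :
  (forall m n, f m n = g m n) -> tlift f t = tlift g t.
Proof. by move=> fg; apply: eq_bigr => p _; rewrite fg. Qed.

Lemma tliftfD (Z : zmodType) (f g : M -> N -> Z) t :
  tlift (fun m n => f m n + g m n) t = tlift f t + tlift g t.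
Proof. exact: big_split. Qed.

Lemma tlift_scale (Z : zmodType) (f : M -> N -> Z) a t : balanced f ->
  tlift f (a *: t) = tlift (fun m n => f (a *: m) n) t.
Proof.
move=> bf; have [fDl fDr fZ] := bf.
have bf' : balanced (fun m n => f (a *: m) n).
  split=> [m m' n|m n n'|b m n] //; first by rewrite scalerDr fDl.
  by rewrite scalerA mulrC -scalerA fZ.
elim/tens_piW: t => s; rewrite -[_ *: _]/(tens_scale _ _) pi_scale !tlift_pi //.
by rewrite big_map.
Qed.

Lemma tensor_eq (Z : zmodType) (f g : tensor -> Z) :
  {morph f : t u / t + u} -> {morph g : t u / t + u} ->
  (forall m n, f (tens m n) = g (tens m n)) -> f =1 g.
Proof.
move=> fD gD fg; elim/tensor_ind => // [|t u IHt IHu].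
  have h0 (h : tensor -> Z) : {morph h : t u / t + u} -> h 0 = 0.
    by move=> hD; apply: (addrI (h 0)); rewrite -hD !addr0.
  by rewrite !h0.
by rewrite fD gD IHt IHu.
Qed.

End TensorRel.


Arguments tens {R M N} m n.

Notation "m '*t' n" := (tens m n) (at level 39, left associativity).

Section TliftComp.
Variables (R : comPzRingType) (M N : lmodType R).

Lemma tlift_additive (Y Z : zmodType) (h : Y -> Z) (f : M -> N -> Y) t :
  {morph h : x y / x + y} -> h (tlift f t) = tlift (fun m n => h (f m n)) t.
Proof.
move=> hD; apply: big_morph => //.
by apply: (addrI (h 0)); rewrite -hD !addr0.
Qed.

Lemma tlift_tlift (R' : comPzRingType) (M' N' : lmodType R') (Z : zmodType)
    (g : M -> N -> tensor M' N') (f : M' -> N' -> Z) t : balanced f ->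
  tlift f (tlift g t) = tlift (fun m n => tlift f (g m n)) t.
Proof. by move=> bf; apply: tlift_additive => x y; exact: tliftD. Qed.

Lemma tlift_exchange (R' : comPzRingType) (M' N' : lmodType R') (Z : zmodType)
    (f : M -> N -> M' -> N' -> Z) t (u : tensor M' N') :
  tlift (fun m n => tlift (f m n) u) t =
  tlift (fun m' n' => tlift (fun m n => f m n m' n') t) u.
Proof. exact: exchange_big. Qed.

End TliftComp.

Definition restr (R S : comPzRingType) (phi : {rmorphism R -> S})
  (M : lmodType S) : Type := M.

Section Restr.
Variables (R S : comPzRingType) (phi : {rmorphism R -> S}) (M : lmodType S).

HB.instance Definition _ := GRing.Zmodule.on (restr phi M).

Definition restr_scale (a : R) (m : restr phi M) : restr phi M :=
  phi a *: (m : M).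

Lemma restr_scaleA a b v :
  restr_scale a (restr_scale b v) = restr_scale (a * b) v.
Proof. by rewrite /restr_scale scalerA rmorphM. Qed.

Lemma restr_scale1 : left_id 1 restr_scale.
Proof. by move=> m; rewrite /restr_scale rmorph1 scale1r. Qed.

Lemma restr_scaleDr : right_distributive restr_scale +%R.
Proof. by move=> a m n; exact: scalerDr. Qed.

Lemma restr_scaleDl v : {morph restr_scale^~ v : a b / a + b}.
Proof. by move=> a b; rewrite /restr_scale rmorphD; exact: scalerDl. Qed.

HB.instance Definition _ := GRing.Zmodule_isLmodule.Build R (restr phi M)
  restr_scaleA restr_scale1 restr_scaleDr restr_scaleDl.

End Restr.

Definition alg (R S : comPzRingType) (phi : {rmorphism R -> S}) : lmodType R :=
  restr phi S^o.

Lemma alg_scaleE (R S : comPzRingType) (phi : {rmorphism R -> S}) a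
  (x : alg phi) : a *: x = phi a * (x : S) :> S.
Proof. by []. Qed.

Definition tring (R A B : comPzRingType) (phi : {rmorphism R -> A})
  (psi : {rmorphism R -> B}) : Type := tensor (alg phi) (alg psi).

Section TensorRing.
Variables (R A B : comPzRingType).
Variables (phi : {rmorphism R -> A}) (psi : {rmorphism R -> B}).

HB.instance Definition _ := GRing.Zmodule.copy (tring phi psi)
  (tensor (alg phi) (alg psi)).

Definition ptens (a : A) (b : B) : tring phi psi :=
  (a : alg phi) *t (b : alg psi).

Lemma ptensDl a a' b : ptens (a + a') b = ptens a b + ptens a' b.
Proof. exact: tensDl. Qed.

Lemma ptensDr a b b' : ptens a (b + b') = ptens a b + ptens a b'.
Proof. exact: tensDr. Qed.

Lemma ptensZ r a b : ptens (phi r * a) b = ptens a (psi r * b).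
Proof. exact: (@tensZ R (alg phi) (alg psi)). Qed.

Lemma balanced_ring (Z : zmodType) (f : A -> B -> Z) :
  (forall a a' b, f (a + a') b = f a b + f a' b) ->
  (forall a b b', f a (b + b') = f a b + f a b') ->
  (forall r a b, f (phi r * a) b = f a (psi r * b)) ->
  @balanced R (alg phi) (alg psi) Z f.
Proof. by move=> fDl fDr fZ; split. Qed.

Lemma balanced_ptensM a b :
  @balanced R (alg phi) (alg psi) _ (fun c d => ptens (a * c) (b * d)).
Proof.
apply: balanced_ring => [c c' d|c d d'|r c d].
- by rewrite mulrDr ptensDl.
- by rewrite mulrDr ptensDr.
- by rewrite mulrCA ptensZ mulrCA.
Qed.

Definition tring_mul (t u : tring phi psi) : tring phi psi :=
  @tlift R (alg phi) (alg psi) _ (fun (a : A) (b : B) =>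
    @tlift R (alg phi) (alg psi) _ (fun (c : A) (d : B) =>
      ptens (a * c) (b * d)) u) t.

Lemma balanced_tring_mul u : @balanced R (alg phi) (alg psi) _
  (fun a b => @tlift R (alg phi) (alg psi) _ (fun (c : A) (d : B) =>
    ptens (a * c) (b * d)) u).
Proof.
apply: balanced_ring => [a a' b|a b b'|r a b].
- by rewrite -tliftfD; apply: eq_tlift => c d; rewrite mulrDl ptensDl.
- by rewrite -tliftfD; apply: eq_tlift => c d; rewrite mulrDl ptensDr.
- by apply: eq_tlift => c d; rewrite -!mulrA ptensZ.
Qed.

Lemma tring_mulDl : left_distributive tring_mul +%R.
Proof. by move=> t u v; apply: tliftD; exact: balanced_tring_mul. Qed.

Lemma tring_mulDr : right_distributive tring_mul +%R.
Proof.
move=> t u v; rewrite /tring_mul -tliftfD; apply: eq_tlift => a b.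
by apply: tliftD; exact: balanced_ptensM.
Qed.

Lemma tring_mul_ptens a b c d :
  tring_mul (ptens a b) (ptens c d) = ptens (a * c) (b * d).
Proof.
rewrite /tring_mul {1}/ptens tlift_tens; last exact: balanced_tring_mul.
by rewrite tlift_tens //; exact: balanced_ptensM.
Qed.

Lemma tring_ind (P : tring phi psi -> Prop) : P 0 ->
  (forall a b, P (ptens a b)) ->
  (forall t u, P t -> P u -> P (t + u)) -> forall t, P t.
Proof. exact: (@tensor_ind R (alg phi) (alg psi)). Qed.

Lemma tring_eq (Z : zmodType) (f g : tring phi psi -> Z) :
  {morph f : t u / t + u} -> {morph g : t u / t + u} ->
  (forall a b, f (ptens a b) = g (ptens a b)) -> f =1 g.
Proof. exact: (@tensor_eq R (alg phi) (alg psi)). Qed.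

Lemma tring_mulC : commutative tring_mul.
Proof.
move=> t u; rewrite /tring_mul tlift_exchange; apply: eq_tlift => c d.
by apply: eq_tlift => a b; rewrite mulrC [d * b]mulrC.
Qed.

Lemma tring_mulA : associative tring_mul.
Proof.
move=> t u v; move: t.
apply: tring_eq => [x y|x y|a b]; rewrite ?tring_mulDl //.
move: u; apply: tring_eq => [x y|x y|c d].
- by rewrite tring_mulDl tring_mulDr.
- by rewrite tring_mulDr tring_mulDl.
move: v; apply: tring_eq => [x y|x y|e f].
- by rewrite !tring_mulDr.
- by rewrite tring_mulDr.
by rewrite !tring_mul_ptens !mulrA.
Qed.

Lemma tring_mul1 : left_id (ptens 1 1) tring_mul.
Proof.
apply: tring_eq => [x y|//|a b]; first exact: tring_mulDr.
by rewrite tring_mul_ptens !mul1r.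
Qed.

HB.instance Definition _ := GRing.Zmodule_isComPzRing.Build (tring phi psi)
  tring_mulA tring_mulC tring_mul1 tring_mulDl.

Lemma ptensM a b c d : ptens a b * ptens c d = ptens (a * c) (b * d).
Proof. exact: tring_mul_ptens. Qed.

Definition tinl (a : A) : tring phi psi := ptens a 1.
Definition tinr (b : B) : tring phi psi := ptens 1 b.

Lemma tinl_additive : zmod_morphism tinl.
Proof.
move=> a b; apply: (addIr (tinl b)); rewrite subrK /tinl -ptensDl.
by rewrite subrK.
Qed.

Lemma tinl_multiplicative : monoid_morphism tinl.
Proof. by split=> // a b; rewrite /tinl ptensM mulr1. Qed.

HB.instance Definition _ := GRing.isZmodMorphism.Build A (tring phi psi) tinl
  tinl_additive.
HB.instance Definition _ := GRing.isMonoidMorphism.Build A (tring phi psi) tinl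
  tinl_multiplicative.

Lemma tinr_additive : zmod_morphism tinr.
Proof.
move=> a b; apply: (addIr (tinr b)); rewrite subrK /tinr -ptensDr.
by rewrite subrK.
Qed.

Lemma tinr_multiplicative : monoid_morphism tinr.
Proof. by split=> // a b; rewrite /tinr ptensM mulr1. Qed.

HB.instance Definition _ := GRing.isZmodMorphism.Build B (tring phi psi) tinr
  tinr_additive.
HB.instance Definition _ := GRing.isMonoidMorphism.Build B (tring phi psi) tinr
  tinr_multiplicative.

Lemma tinlr r : tinl (phi r) = tinr (psi r).
Proof. by rewrite /tinl /tinr -[phi r]mulr1 ptensZ mulr1. Qed.

Definition tring_lift (C : comPzRingType) (f : {rmorphism A -> C})
    (g : {rmorphism B -> C}) (fg : forall r, f (phi r) = g (psi r))
    (t : tring phi psi) : C :=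
  @tlift R (alg phi) (alg psi) _ (fun (a : A) (b : B) => f a * g b) t.

Section TringLift.
Variables (C : comPzRingType) (f : {rmorphism A -> C}) (g : {rmorphism B -> C}).
Hypothesis fg : forall r, f (phi r) = g (psi r).

Lemma balanced_tring_lift :
  @balanced R (alg phi) (alg psi) _ (fun a b => f a * g b).
Proof.
apply: balanced_ring => [a a' b|a b b'|r a b].
- by rewrite rmorphD mulrDl.
- by rewrite rmorphD mulrDr.
- by rewrite !rmorphM fg mulrCA mulrA.
Qed.

Lemma tring_liftD : {morph tring_lift fg : t u / t + u}.
Proof. by move=> t u; apply: tliftD; exact: balanced_tring_lift. Qed.

Lemma tring_liftE a b : tring_lift fg (ptens a b) = f a * g b.
Proof. by rewrite /tring_lift tlift_tens //; exact: balanced_tring_lift. Qed.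

Lemma tring_lift_additive : zmod_morphism (tring_lift fg).
Proof.
move=> t u; apply: (addIr (tring_lift fg u)); rewrite subrK.
by rewrite -tring_liftD subrK.
Qed.

Lemma tring_lift_multiplicative : monoid_morphism (tring_lift fg).
Proof.
split; first by rewrite tring_liftE !rmorph1 mulr1.
move=> t u; move: t; apply: tring_eq => [x y|x y|a b].
- by rewrite mulrDl tring_liftD.
- by rewrite tring_liftD mulrDl.
move: u; apply: tring_eq => [x y|x y|c d].
- by rewrite mulrDr tring_liftD.
- by rewrite tring_liftD mulrDr.
by rewrite ptensM !tring_liftE !rmorphM mulrACA.
Qed.

HB.instance Definition _ := GRing.isZmodMorphism.Build (tring phi psi) C
  (tring_lift fg) tring_lift_additive.
HB.instance Definition _ := GRing.isMonoidMorphism.Build (tring phi psi) C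
  (tring_lift fg) tring_lift_multiplicative.

End TringLift.

End TensorRing.

Arguments ptens {R A B} phi psi a b.
Arguments tinl {R A B} phi psi a.
Arguments tinr {R A B} phi psi b.

(* S (x)_R M with its S-module structure. *)
Definition ext (R S : comPzRingType) (phi : {rmorphism R -> S})
  (M : lmodType R) : Type := tensor (alg phi) M.

Section Ext.
Variables (R S : comPzRingType) (phi : {rmorphism R -> S}) (M : lmodType R).

HB.instance Definition _ := GRing.Zmodule.copy (ext phi M)
  (tensor (alg phi) M).

Definition etens (s : S) (m : M) : ext phi M := (s : alg phi) *t m.

Lemma etensDl s s' m : etens (s + s') m = etens s m + etens s' m.
Proof. exact: tensDl. Qed.

Lemma etensDr s m m' : etens s (m + m') = etens s m + etens s m'.
Proof. exact: tensDr. Qed.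

Lemma etensZ r s m : etens (phi r * s) m = etens s (r *: m).
Proof. exact: (@tensZ R (alg phi) M). Qed.

Lemma balanced_ext (Z : zmodType) (f : S -> M -> Z) :
  (forall s s' m, f (s + s') m = f s m + f s' m) ->
  (forall s m m', f s (m + m') = f s m + f s m') ->
  (forall r s m, f (phi r * s) m = f s (r *: m)) ->
  @balanced R (alg phi) M Z f.
Proof. by move=> fDl fDr fZ; split. Qed.

Definition ext_scale (s : S) (t : ext phi M) : ext phi M :=
  @tlift R (alg phi) M _ (fun (s' : S) m => etens (s * s') m) t.

Lemma balanced_ext_scale s :
  @balanced R (alg phi) M _ (fun (s' : S) m => etens (s * s') m).
Proof.
apply: balanced_ext => *; first by rewrite mulrDr etensDl.
  by rewrite etensDr.
by rewrite mulrCA etensZ.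
Qed.

Lemma ext_scaleDr : right_distributive ext_scale +%R.
Proof. by move=> s t u; apply: tliftD; exact: balanced_ext_scale. Qed.

Lemma ext_scale_etens s s' m : ext_scale s (etens s' m) = etens (s * s') m.
Proof. by rewrite /ext_scale tlift_tens //; exact: balanced_ext_scale. Qed.

Lemma ext_eq (Z : zmodType) (f g : ext phi M -> Z) :
  {morph f : t u / t + u} -> {morph g : t u / t + u} ->
  (forall s m, f (etens s m) = g (etens s m)) -> f =1 g.
Proof. exact: (@tensor_eq R (alg phi) M). Qed.

Lemma ext_scaleA a b v : ext_scale a (ext_scale b v) = ext_scale (a * b) v.
Proof.
move: v; apply: ext_eq => [x y|x y|s m]; rewrite ?ext_scaleDr //.
by rewrite !ext_scale_etens mulrA.
Qed.

Lemma ext_scale1 : left_id 1 ext_scale.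
Proof.
apply: ext_eq => [x y|//|s m]; first exact: ext_scaleDr.
by rewrite ext_scale_etens mul1r.
Qed.

Lemma ext_scaleDl v : {morph ext_scale^~ v : a b / a + b}.
Proof.
move=> a b; rewrite /ext_scale -tliftfD; apply: eq_tlift => s m.
by rewrite mulrDl etensDl.
Qed.

HB.instance Definition _ := GRing.Zmodule_isLmodule.Build S (ext phi M)
  ext_scaleA ext_scale1 ext_scaleDr ext_scaleDl.

Lemma scale_etens a s m : a *: etens s m = etens (a * s) m.
Proof. exact: ext_scale_etens. Qed.

End Ext.

Arguments etens {R S} phi {M} s m.

Section MoreBalanced.
Variables (R : comPzRingType).

Lemma balanced_flip (M N : lmodType R) (Z : zmodType) (f : M -> N -> Z) :
  balanced f -> balanced (fun n m => f m n).
Proof. by case=> fDl fDr fZ; split. Qed.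

Lemma balanced_compl (M M' N : lmodType R) (Z : zmodType) (f : M' -> N -> Z)
    (h : M -> M') : {morph h : x y / x + y} -> scalable h ->
  balanced f -> balanced (fun m n => f (h m) n).
Proof.
move=> hD hZ [fDl fDr fZ]; split=> [m m' n|m n n'|a m n] //.
  by rewrite hD fDl.
by rewrite hZ fZ.
Qed.

Lemma balanced_compr (M N N' : lmodType R) (Z : zmodType) (f : M -> N' -> Z)
    (h : N -> N') : {morph h : x y / x + y} -> scalable h ->
  balanced f -> balanced (fun m n => f m (h n)).
Proof.
move=> hD hZ bf; apply: (@balanced_flip _ _ _ (fun n m => f m (h n))).
apply: (@balanced_compl _ _ _ _ (fun n m => f m n)) => //.
exact: balanced_flip.
Qed.

Section Balanced3.
Variables (M N P : lmodType R) (Z : zmodType).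

Definition balanced3 (f : M -> N -> P -> Z) :=
  (forall m, balanced (f m)) /\ (forall p, balanced (fun m n => f m n p)).

Variable f : M -> N -> P -> Z.
Hypothesis bf : balanced3 f.

Lemma balanced_nestedr : balanced (fun m t => tlift (f m) t).
Proof.
have [f1 f2] := bf; split.
- move=> m m' t; rewrite -tliftfD; apply: eq_tlift => n p.
  by case: (f2 p) => ->.
- by move=> m t u; exact: tliftD.
- move=> a m t; rewrite tlift_scale //; apply: eq_tlift => n p.
  by case: (f2 p) => _ _ ->.
Qed.

Lemma balanced_nestedl :
  balanced (fun t p => tlift (fun m n => f m n p) t).
Proof.
have [f1 f2] := bf; split.
- by move=> t u p; exact: tliftD.
- move=> t p p'; rewrite -tliftfD; apply: eq_tlift => m n.
  by case: (f1 m) => _ ->.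
- move=> a t p; rewrite tlift_scale //; apply: eq_tlift => m n.
  by case: (f2 p) => _ _ ->; case: (f1 m) => _ _ ->.
Qed.

End Balanced3.

Lemma balanced3_tens (M N P : lmodType R) :
  balanced3 (fun (m : M) (n : N) (p : P) => m *t (n *t p)).
Proof.
split=> [m|p]; split=> *; rewrite ?tensDl ?tensDr ?tensZ //.
by rewrite scale_tens tensZ.
Qed.

End MoreBalanced.

Lemma tring_scaleE (R A B : comPzRingType) (phi : {rmorphism R -> A})
  (psi : {rmorphism R -> B}) r (t : tring phi psi) :
  r *: (t : tensor (alg phi) (alg psi)) = tinl phi psi (phi r) * t.
Proof.
move: t; apply: tring_eq => [x y|x y|a b].
- exact: scalerDr.
- exact: (@mulrDr (tring phi psi) _ x y).
by rewrite ptensM mul1r [LHS]scale_tens.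
Qed.


(* The affine group scheme G = Spec A over R is given by the commutative Hopf
   algebra A = R[G]: its multiplication, unit and inverse are the R-algebra
   maps comul, counit and antipode. With tlift the axioms are written as in
   Sweedler notation: tlift f (comul x) is the sum of the f x_(1) x_(2). *)
Record affGroup (R : comPzRingType) := AffGroup {
  coord_ring : comPzRingType;
  str : {rmorphism R -> coord_ring};
  comul : {rmorphism coord_ring -> tring str str};
  counit : {rmorphism coord_ring -> R};
  antipode : {rmorphism coord_ring -> coord_ring};
  comul_str : forall r, comul (str r) = tinl str str (str r);
  counit_str : forall r, counit (str r) = r;
  antipode_str : forall r, antipode (str r) = str r;
  comulA : forall x : coord_ring,
    tlift (fun a b : alg str =>
      tlift (fun c d : alg str => a *t (c *t d)) (comul b)) (comul x) =
    tlift (fun a b : alg str =>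
      tlift (fun c d : alg str => c *t (d *t b)) (comul a)) (comul x);
  counitl : forall x : coord_ring,
    tlift (fun a b : alg str =>
      str (counit a) * (b : coord_ring)) (comul x) = x;
  counitr : forall x : coord_ring,
    tlift (fun a b : alg str =>
      (a : coord_ring) * str (counit b)) (comul x) = x;
  antipodel : forall x : coord_ring,
    tlift (fun a b : alg str => antipode a * (b : coord_ring)) (comul x) =
    str (counit x);
  antipoder : forall x : coord_ring,
    tlift (fun a b : alg str => (a : coord_ring) * antipode b) (comul x) =
    str (counit x)
}.

Section AffGroupTheory.
Variables (R : comPzRingType) (G : affGroup R).
Local Notation A := (alg (str G)).

Lemma comulZ : scalable (comul G : A -> tensor A A).
Proof.
by move=> r x; rewrite tring_scaleE -comul_str -rmorphM.
Qed.

Lemma comulD : {morph (comul G : A -> tensor A A) : x y / x + y}.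
Proof. exact: (rmorphD (comul G)). Qed.

Lemma comulA3 (Z : zmodType) (f : A -> A -> A -> Z) (x : A) : balanced3 f ->
  tlift (fun a b : A => tlift (f a) (comul G b)) (comul G x) =
  tlift (fun a b : A => tlift (fun c d => f c d b) (comul G a)) (comul G x).
Proof.
move=> bf; have bf' := balanced_nestedr bf.
have := congr1 (tlift (fun m t => tlift (f m) t)) (comulA x).
rewrite !(tlift_tlift _ _ bf') => EA.
have E a c d : tlift (fun m t => tlift (f m) t) (a *t (c *t d)) = f a c d.
  by rewrite tlift_tens // tlift_tens //; case: bf.
transitivity (tlift (fun a b : A => tlift (fun m t => tlift (f m) t)
    (tlift (fun c d : A => a *t (c *t d)) (comul G b))) (comul G x)).
  apply: eq_tlift => a b; rewrite (tlift_tlift _ _ bf').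
  by apply: eq_tlift => c d; rewrite E.
rewrite EA; apply: eq_tlift => a b; rewrite (tlift_tlift _ _ bf').
by apply: eq_tlift => c d; rewrite E.
Qed.

End AffGroupTheory.

Section BaseChangeGroup.
Variables (R S : comPzRingType) (phi : {rmorphism R -> S}) (G : affGroup R).

Local Notation A := (coord_ring G).
Local Notation eta := (str G).

Definition bc_coord : comPzRingType := tring phi eta.
Definition bc_str : {rmorphism S -> bc_coord} := tinl phi eta.
Local Notation AS := bc_coord.
Local Notation eS := bc_str.

Lemma bc_str_eta r : eS (phi r) = tinr phi eta (eta r).
Proof. exact: tinlr. Qed.

Lemma bc_str_phi s r : eS (s * phi r) = ptens phi eta s (eta r).
Proof. by rewrite /= /tinl mulrC ptensZ mulr1. Qed.

(* A (x)_R A -> AS (x)_S AS, with AS := S (x)_R A *)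
Lemma bc_comul2_subproof r :
  (tinl eS eS \o tinr phi eta) (eta r) = (tinr eS eS \o tinr phi eta) (eta r).
Proof. by rewrite /= -!bc_str_eta tinlr. Qed.

Definition bc_comul2 : {rmorphism tring eta eta -> tring eS eS} :=
  tring_lift bc_comul2_subproof.

Lemma bc_comul_subproof r :
  (tinl eS eS \o eS) (phi r) = (bc_comul2 \o comul G) (eta r).
Proof.
rewrite /= comul_str /tinl tring_liftE /= rmorph1 mulr1.
by rewrite -bc_str_eta.
Qed.

Definition bc_comul : {rmorphism AS -> tring eS eS} :=
  tring_lift bc_comul_subproof.

Lemma bc_counit_subproof r : idfun (phi r) = (phi \o counit G) (eta r).
Proof. by rewrite /= counit_str. Qed.

Definition bc_counit : {rmorphism AS -> S} := tring_lift bc_counit_subproof.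

Lemma bc_antipode_subproof r :
  eS (phi r) = (tinr phi eta \o antipode G) (eta r).
Proof. by rewrite /= antipode_str bc_str_eta. Qed.

Definition bc_antipode : {rmorphism AS -> AS} :=
  tring_lift bc_antipode_subproof.

Lemma bc_comulE s (x : A) : bc_comul (ptens phi eta s x) =
  tlift (fun a b : alg eta =>
    ptens eS eS (ptens phi eta s a) (ptens phi eta 1 b)) (comul G x).
Proof.
transitivity (tinl eS eS (eS s) * bc_comul2 (comul G x)).
  exact: tring_liftE.
rewrite /bc_comul2 /= /tring_lift.
rewrite (tlift_additive (h := fun y => tinl eS eS (eS s) * y)); last first.
  by move=> y z; rewrite mulrDr.
by apply: eq_tlift => a b /=; rewrite /tinl /tinr !ptensM !(mul1r, mulr1).
Qed.

Lemma bc_counitE s x : bc_counit (ptens phi eta s x) = s * phi (counit G x).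
Proof. exact: tring_liftE. Qed.

Lemma bc_antipodeE s x :
  bc_antipode (ptens phi eta s x) = ptens phi eta s (antipode G x).
Proof.
transitivity (eS s * tinr phi eta (antipode G x)); first exact: tring_liftE.
by rewrite /bc_str /= /tinl /tinr ptensM mul1r mulr1.
Qed.

Lemma tlift_bc_comul (Z : zmodType) (f : AS -> AS -> Z) s x :
  @balanced S (alg eS) (alg eS) Z f ->
  @tlift S (alg eS) (alg eS) Z f (bc_comul (ptens phi eta s x)) =
  @tlift R (alg eta) (alg eta) Z
    (fun a b => f (ptens phi eta s a) (ptens phi eta 1 b)) (comul G x).
Proof.
move=> bf; rewrite bc_comulE (tlift_tlift _ _ bf); apply: eq_tlift => a b.
by rewrite tlift_tens.
Qed.


Lemma bc_comul_str s : bc_comul (eS s) = tinl eS eS (eS s).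
Proof.
transitivity (tinl eS eS (eS s) * bc_comul2 (comul G 1)).
  exact: tring_liftE.
by rewrite !rmorph1 mulr1.
Qed.

Lemma bc_comulZ : scalable (bc_comul : alg eS -> tensor (alg eS) (alg eS)).
Proof.
move=> s x; transitivity (tinl eS eS (eS s) * bc_comul x).
  by rewrite -bc_comul_str; exact: (rmorphM bc_comul (eS s) x).
by rewrite tring_scaleE.
Qed.

Lemma bc_comulD :
  {morph (bc_comul : alg eS -> tensor (alg eS) (alg eS)) : x y / x + y}.
Proof. exact: (rmorphD bc_comul). Qed.

Lemma balanced_bc2 s : @balanced R (alg eta) (alg eta) _
  (fun a b => ptens eS eS (ptens phi eta s a) (ptens phi eta 1 b)).
Proof.
apply: balanced_ring => [a a' b|a b b'|r a b].
- by rewrite ptensDr ptensDl.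
- by rewrite ptensDr ptensDr.
have E t c : ptens phi eta (phi r * t) c =
    eS (phi r) * ptens phi eta t c by rewrite ptensM mul1r.
by rewrite -!ptensZ !E ptensZ.
Qed.

Lemma balanced_comulr (Z : zmodType) (f : alg eS -> alg eS -> alg eS -> Z) :
  balanced3 f ->
  balanced (fun a b : alg eS => tlift (f a) (bc_comul b)).
Proof.
move=> /balanced_nestedr; apply: balanced_compr.
  exact: bc_comulD.
exact: bc_comulZ.
Qed.

Lemma balanced_comull (Z : zmodType) (f : alg eS -> alg eS -> alg eS -> Z) :
  balanced3 f ->
  balanced (fun a b : alg eS => tlift (fun c d => f c d b) (bc_comul a)).
Proof.
move=> /balanced_nestedl; apply: balanced_compl.
  exact: bc_comulD.
exact: bc_comulZ.
Qed.

Lemma bc_comulA (x : AS) :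
  tlift (fun a b : alg eS =>
    tlift (fun c d : alg eS => a *t (c *t d)) (bc_comul b)) (bc_comul x) =
  tlift (fun a b : alg eS =>
    tlift (fun c d : alg eS => c *t (d *t b)) (bc_comul a)) (bc_comul x).
Proof.
have b3 := balanced3_tens (alg eS) (alg eS) (alg eS).
have br := balanced_comulr b3; have bl := balanced_comull b3.
move: x; apply: tring_eq => [x y|x y|s x].
- by rewrite rmorphD tliftD.
- by rewrite rmorphD tliftD.
rewrite !tlift_bc_comul //.
pose h (a b c : alg eta) := (ptens phi eta s a : alg eS) *t
  ((ptens phi eta 1 b : alg eS) *t (ptens phi eta 1 c : alg eS)).
have b3h : balanced3 h.
  split=> [a|c].
    apply: (@balanced_ring _ _ _ eta eta).
    - by move=> b b' c; rewrite /h ptensDr tensDl tensDr.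
    - by move=> b c c'; rewrite /h ptensDr !tensDr.
    move=> r b c; rewrite /h; congr (_ *t _).
    by case: (balanced_bc2 1) => _ _; apply.
  apply: (@balanced_ring _ _ _ eta eta).
  - by move=> a a' b; rewrite /h ptensDr tensDl.
  - by move=> a b b'; rewrite /h ptensDr tensDl tensDr.
  move=> r a b; rewrite /h.
  have E t u : ptens phi eta t (eta r * u) =
      phi r *: (ptens phi eta t u : alg eS).
    by rewrite alg_scaleE ptensM mul1r -ptensZ.
  by rewrite !E tensZ scale_tens.
transitivity (tlift (fun a b : alg eta => tlift (h a) (comul G b)) (comul G x)).
  by apply: eq_tlift => a b; rewrite tlift_bc_comul //; case: b3 => + _; apply.
rewrite comulA3 //; apply: eq_tlift => a b; rewrite tlift_bc_comul //.
by case: b3 => _; apply.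
Qed.

Lemma bc_counitl (x : AS) :
  tlift (fun a b : alg eS => eS (bc_counit a) * (b : AS)) (bc_comul x) = x.
Proof.
have bf : @balanced S (alg eS) (alg eS) _
    (fun a b => eS (bc_counit a) * (b : AS)).
  apply: balanced_ring => [a a' b|a b b'|r a b].
  - by rewrite !rmorphD mulrDl.
  - by rewrite mulrDr.
  by rewrite !rmorphM bc_counitE rmorph1 rmorph1 mulr1 mulrCA mulrA.
move: x; apply: tring_eq => [x y|//|s x]; first by rewrite rmorphD tliftD.
rewrite tlift_bc_comul // -[in RHS](counitl x).
rewrite (@tlift_additive _ _ _ _ _ (ptens phi eta s)); last first.
  by move=> y z; exact: ptensDr.
apply: eq_tlift => a b; rewrite bc_counitE ptensM mulr1 mul1r.
by rewrite mulrC ptensZ.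
Qed.

Lemma bc_counitr (x : AS) :
  tlift (fun a b : alg eS => (a : AS) * eS (bc_counit b)) (bc_comul x) = x.
Proof.
have bf : @balanced S (alg eS) (alg eS) _
    (fun a b => (a : AS) * eS (bc_counit b)).
  apply: balanced_ring => [a a' b|a b b'|r a b].
  - by rewrite mulrDl.
  - by rewrite !rmorphD mulrDr.
  by rewrite !rmorphM bc_counitE rmorph1 rmorph1 mulr1 mulrCA mulrA.
move: x; apply: tring_eq => [x y|//|s x]; first by rewrite rmorphD tliftD.
rewrite tlift_bc_comul // -[in RHS](counitr x).
rewrite (@tlift_additive _ _ _ _ _ (ptens phi eta s)); last first.
  by move=> y z; exact: ptensDr.
apply: eq_tlift => a b; rewrite bc_counitE mul1r ptensM mulr1.
by rewrite mulrC ptensZ mulrC.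
Qed.

Lemma bc_antipodel (x : AS) :
  tlift (fun a b : alg eS => bc_antipode a * (b : AS)) (bc_comul x) =
  eS (bc_counit x).
Proof.
have bf : @balanced S (alg eS) (alg eS) _
    (fun a b => bc_antipode a * (b : AS)).
  apply: balanced_ring => [a a' b|a b b'|r a b].
  - by rewrite !rmorphD mulrDl.
  - by rewrite mulrDr.
  by rewrite !rmorphM bc_antipodeE rmorph1 mulrCA mulrA.
move: x; apply: tring_eq => [x y|x y|s x].
- by rewrite rmorphD tliftD.
- by rewrite !rmorphD.
rewrite tlift_bc_comul // bc_counitE bc_str_phi -antipodel.
rewrite (@tlift_additive _ _ _ _ _ (ptens phi eta s)); last first.
  by move=> y z; exact: ptensDr.
by apply: eq_tlift => a b; rewrite bc_antipodeE ptensM mulr1.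
Qed.

Lemma bc_antipoder (x : AS) :
  tlift (fun a b : alg eS => (a : AS) * bc_antipode b) (bc_comul x) =
  eS (bc_counit x).
Proof.
have bf : @balanced S (alg eS) (alg eS) _
    (fun a b => (a : AS) * bc_antipode b).
  apply: balanced_ring => [a a' b|a b b'|r a b].
  - by rewrite mulrDl.
  - by rewrite !rmorphD mulrDr.
  by rewrite !rmorphM bc_antipodeE rmorph1 mulrCA mulrA.
move: x; apply: tring_eq => [x y|x y|s x].
- by rewrite rmorphD tliftD.
- by rewrite !rmorphD.
rewrite tlift_bc_comul // bc_counitE bc_str_phi -antipoder.
rewrite (@tlift_additive _ _ _ _ _ (ptens phi eta s)); last first.
  by move=> y z; exact: ptensDr.
by apply: eq_tlift => a b; rewrite bc_antipodeE ptensM mulr1.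
Qed.

Lemma bc_counit_str s : bc_counit (eS s) = s.
Proof. by rewrite bc_counitE rmorph1 rmorph1 mulr1. Qed.

Lemma bc_antipode_str s : bc_antipode (eS s) = eS s.
Proof. by rewrite bc_antipodeE rmorph1. Qed.

Definition base_change : affGroup S := AffGroup bc_comul_str bc_counit_str
  bc_antipode_str bc_comulA bc_counitl bc_counitr bc_antipodel bc_antipoder.

End BaseChangeGroup.

(* A representation of G on an R-module V, i.e. a right R[G]-comodule. *)
Record comod (R : comPzRingType) (G : affGroup R) := Comod {
  cmod :> lmodType R;
  coact : {linear cmod -> tensor cmod (alg (str G))};
  coactA : forall v : cmod,
    tlift (fun (w : cmod) (a : alg (str G)) =>
      tlift (fun b c : alg (str G) => w *t (b *t c)) (comul G a)) (coact v) =
    tlift (fun (w : cmod) (a : alg (str G)) =>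
      tlift (fun (u : cmod) (b : alg (str G)) => u *t (b *t a)) (coact w))
        (coact v);
  coact1 : forall v : cmod,
    tlift (fun (w : cmod) (a : alg (str G)) => counit G a *: w) (coact v) = v
}.

Section ComodTheory.
Variables (R : comPzRingType) (G : affGroup R) (V : comod G).
Local Notation A := (alg (str G)).

Lemma coactA3 (Z : zmodType) (f : V -> A -> A -> Z) (v : V) : balanced3 f ->
  tlift (fun (w : V) (a : A) => tlift (f w) (comul G a)) (coact V v) =
  tlift (fun (w : V) (a : A) => tlift (fun u b => f u b a) (coact V w))
    (coact V v).
Proof.
move=> bf; have bf' := balanced_nestedr bf.
have := congr1 (tlift (fun m t => tlift (f m) t)) (coactA v).
rewrite !(tlift_tlift _ _ bf') => EA.
have E w c d : tlift (fun m t => tlift (f m) t) (w *t (c *t d)) = f w c d.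
  by rewrite tlift_tens // tlift_tens //; case: bf.
transitivity (tlift (fun (w : V) (a : A) => tlift (fun m t => tlift (f m) t)
    (tlift (fun c d : A => w *t (c *t d)) (comul G a))) (coact V v)).
  apply: eq_tlift => a b; rewrite (tlift_tlift _ _ bf').
  by apply: eq_tlift => c d; rewrite E.
rewrite EA; apply: eq_tlift => a b; rewrite (tlift_tlift _ _ bf').
by apply: eq_tlift => c d; rewrite E.
Qed.

End ComodTheory.

Section BaseChangeComod.
Variables (R S : comPzRingType) (phi : {rmorphism R -> S}) (G : affGroup R).
Variable V : comod G.

Local Notation A := (alg (str G)).
Local Notation AS := (alg (str (base_change phi G))).
Local Notation VS := (ext phi V).

Definition one_tens (a : coord_ring G) : AS := ptens phi (str G) 1 a.

Lemma one_tensZ r a : one_tens (str G r * a) = phi r *: one_tens a.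
Proof. by rewrite alg_scaleE /one_tens ptensM mul1r -ptensZ. Qed.

Lemma one_tensD a b : one_tens (a + b) = one_tens a + one_tens b.
Proof. exact: ptensDr. Qed.

(* s (x) v |-> the sum of the (s (x) v_(0)) (x)_S (1 (x) v_(1)) *)
Definition bc_coact (t : VS) : tensor VS AS :=
  @tlift R (alg phi) V _ (fun (s : S) (v : V) =>
    tlift (fun (w : V) (a : A) => etens phi s w *t one_tens a) (coact V v)) t.

Lemma balanced_bc_coact s :
  balanced (fun (w : V) (a : A) => etens phi s w *t one_tens a).
Proof.
split=> [w w' a|w a a'|r w a].
- by rewrite etensDr tensDl.
- by rewrite one_tensD tensDr.
rewrite -etensZ -scale_etens tensZ; congr (_ *t _).
by rewrite -one_tensZ.
Qed.

Lemma balanced_bc_coact2 : @balanced R (alg phi) V _ (fun (s : S) (v : V) =>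
  tlift (fun (w : V) (a : A) => etens phi s w *t one_tens a) (coact V v)).
Proof.
apply: balanced_ext => [s s' v|s v v'|r s v].
- by rewrite -tliftfD; apply: eq_tlift => w a; rewrite etensDl tensDl.
- by rewrite linearD tliftD //; exact: balanced_bc_coact.
rewrite linearZ tlift_scale; last exact: balanced_bc_coact.
by apply: eq_tlift => w a; rewrite etensZ.
Qed.

Lemma bc_coactD : {morph bc_coact : x y / x + y}.
Proof. by move=> x y; apply: tliftD; exact: balanced_bc_coact2. Qed.

Lemma bc_coactE s v : bc_coact (etens phi s v) =
  tlift (fun (w : V) (a : A) => etens phi s w *t one_tens a) (coact V v).
Proof. by rewrite /bc_coact tlift_tens //; exact: balanced_bc_coact2. Qed.

Lemma bc_coact_linear : linear bc_coact.
Proof.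
move=> s t u; rewrite bc_coactD; congr (_ + _); move: t.
apply: ext_eq => [x y|x y|s' v].
- by rewrite scalerDr bc_coactD.
- by rewrite bc_coactD scalerDr.
rewrite scale_etens !bc_coactE.
rewrite (tlift_additive (h := *:%R s)); last exact: scalerDr.
by apply: eq_tlift => w a; rewrite scale_tens scale_etens.
Qed.

HB.instance Definition _ :=
  GRing.isLinear.Build S VS (tensor VS AS) _ bc_coact bc_coact_linear.

Lemma tlift_bc_coact (Z : zmodType) (f : VS -> AS -> Z) s v : balanced f ->
  tlift f (bc_coact (etens phi s v)) =
  tlift (fun (w : V) (a : A) => f (etens phi s w) (one_tens a)) (coact V v).
Proof.
move=> bf; rewrite bc_coactE (tlift_tlift _ _ bf); apply: eq_tlift => w a.
by rewrite tlift_tens.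
Qed.

Lemma bc_coactA (v : VS) :
  tlift (fun (w : VS) (a : AS) =>
    tlift (fun b c : AS => w *t (b *t c)) (comul (base_change phi G) a))
      (bc_coact v) =
  tlift (fun (w : VS) (a : AS) =>
    tlift (fun (u : VS) (b : AS) => u *t (b *t a)) (bc_coact w)) (bc_coact v).
Proof.
have b3 := balanced3_tens VS AS AS.
have br : balanced (fun (w : VS) (a : AS) =>
    tlift (fun b c : AS => w *t (b *t c)) (comul (base_change phi G) a)).
  apply: balanced_compr (balanced_nestedr b3).
    exact: comulD.
  exact: comulZ.
have bl : balanced (fun (w : VS) (a : AS) =>
    tlift (fun (u : VS) (b : AS) => u *t (b *t a)) (bc_coact w)).
  apply: balanced_compl (balanced_nestedl b3).
    exact: bc_coactD.
  by move=> s x; exact: linearZ.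
move: v; apply: ext_eq => [x y|x y|s v].
- by rewrite bc_coactD tliftD.
- by rewrite bc_coactD tliftD.
rewrite !tlift_bc_coact //.
pose h (w : V) (b c : A) := etens phi s w *t (one_tens b *t one_tens c).
have b3h : balanced3 h.
  split=> [w|c]; split.
  - by move=> b b' c; rewrite /h one_tensD tensDl tensDr.
  - by move=> b c c'; rewrite /h one_tensD !tensDr.
  - by move=> r b c; rewrite /h !one_tensZ tensZ.
  - by move=> w w' b; rewrite /h etensDr tensDl.
  - by move=> w b b'; rewrite /h one_tensD tensDl tensDr.
  - move=> r w b; rewrite /h !one_tensZ -etensZ -scale_etens tensZ.
    by rewrite scale_tens.
transitivity (tlift (fun (w : V) (a : A) => tlift (h w) (comul G a))
    (coact V v)).
  apply: eq_tlift => w a; apply: tlift_bc_comul.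
  by case: b3 => + _; apply.
rewrite coactA3 //; apply: eq_tlift => w a; rewrite tlift_bc_coact //.
by case: b3 => _; apply.
Qed.

Lemma bc_coact1 (v : VS) :
  tlift (fun (w : VS) (a : AS) => counit (base_change phi G) a *: w)
    (bc_coact v) = v.
Proof.
have bf : balanced (fun (w : VS) (a : AS) => counit (base_change phi G) a *: w).
  split=> [w w' a|w a a'|s w a].
  - by rewrite scalerDr.
  - by rewrite rmorphD scalerDl.
  rewrite scalerA; congr (_ *: _); rewrite alg_scaleE rmorphM counit_str.
  by rewrite mulrC.
move: v; apply: ext_eq => [x y|//|s v]; first by rewrite bc_coactD tliftD.
rewrite tlift_bc_coact // -[in RHS](coact1 v).
rewrite (@tlift_additive _ _ _ _ _ (etens phi s)); last first.
  by move=> y z; exact: etensDr.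
apply: eq_tlift => w a.
have -> : counit (base_change phi G) (one_tens a) = 1 * phi (counit G a).
  exact: bc_counitE.
by rewrite mul1r scale_etens etensZ.
Qed.

Definition base_change_comod : comod (base_change phi G) :=
  Comod bc_coactA bc_coact1.

End BaseChangeComod.

Section Representations.
Variables (R : comPzRingType) (G : affGroup R).

Definition comod_morphism (V W : comod G) (f : {linear V -> W}) :=
  forall v : V, coact W (f v) =
    tlift (fun (u : V) (a : alg (str G)) => f u *t a) (coact V v).

Definition invariant (V : comod G) (v : V) :=
  coact V v = v *t ((1 : coord_ring G) : alg (str G)).

Definition comod_iso (V W : comod G) :=
  exists f : {linear V -> W}, comod_morphism f /\ bijective f.

Definition irreducible_comod (V : comod G) :=
  (exists v : V, v <> 0) /\
  forall (W : comod G) (f : {linear W -> V}), comod_morphism f ->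
    injective f -> (forall w : W, w = 0) \/ (forall v, exists w, f w = v).

End Representations.

(* Exactness of 0 -> P1 -> P2 -> P3 -> 0, for subgroups Pi of Vi and the
   restrictions of f and g to them. *)
Definition short_exact (V1 V2 V3 : zmodType) (P1 : V1 -> Prop) (P2 : V2 -> Prop)
    (P3 : V3 -> Prop) (f : V1 -> V2) (g : V2 -> V3) :=
  [/\ forall v, P1 v -> f v = 0 -> v = 0,
      forall v, P2 v -> (g v = 0 <-> exists2 u, P1 u & f u = v)
    & forall w, P3 w -> exists2 v, P2 v & g v = w].

Definition linearly_reductive (R : comPzRingType) (G : affGroup R) :=
  forall (V1 V2 V3 : comod G) (f : {linear V1 -> V2}) (g : {linear V2 -> V3}),
    comod_morphism f -> comod_morphism g ->
    short_exact (fun _ : V1 => True) (fun _ : V2 => True) (fun _ : V3 => True)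
      f g ->
    short_exact (@invariant _ _ V1) (@invariant _ _ V2) (@invariant _ _ V3) f g.

Section RingHom.
Variables (R A : comPzRingType) (phi : {rmorphism R -> A}).

Definition finite_hom := exists n (e : 'I_n -> A),
  forall a, exists c : 'I_n -> R, a = \sum_(i < n) phi (c i) * e i.

Definition flat_hom := forall (M N : lmodType R) (f : {linear M -> N}),
  injective f ->
  injective (tlift (fun (m : M) (a : alg phi) => f m *t a)).

(* Polynomials in n variables over R, as formal sums of terms c * X^e: MathComp
   and multinomials polynomials exclude the zero ring of coefficients. *)
Definition fpoly n := seq (R * {ffun 'I_n -> nat}).

Definition fpoly_coef n (P : fpoly n) (e : {ffun 'I_n -> nat}) : R :=
  \sum_(t <- P | t.2 == e) t.1.

Definition fpoly_mul n (P Q : fpoly n) : fpoly n :=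
  allpairs (fun s t : R * {ffun 'I_n -> nat} =>
    (s.1 * t.1, [ffun i => (s.2 i + t.2 i)%N])) P Q.

Definition fpoly_eval n (x : 'I_n -> A) (P : fpoly n) : A :=
  \sum_(t <- P) phi t.1 * \prod_(i < n) x i ^+ t.2 i.

(* A is isomorphic to R[X_1, ..., X_n] / (P_1, ..., P_m). *)
Definition finitely_presented_hom :=
  exists n (x : 'I_n -> A) m (P : 'I_m -> fpoly n),
    (forall a, exists Q, fpoly_eval x Q = a) /\
    forall Q, fpoly_eval x Q = 0 <->
      exists H : 'I_m -> fpoly n, forall e,
        fpoly_coef Q e = \sum_(j < m) fpoly_coef (fpoly_mul (H j) (P j)) e.

Definition formally_etale := forall (B C : comPzRingType)
    (beta : {rmorphism R -> B}) (pi : {rmorphism B -> C})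
    (f : {rmorphism A -> C}),
  (forall c, exists b, pi b = c) ->
  (forall x y, pi x = 0 -> pi y = 0 -> x * y = 0) ->
  (forall r, f (phi r) = pi (beta r)) ->
  let lifts (h : {rmorphism A -> B}) :=
    (forall r, h (phi r) = beta r) /\ (forall a, pi (h a) = f a) in
  (exists h, lifts h) /\ (forall h h', lifts h -> lifts h' -> h =1 h').

Definition etale_hom := finitely_presented_hom /\ formally_etale.

End RingHom.

Definition prime_ideal (R : comPzRingType) (p : R -> Prop) :=
  [/\ p 0, forall x y, p x -> p y -> p (x + y), forall a x, p x -> p (a * x),
      ~ p 1 & forall x y, p (x * y) -> p x \/ p y].

Definition free_of_rank (R : comPzRingType) (M : lmodType R) n :=
  exists e : 'I_n -> M, forall v, exists! c : {ffun 'I_n -> R},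
    v = \sum_(i < n) c i *: e i.

(* lam identifies L with the localization R_f. *)
Definition is_localization_away (R L : comPzRingType) (f : R)
    (lam : {rmorphism R -> L}) :=
  [/\ exists u, lam f * u = 1,
      forall x, exists a n, lam f ^+ n * x = lam a
    & forall a, lam a = 0 -> exists n, f ^+ n * a = 0].

Definition locally_free (R : comPzRingType) (M : lmodType R) :=
  forall p, prime_ideal p -> exists f, ~ p f /\
    exists (L : comPzRingType) (lam : {rmorphism R -> L}) n,
      is_localization_away f lam /\ free_of_rank (ext lam M) n.

(* Families of affine schemes over Spec R. Since affine opens refine any
   covering and a good representation theory pulls back, the existence of a
   covering by schemes over which G has a good representation theory is
   equivalent to that of one by affine schemes. *)
Record affine_family (R : comPzRingType) := AffineFamily {
  fam_index : Type;
  fam_ring : fam_index -> comPzRingType;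
  fam_map : forall i, {rmorphism R -> fam_ring i}
}.

Section Coverings.
Variables (R : comPzRingType) (U : affine_family R).

Definition jointly_surjective := forall p : R -> Prop, prime_ideal p ->
  exists (i : fam_index U) (q : fam_ring i -> Prop), prime_ideal q /\
    forall r, p r <-> q (fam_map i r).

Definition fppf_covering := jointly_surjective /\
  forall i : fam_index U,
    flat_hom (fam_map i) /\ finitely_presented_hom (fam_map i).

Definition etale_covering := jointly_surjective /\
  forall i : fam_index U, etale_hom (fam_map i).

End Coverings.

Definition good_representation_theory (R : comPzRingType) (G : affGroup R) :=
  exists n (V : 'I_n -> comod G),
    (forall i, locally_free (V i)) /\
    forall (k : closedFieldType) (x : {rmorphism R -> k}),
      [/\ forall i, irreducible_comod (base_change_comod x (V i)),
          forall i j,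
            comod_iso (base_change_comod x (V i)) (base_change_comod x (V j)) ->
            i = j
        & forall W : comod (base_change x G), irreducible_comod W ->
            exists i, comod_iso (base_change_comod x (V i)) W].

(* Main.v *)
From HB Require Import structures.
From mathcomp Require Import all_boot all_algebra all_field.
From mathcomp Require Import boolp zify ring.
Require Import Defs.

Set Implicit Arguments.
Unset Strict Implicit.
Unset Printing Implicit Defensive.

Import GRing.Theory.
Local Open Scope ring_scope.
Local Open Scope quotient_scope.

(** The representations of G are the modules over the algebra D dual to the
    coordinate ring A, and a good representation theory is a splitting of D
    into matrix blocks. Such a splitting exists locally for the etale topology,
    whether or not G itself is etale, so that a single family of flat and etale
    maps is a covering for both parts of the theorem.

    Fix a prime ideal p of R and the point x of Spec R with values in the
    fraction field K of R / p. It suffices to find a flat etale neighbourhood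
    of x, possibly after an extension of K, over which G has a good
    representation theory; these neighbourhoods form the covering, one for each
    p. Neighbourhoods are built from two constructions: inverting an element
    that is nonzero at x, and adjoining a root of a monic polynomial that is
    simple at x.

    Near x, the algebra A is free (near_basis). Take a minimal system of
    generators; flatness and Nakayama's lemma show that each relation between
    them is killed in a neighbourhood, and finite presentation reduces the
    vanishing of all relations to that of finitely many. The structure constants
    of the dual basis then present D as an algebra over a neighbourhood.

    At every field-valued point, D is semisimple, in the form that each d has a
    w with d w d = d (reductive_vnr). This is Maschke's argument: for a left
    ideal W of D, linear reductivity lifts the identity from the invariants of
    Hom(W, W) to those of Hom(D, W). Linear reductivity is assumed for
    R-modules, and is applied to vector spaces over K regarded as R-modules.

    Over a large enough field, 1 is a sum of orthogonal idempotents e_j of D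
    with e_j D e_l at most a line. For generic d and d' in the span of the e_j,
    the operator a |-> d a d' has distinct eigenvalues (exists_good_pair), a
    property that depends on the discriminant only, so that d and d' may be
    moved to sections over an etale neighbourhood (exists_split_pair). The
    eigenvalues are simple roots of the characteristic polynomial and extend to
    a neighbourhood, with them the eigenlines, and each eigenline carries an
    idempotent e with e D e of rank one (near_prim_idem). Choosing one such
    idempotent in each block gives a splitting of D near x (near_split): by
    finitely many identities between the idempotents, each of which holds near x
    as soon as it holds at x. The left ideals D e of these idempotents are free
    modules with an action of G whose fibres at geometric points are the
    irreducible representations (split_good), again by calculation with the
    same identities. *)

(** * Formal polynomials and finite presentations *)

Section FormalPolynomials.
Variables (R : comPzRingType) (n : nat).
Local Notation exps := {ffun 'I_n -> nat}.
Local Notation fpol := (fpoly R n).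
Implicit Types (P Q T : fpol) (e : exps).

Lemma fpoly_coefE Q e : fpoly_coef Q e = \sum_(t <- Q) t.1 *+ (t.2 == e).
Proof. by rewrite /fpoly_coef big_mkcond; apply: eq_bigr => t _; case: eqP. Qed.

Lemma fpoly_coef_cat P Q e :
  fpoly_coef (P ++ Q) e = fpoly_coef P e + fpoly_coef Q e.
Proof. by rewrite /fpoly_coef big_cat. Qed.

Lemma fpoly_coef_mul P Q e : fpoly_coef (fpoly_mul P Q) e =
  \sum_(s <- P) \sum_(t <- Q) (s.1 * t.1) *+ ([ffun i => (s.2 i + t.2 i)%N] == e).
Proof. by rewrite fpoly_coefE /fpoly_mul big_allpairs_dep. Qed.

Lemma fpoly_sum_supp (Z : zmodType) (h : R -> exps -> Z) Q (E : seq exps) :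
  (forall e, {morph h^~ e : a b / a + b}) -> uniq E ->
  (forall t, t \in Q -> t.2 \in E) ->
  \sum_(t <- Q) h t.1 t.2 = \sum_(e <- E) h (fpoly_coef Q e) e.
Proof.
move=> hD uE QE.
have h0 e : h 0 e = 0 by apply: (addrI (h 0 e)); rewrite -hD !addr0.
transitivity (\sum_(e <- E) \sum_(t <- Q | t.2 == e) h t.1 t.2).
  rewrite (exchange_big_dep xpredT) //=; apply: eq_big_seq => t /QE tE.
  rewrite big_mkcond (bigD1_seq _ tE uE) /= eqxx big1 ?addr0 // => e.
  by rewrite eq_sym => /negPf ->.
apply: eq_bigr => e _; rewrite /fpoly_coef (big_morph (h^~ e) (hD e) (h0 e)).
by apply: eq_bigr => t /eqP ->.
Qed.

(** Any expression additive in the coefficients factors through the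
    polynomial that a formal sum of terms denotes. *)
Lemma fpoly_sum_eq (Z : zmodType) (h : R -> exps -> Z) P Q :
  (forall e, {morph h^~ e : a b / a + b}) -> fpoly_coef P =1 fpoly_coef Q ->
  \sum_(t <- P) h t.1 t.2 = \sum_(t <- Q) h t.1 t.2.
Proof.
move=> hD PQ; pose E := undup (map snd (P ++ Q)).
have QE (t : R * exps) : t \in P ++ Q -> t.2 \in E.
  by move=> tPQ; rewrite mem_undup; apply/mapP; exists t.
rewrite !(@fpoly_sum_supp _ h _ E) ?undup_uniq //.
- by apply: eq_bigr => e _; rewrite PQ.
- by move=> t tQ; apply: QE; rewrite mem_cat tQ orbT.
- by move=> t tP; apply: QE; rewrite mem_cat tP.
Qed.

Lemma fpoly_mul_eql P P' Q : fpoly_coef P =1 fpoly_coef P' ->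
  fpoly_coef (fpoly_mul P Q) =1 fpoly_coef (fpoly_mul P' Q).
Proof.
move=> PP' e; rewrite !fpoly_coef_mul; apply: (fpoly_sum_eq (h := fun c d =>
  \sum_(t <- Q) (c * t.1) *+ ([ffun i => (d i + t.2 i)%N] == e))) => // d a b.
by rewrite -big_split; apply: eq_bigr => t _; rewrite mulrDl mulrnDl.
Qed.

Lemma ffun_addC (d e : exps) :
  [ffun i => (d i + e i)%N] = [ffun i => (e i + d i)%N].
Proof. by apply/ffunP => i; rewrite !ffunE addnC. Qed.

Lemma fpoly_coef_mulC P Q :
  fpoly_coef (fpoly_mul P Q) =1 fpoly_coef (fpoly_mul Q P).
Proof.
move=> e; rewrite !fpoly_coef_mul exchange_big; apply: eq_bigr => t _.
by apply: eq_bigr => s _; rewrite mulrC ffun_addC.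
Qed.

Lemma fpoly_coef_mulA P Q T : fpoly_coef (fpoly_mul P (fpoly_mul Q T)) =1
  fpoly_coef (fpoly_mul (fpoly_mul P Q) T).
Proof.
move=> e; rewrite !fpoly_coef_mul /fpoly_mul big_allpairs_dep /=.
apply: eq_bigr => s _; rewrite big_allpairs_dep /=.
apply: eq_bigr => t _; apply: eq_bigr => u _; rewrite mulrA; congr (_ *+ (_ == _)).
by apply/ffunP => i; rewrite !ffunE addnA.
Qed.

Definition fpoly_one : fpol := [:: (1, [ffun=> 0%N])].

Lemma fpoly_coef_mul1 P : fpoly_coef (fpoly_mul fpoly_one P) =1 fpoly_coef P.
Proof.
move=> e; rewrite fpoly_coef_mul big_seq1 fpoly_coefE.
apply: eq_bigr => t _; rewrite mul1r; congr (_ *+ (_ == _)).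
by apply/ffunP => i; rewrite !ffunE.
Qed.

Lemma fpoly_coef_mulDl P Q T e : fpoly_coef (fpoly_mul (P ++ Q) T) e =
  fpoly_coef (fpoly_mul P T) e + fpoly_coef (fpoly_mul Q T) e.
Proof. by rewrite !fpoly_coef_mul big_cat. Qed.

Definition fpoly_opp P : fpol := [seq (- t.1, t.2) | t <- P].

Lemma fpoly_coef_opp P e : fpoly_coef (fpoly_opp P) e = - fpoly_coef P e.
Proof.
rewrite !fpoly_coefE big_map -sumrN; apply: eq_bigr => t _.
by rewrite mulNrn.
Qed.

Lemma fpoly_coef_mulN P T e : fpoly_coef (fpoly_mul (fpoly_opp P) T) e =
  - fpoly_coef (fpoly_mul P T) e.
Proof.
rewrite !fpoly_coef_mul big_map -sumrN; apply: eq_bigr => s _ /=.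
by rewrite -sumrN; apply: eq_bigr => t _; rewrite mulNr mulNrn.
Qed.

Lemma fpoly_coef_flatten m (Q : 'I_m -> fpol) e :
  fpoly_coef (flatten [seq Q j | j <- enum 'I_m]) e =
  \sum_(j < m) fpoly_coef (Q j) e.
Proof.
rewrite /fpoly_coef big_flatten big_map big_enum /=.
by apply: eq_bigr.
Qed.

Section Eval.
Variables (A : comPzRingType) (phi : {rmorphism R -> A}) (x : 'I_n -> A).

Lemma fpoly_eval_eq P Q : fpoly_coef P =1 fpoly_coef Q ->
  fpoly_eval phi x P = fpoly_eval phi x Q.
Proof.
move=> PQ; apply: (fpoly_sum_eq
  (h := fun c d => phi c * \prod_(i < n) x i ^+ d i)) => // e a b.
by rewrite rmorphD mulrDl.
Qed.

Lemma fpoly_eval_cat P Q :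
  fpoly_eval phi x (P ++ Q) = fpoly_eval phi x P + fpoly_eval phi x Q.
Proof. by rewrite /fpoly_eval big_cat. Qed.

Lemma fpoly_eval_opp P : fpoly_eval phi x (fpoly_opp P) = - fpoly_eval phi x P.
Proof.
rewrite /fpoly_eval big_map -sumrN; apply: eq_bigr => t _.
by rewrite rmorphN mulNr.
Qed.

Lemma fpoly_eval_mul P Q : fpoly_eval phi x (fpoly_mul P Q) =
  fpoly_eval phi x P * fpoly_eval phi x Q.
Proof.
rewrite /fpoly_eval /fpoly_mul big_allpairs_dep mulr_suml.
apply: eq_bigr => s _; rewrite mulr_sumr; apply: eq_bigr => t _ /=.
rewrite rmorphM mulrACA -big_split /=; congr (_ * _).
by apply: eq_bigr => i _; rewrite ffunE exprD.
Qed.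

Definition fpoly_const (r : R) : fpol := [:: (r, [ffun=> 0%N])].

Lemma fpoly_eval_const r : fpoly_eval phi x (fpoly_const r) = phi r.
Proof.
by rewrite /fpoly_eval big_seq1 big1 ?mulr1 // => i _; rewrite ffunE.
Qed.

Definition fpoly_var (i : 'I_n) : fpol := [:: (1, [ffun j => (j == i : nat)])].

Lemma fpoly_eval_var i : fpoly_eval phi x (fpoly_var i) = x i.
Proof.
rewrite /fpoly_eval big_seq1 rmorph1 mul1r (bigD1 i) //= ffunE eqxx expr1.
by rewrite big1 ?mulr1 // => j ji; rewrite ffunE (negPf ji).
Qed.

Lemma fpoly_eval_flatten m (Q : 'I_m -> fpol) :
  fpoly_eval phi x (flatten [seq Q j | j <- enum 'I_m]) =
  \sum_(j < m) fpoly_eval phi x (Q j).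
Proof. by rewrite /fpoly_eval big_flatten big_map big_enum; apply: eq_bigr. Qed.

End Eval.

Lemma fpoly_eval_comp (A B : comPzRingType) (phi : {rmorphism R -> A})
    (h : {rmorphism A -> B}) (beta : {rmorphism R -> B}) (x : 'I_n -> A) P :
  (forall r, h (phi r) = beta r) ->
  h (fpoly_eval phi x P) = fpoly_eval beta (fun i => h (x i)) P.
Proof.
move=> hphi; rewrite /fpoly_eval rmorph_sum; apply: eq_bigr => t _.
by rewrite rmorphM hphi rmorph_prod; congr (_ * _); apply: eq_bigr => i _;
  rewrite rmorphXn.
Qed.

Lemma eq_fpoly_eval (A : comPzRingType) (phi : {rmorphism R -> A})
    (x y : 'I_n -> A) P : x =1 y -> fpoly_eval phi x P = fpoly_eval phi y P.
Proof.
move=> xy; apply: eq_bigr => t _; congr (_ * _).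
by apply: eq_bigr => i _; rewrite xy.
Qed.

End FormalPolynomials.

(** Quotients of rings of formal polynomials supply the universal solutions of
    finite systems of equations, over rings that may be zero. *)
Section PresentedRing.
Variables (R : comPzRingType) (n m : nat) (P : 'I_m -> fpoly R n).
Local Notation fpol := (fpoly R n).

Definition pres_rel (Q Q' : fpol) := exists H : 'I_m -> fpol, forall e,
  fpoly_coef Q e =
  fpoly_coef Q' e + \sum_(j < m) fpoly_coef (fpoly_mul (H j) (P j)) e.

Definition pres_relb (Q Q' : fpol) : bool := `[< pres_rel Q Q' >].

Lemma pres_rel_coef Q Q' : fpoly_coef Q =1 fpoly_coef Q' -> pres_rel Q Q'.
Proof.
move=> QQ'; exists (fun=> [::]) => e; rewrite QQ' big1 ?addr0 // => j _.
by rewrite fpoly_coef_mul big_nil.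
Qed.

Lemma pres_relb_refl : reflexive pres_relb.
Proof. by move=> Q; apply/asboolP; exact: pres_rel_coef. Qed.

Lemma pres_rel_sym Q Q' : pres_rel Q Q' -> pres_rel Q' Q.
Proof.
case=> H QQ'; exists (fun j => fpoly_opp (H j)) => e; rewrite QQ' -addrA.
rewrite -big_split big1 ?addr0 // => j _ /=.
by rewrite fpoly_coef_mulN subrr.
Qed.

Lemma pres_relb_sym : symmetric pres_relb.
Proof. by move=> Q Q'; apply/asboolP/asboolP; exact: pres_rel_sym. Qed.

Lemma pres_rel_trans Q Q' Q'' :
  pres_rel Q Q' -> pres_rel Q' Q'' -> pres_rel Q Q''.
Proof.
case=> H QQ' [H' QQ'']; exists (fun j => H' j ++ H j) => e.
rewrite QQ' QQ'' -addrA -big_split; congr (_ + _); apply: eq_bigr => j _ /=.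
by rewrite fpoly_coef_mulDl.
Qed.

Lemma pres_relb_trans : transitive pres_relb.
Proof.
move=> Q Q' Q'' /asboolP h1 /asboolP h2; apply/asboolP.
exact: pres_rel_trans h1 h2.
Qed.

Canonical pres_equiv :=
  EquivRel pres_relb pres_relb_refl pres_relb_sym pres_relb_trans.

Definition pres := {eq_quot pres_relb}.
HB.instance Definition _ : EqQuotient _ pres_relb pres := EqQuotient.on pres.
HB.instance Definition _ := Choice.on pres.

Lemma pres_eqP Q Q' : \pi_pres Q = \pi_pres Q' <-> pres_rel Q Q'.
Proof.
split; first by move/eqmodP/asboolP.
by move=> st; apply/eqmodP/asboolP.
Qed.

Lemma pres_reprP Q : pres_rel (repr (\pi_pres Q)) Q.
Proof. by apply/pres_eqP; rewrite reprK. Qed.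

Lemma pres_W (C : pres -> Prop) : (forall Q, C (\pi_pres Q)) -> forall t, C t.
Proof. by move=> Cpi t; rewrite -[t]reprK. Qed.

Definition pres_add (t u : pres) : pres := \pi_pres (repr t ++ repr u).
Definition pres_opp (t : pres) : pres := \pi_pres (fpoly_opp (repr t)).
Definition pres_mul (t u : pres) : pres := \pi_pres (fpoly_mul (repr t) (repr u)).

Lemma pres_rel_cat Q Q' T T' :
  pres_rel Q Q' -> pres_rel T T' -> pres_rel (Q ++ T) (Q' ++ T').
Proof.
case=> H QQ' [H' TT']; exists (fun j => H j ++ H' j) => e.
rewrite !fpoly_coef_cat QQ' TT' addrACA -big_split; congr (_ + _).
by apply: eq_bigr => j _ /=; rewrite fpoly_coef_mulDl.
Qed.

Lemma pres_rel_mull Q Q' T :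
  pres_rel Q Q' -> pres_rel (fpoly_mul Q T) (fpoly_mul Q' T).
Proof.
case=> H QQ'; exists (fun j => fpoly_mul T (H j)) => e.
pose S := flatten [seq fpoly_mul (H j) (P j) | j <- enum 'I_m].
have E : fpoly_coef Q =1 fpoly_coef (Q' ++ S).
  by move=> d; rewrite fpoly_coef_cat fpoly_coef_flatten.
rewrite (fpoly_mul_eql _ E) fpoly_coef_mulDl; congr (_ + _).
rewrite fpoly_coef_mul big_flatten big_map big_enum /=.
apply: eq_bigr => j _; rewrite -fpoly_coef_mul fpoly_coef_mulC.
exact: fpoly_coef_mulA.
Qed.

Lemma pres_rel_mul Q Q' T T' :
  pres_rel Q Q' -> pres_rel T T' -> pres_rel (fpoly_mul Q T) (fpoly_mul Q' T').
Proof.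
move=> QQ' TT'; apply: pres_rel_trans (pres_rel_mull T QQ') _.
apply: pres_rel_trans (pres_rel_coef (fpoly_coef_mulC _ _)) _.
apply: pres_rel_trans (pres_rel_mull Q' TT') _.
exact: (pres_rel_coef (fpoly_coef_mulC _ _)).
Qed.

Lemma pres_addE Q T : pres_add (\pi_pres Q) (\pi_pres T) = \pi_pres (Q ++ T).
Proof. by apply/pres_eqP; apply: pres_rel_cat; exact: pres_reprP. Qed.

Lemma pres_mulE Q T :
  pres_mul (\pi_pres Q) (\pi_pres T) = \pi_pres (fpoly_mul Q T).
Proof. by apply/pres_eqP; apply: pres_rel_mul; exact: pres_reprP. Qed.

Lemma pres_oppE Q : pres_opp (\pi_pres Q) = \pi_pres (fpoly_opp Q).
Proof.
apply/pres_eqP; have [H QH] := pres_reprP Q.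
exists (fun j => fpoly_opp (H j)) => e; rewrite !fpoly_coef_opp QH opprD.
by congr (_ + _); rewrite -sumrN; apply: eq_bigr => j _;
  rewrite fpoly_coef_mulN.
Qed.

Lemma pres_addA : associative pres_add.
Proof.
by elim/pres_W=> Q; elim/pres_W=> T; elim/pres_W=> U; rewrite !pres_addE catA.
Qed.

Lemma pres_addC : commutative pres_add.
Proof.
elim/pres_W=> Q; elim/pres_W=> T; rewrite !pres_addE; apply/pres_eqP.
by apply: pres_rel_coef => e; rewrite !fpoly_coef_cat addrC.
Qed.

Lemma pres_add0 : left_id (\pi_pres [::]) pres_add.
Proof. by elim/pres_W=> Q; rewrite pres_addE. Qed.

Lemma pres_addN : left_inverse (\pi_pres [::]) pres_opp pres_add.
Proof.
elim/pres_W=> Q; rewrite pres_oppE pres_addE; apply/pres_eqP.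
apply: pres_rel_coef => e; rewrite fpoly_coef_cat fpoly_coef_opp addNr.
by rewrite /fpoly_coef big_nil.
Qed.

HB.instance Definition _ :=
  GRing.isZmodule.Build pres pres_addA pres_addC pres_add0 pres_addN.

Lemma pres_mulA : associative pres_mul.
Proof.
elim/pres_W=> Q; elim/pres_W=> T; elim/pres_W=> U; rewrite !pres_mulE.
by apply/pres_eqP; apply: pres_rel_coef; exact: fpoly_coef_mulA.
Qed.

Lemma pres_mulC : commutative pres_mul.
Proof.
elim/pres_W=> Q; elim/pres_W=> T; rewrite !pres_mulE.
by apply/pres_eqP; apply: pres_rel_coef; exact: fpoly_coef_mulC.
Qed.

Lemma pres_mul1 : left_id (\pi_pres (fpoly_one R n)) pres_mul.
Proof.
elim/pres_W=> Q; rewrite pres_mulE.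
by apply/pres_eqP; apply: pres_rel_coef; exact: fpoly_coef_mul1.
Qed.

Lemma pres_mulDl : left_distributive pres_mul +%R.
Proof.
elim/pres_W=> Q; elim/pres_W=> T; elim/pres_W=> U.
rewrite -![_ + _]/(pres_add _ _) !(pres_addE, pres_mulE).
by apply/pres_eqP; apply: pres_rel_coef => e;
  rewrite fpoly_coef_mulDl fpoly_coef_cat.
Qed.

HB.instance Definition _ := GRing.Zmodule_isComPzRing.Build pres
  pres_mulA pres_mulC pres_mul1 pres_mulDl.

Definition pres_str (r : R) : pres := \pi_pres (fpoly_const n r).

Lemma pres_str_additive : zmod_morphism pres_str.
Proof.
move=> a b; apply: (addIr (pres_str b)); rewrite subrK.
rewrite -[_ + _]/(pres_add _ _) pres_addE.
apply/pres_eqP; apply: pres_rel_coef => e.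
rewrite fpoly_coef_cat !fpoly_coefE !big_seq1 /=.
by rewrite -mulrnDl subrK.
Qed.

Lemma pres_str_multiplicative : monoid_morphism pres_str.
Proof.
split=> // a b; rewrite -[RHS]/(pres_mul _ _) pres_mulE; apply/pres_eqP.
apply: pres_rel_coef => e; rewrite fpoly_coef_mul fpoly_coefE !big_seq1 /=.
by congr (_ *+ (_ == _)); apply/ffunP => i; rewrite !ffunE.
Qed.

HB.instance Definition _ := GRing.isZmodMorphism.Build R pres pres_str
  pres_str_additive.
HB.instance Definition _ := GRing.isMonoidMorphism.Build R pres pres_str
  pres_str_multiplicative.

Definition pres_var (i : 'I_n) : pres := \pi_pres (fpoly_var R i).

End PresentedRing.

Section PresentedRingTheory.
Variables (R : comPzRingType) (n m : nat) (P : 'I_m -> fpoly R n).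
Local Notation fpol := (fpoly R n).
Local Notation pi Q := (\pi_(pres P) Q).

Lemma pres_addE' Q T : pi Q + pi T = pi (Q ++ T).
Proof. exact: pres_addE. Qed.

Lemma pres_mulE' Q T : pi Q * pi T = pi (fpoly_mul Q T).
Proof. exact: pres_mulE. Qed.

Definition fpoly_mon (e : {ffun 'I_n -> nat}) : fpol := [:: (1, e)].

Lemma pres_monM d e :
  pi (fpoly_mon d) * pi (fpoly_mon e) = pi (fpoly_mon [ffun i => (d i + e i)%N]).
Proof. by rewrite pres_mulE' /fpoly_mul /= mul1r. Qed.

Lemma pres_varX i k :
  pres_var P i ^+ k = pi (fpoly_mon [ffun j => ((j == i) * k)%N]).
Proof.
elim: k => [|k IHk].
  congr (pi (fpoly_mon _)); apply/ffunP => j; rewrite !ffunE.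
  by rewrite muln0.
rewrite exprS IHk [pres_var P i * _]pres_monM; congr (pi (fpoly_mon _)).
by apply/ffunP => j; rewrite !ffunE mulnS.
Qed.

Lemma pres_monE e :
  pi (fpoly_mon e) = \prod_(i < n) pres_var P i ^+ e i.
Proof.
rewrite -big_enum.
have E s : uniq s -> \prod_(i <- s) pres_var P i ^+ e i =
    pi (fpoly_mon [ffun j => ((j \in s) * e j)%N]).
  elim: s => [_|i s IHs] /=.
    rewrite big_nil -[LHS]/(pi (fpoly_mon [ffun=> 0%N])).
    by congr (pi (fpoly_mon _)); apply/ffunP => j; rewrite !ffunE.
  case/andP=> is_ us; rewrite big_cons IHs // pres_varX pres_monM.
  congr (pi (fpoly_mon _)); apply/ffunP => j; rewrite !ffunE inE.
  by case: eqP => [->|_] //=; rewrite (negPf is_) addn0.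
rewrite E ?enum_uniq //; congr (pi (fpoly_mon _)); apply/ffunP => j.
by rewrite ffunE mem_enum mul1n.
Qed.

Lemma pres_evalE Q : fpoly_eval (@pres_str _ _ _ P) (@pres_var _ _ _ P) Q = pi Q.
Proof.
elim: Q => [|[r e] Q IHQ]; rewrite /fpoly_eval ?big_nil // big_cons.
rewrite -/(fpoly_eval _ _ _) IHQ -pres_monE -cat1s -pres_addE'.
congr (_ + _); rewrite [LHS]pres_mulE' /fpoly_mul /= mulr1.
by congr (pi [:: (_, _)]); apply/ffunP => i; rewrite !ffunE.
Qed.

Lemma pres_eq0 Q : pi Q = 0 <-> exists H : 'I_m -> fpol, forall e,
  fpoly_coef Q e = \sum_(j < m) fpoly_coef (fpoly_mul (H j) (P j)) e.
Proof.
have c0 e : fpoly_coef ([::] : fpol) e = 0 by rewrite /fpoly_coef big_nil.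
by split=> [/pres_eqP|] [H HQ]; [|apply/pres_eqP]; exists H => e;
  rewrite HQ c0 add0r.
Qed.

Lemma pres_var_root j : pi (P j) = 0.
Proof.
apply/pres_eq0; exists (fun i => if i == j then fpoly_one R n else [::]) => e.
rewrite (bigD1 j) //= eqxx fpoly_coef_mul1 big1 ?addr0 // => i /negPf ->.
by rewrite /fpoly_coef big_nil.
Qed.

Section Lift.
Variables (C : comPzRingType) (beta : {rmorphism R -> C}) (y : 'I_n -> C).
Hypothesis Py : forall j, fpoly_eval beta y (P j) = 0.

Lemma fpoly_eval_pres_rel Q Q' : pres_rel P Q Q' ->
  fpoly_eval beta y Q = fpoly_eval beta y Q'.
Proof.
case=> H HQ; pose S := flatten [seq fpoly_mul (H j) (P j) | j <- enum 'I_m].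
rewrite (@fpoly_eval_eq _ _ _ _ _ _ (Q' ++ S)); last first.
  by move=> e; rewrite fpoly_coef_cat fpoly_coef_flatten.
rewrite fpoly_eval_cat fpoly_eval_flatten big1 ?addr0 // => j _.
by rewrite fpoly_eval_mul Py mulr0.
Qed.

Definition pres_lift (t : pres P) : C := fpoly_eval beta y (repr t).

Lemma pres_liftE Q : pres_lift (pi Q) = fpoly_eval beta y Q.
Proof. by apply: fpoly_eval_pres_rel; exact: pres_reprP. Qed.

Lemma pres_lift_additive : zmod_morphism pres_lift.
Proof.
move=> t u; apply: (addIr (pres_lift u)); rewrite subrK.
have D a b : pres_lift (a + b) = pres_lift a + pres_lift b.
  elim/pres_W: a => a; elim/pres_W: b => b.
  by rewrite pres_addE' !pres_liftE fpoly_eval_cat.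
by rewrite -D subrK.
Qed.

Lemma pres_lift_multiplicative : monoid_morphism pres_lift.
Proof.
split.
  rewrite -[RHS](rmorph1 beta) -(fpoly_eval_const beta y) -pres_liftE.
  by [].
elim/pres_W=> a; elim/pres_W=> b.
by rewrite pres_mulE' !pres_liftE fpoly_eval_mul.
Qed.

HB.instance Definition _ := GRing.isZmodMorphism.Build (pres P) C pres_lift
  pres_lift_additive.
HB.instance Definition _ := GRing.isMonoidMorphism.Build (pres P) C pres_lift
  pres_lift_multiplicative.

Lemma pres_lift_exists : exists h : {rmorphism pres P -> C},
  (forall r, h (pres_str P r) = beta r) /\ (forall i, h (pres_var P i) = y i).
Proof.
exists pres_lift; split=> [r|i].
  by rewrite [LHS]pres_liftE fpoly_eval_const.
by rewrite [LHS]pres_liftE fpoly_eval_var.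
Qed.

End Lift.

End PresentedRingTheory.

Definition presents (R A : comPzRingType) (phi : {rmorphism R -> A}) n
    (x : 'I_n -> A) m (P : 'I_m -> fpoly R n) :=
  (forall a, exists Q, fpoly_eval phi x Q = a) /\
  forall Q, fpoly_eval phi x Q = 0 <->
    exists H : 'I_m -> fpoly R n, forall e,
      fpoly_coef Q e = \sum_(j < m) fpoly_coef (fpoly_mul (H j) (P j)) e.

(** The functor of points: maps out of A are the solutions of the system P. *)
Record represents (R A : comPzRingType) (phi : {rmorphism R -> A}) n
    (x : 'I_n -> A) m (P : 'I_m -> fpoly R n) : Prop := Represents {
  rep_sol : forall j, fpoly_eval phi x (P j) = 0;
  rep_ex : forall (C : comPzRingType) (beta : {rmorphism R -> C}) (y : 'I_n -> C),
    (forall j, fpoly_eval beta y (P j) = 0) ->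
    exists h : {rmorphism A -> C},
      (forall r, h (phi r) = beta r) /\ (forall i, h (x i) = y i);
  rep_uniq : forall (C : comPzRingType) (h h' : {rmorphism A -> C}),
    (forall r, h (phi r) = h' (phi r)) -> (forall i, h (x i) = h' (x i)) ->
    h =1 h'
}.

Lemma presents_eq (R A : comPzRingType) (phi : {rmorphism R -> A}) n
    (x : 'I_n -> A) (C : comPzRingType) (h h' : {rmorphism A -> C}) :
  (forall a, exists Q, fpoly_eval phi x Q = a) ->
  (forall r, h (phi r) = h' (phi r)) -> (forall i, h (x i) = h' (x i)) ->
  h =1 h'.
Proof.
move=> xs hh' xx' a; have [Q <-] := xs a.
rewrite (fpoly_eval_comp (beta := h \o phi)) //.
rewrite [RHS](fpoly_eval_comp (beta := h \o phi)); last first.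
  by move=> r; rewrite /= hh'.
exact: eq_fpoly_eval.
Qed.

Lemma presents_pres (R : comPzRingType) n m (P : 'I_m -> fpoly R n) :
  presents (@pres_str _ _ _ P) (@pres_var _ _ _ P) P.
Proof.
split=> [|Q]; last by rewrite pres_evalE; exact: pres_eq0.
by elim/pres_W=> Q; exists Q; exact: pres_evalE.
Qed.

Lemma presents_represents (R A : comPzRingType) (phi : {rmorphism R -> A}) n
    (x : 'I_n -> A) m (P : 'I_m -> fpoly R n) :
  presents phi x P -> represents phi x P.
Proof.
case=> xs xP; split.
- move=> j; apply/xP; apply/(pres_eq0 P); exact: pres_var_root.
- move=> C beta y Py; pose q a := projT1 (cid (xs a)).
  have qE a : fpoly_eval phi x (q a) = a by exact: projT2 (cid (xs a)).
  pose h a := fpoly_eval beta y (q a).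
  have hE Q : h (fpoly_eval phi x Q) = fpoly_eval beta y Q.
    have /xP /(pres_eq0 P) E0 :
        fpoly_eval phi x (q (fpoly_eval phi x Q) ++ fpoly_opp Q) = 0.
      by rewrite fpoly_eval_cat fpoly_eval_opp qE subrr.
    have /pres_eqP /(fpoly_eval_pres_rel Py) := E0.
    rewrite fpoly_eval_cat fpoly_eval_opp [X in _ = X -> _]/fpoly_eval big_nil.
    by move/eqP; rewrite subr_eq0 => /eqP.
  have hB : zmod_morphism h.
    move=> a b; rewrite -{1}[a]qE -{1}[b]qE -fpoly_eval_opp -fpoly_eval_cat hE.
    by rewrite fpoly_eval_cat fpoly_eval_opp.
  have hM : monoid_morphism h.
    split.
      rewrite -(rmorph1 phi) -(fpoly_eval_const phi x) hE.
      by rewrite fpoly_eval_const rmorph1.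
    move=> a b; rewrite -{1}[a]qE -{1}[b]qE -fpoly_eval_mul hE.
    by rewrite fpoly_eval_mul.
  pose hZ := GRing.isZmodMorphism.Build A C h hB.
  pose hR := GRing.isMonoidMorphism.Build A C h hM.
  pose H : {rmorphism A -> C} := HB.pack h hZ hR.
  exists H; split=> [r|i] /=.
    by rewrite -(fpoly_eval_const phi x) hE fpoly_eval_const.
  by rewrite -{1}(fpoly_eval_var phi x) hE fpoly_eval_var.
- by move=> C h h'; exact: presents_eq.
Qed.

Lemma represents_presents (R A : comPzRingType) (phi : {rmorphism R -> A}) n
    (x : 'I_n -> A) m (P : 'I_m -> fpoly R n) :
  represents phi x P -> presents phi x P.
Proof.
move=> rep; have [xP xe xu] := rep.
have rP j : fpoly_eval (@pres_str _ _ _ P) (@pres_var _ _ _ P) (P j) = 0.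
  by rewrite pres_evalE; exact: pres_var_root.
have [g [g1 g2]] := xe _ _ _ rP.
have [h [h1 h2]] := pres_lift_exists xP.
have hg : h \o g =1 (idfun : {rmorphism A -> A}).
  by apply: xu => [r|i] /=; rewrite ?g1 ?h1 ?g2 ?h2.
split=> [a|Q].
  move: (hg a) => /= <-; elim/pres_W: (g a) => Q; exists Q.
  rewrite -pres_evalE (fpoly_eval_comp (beta := phi)) //.
  exact: eq_fpoly_eval.
rewrite -pres_eq0 -pres_evalE; split=> [Q0|Q0].
  rewrite -(eq_fpoly_eval _ _ g2) -(fpoly_eval_comp (phi := phi)) // Q0.
  exact: rmorph0.
rewrite -(eq_fpoly_eval _ _ h2) -(fpoly_eval_comp (phi := @pres_str _ _ _ P)) //.
by rewrite Q0 rmorph0.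
Qed.

(** Generators and relations against the functor of points: the second form is
    the one in which composition of presentations and the construction of maps
    are a matter of solving equations. *)
Lemma finitely_presentedP (R A : comPzRingType) (phi : {rmorphism R -> A}) :
  finitely_presented_hom phi <->
  exists n (x : 'I_n -> A) m (P : 'I_m -> fpoly R n), represents phi x P.
Proof.
split=> -[n [x [m [P xP]]]]; exists n, x, m, P.
  exact: presents_represents.
by have [] := represents_presents xP.
Qed.

(** * Flat, finitely presented, formally etale homomorphisms compose *)

Lemma split_lshift m n (i : 'I_m) : split (lshift n i) = inl i.
Proof. exact: (unsplitK (inl i)). Qed.

Lemma split_rshift m n (i : 'I_n) : split (rshift m i) = inr i.
Proof. exact: (unsplitK (inr i)). Qed.

(** The relations of S over R, together with those of T over S in which each
    coefficient is replaced by a polynomial over R that represents it. *)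
Lemma fpresented_comp (R S T : comPzRingType) (phi : {rmorphism R -> S})
    (psi : {rmorphism S -> T}) :
  finitely_presented_hom phi -> finitely_presented_hom psi ->
  finitely_presented_hom (psi \o phi).
Proof.
case/finitely_presentedP=> n [x [m [P xP]]].
case/finitely_presentedP=> n' [x' [m' [P' xP']]].
apply/finitely_presentedP.
have [xs _] := represents_presents xP.
pose q s := projT1 (cid (xs s)).
have qE s : fpoly_eval phi x (q s) = s by exact: projT2 (cid (xs s)).
pose z (i : 'I_(n + n')) : T :=
  match split i with inl a => psi (x a) | inr b => x' b end.
pose inexp (d : {ffun 'I_n -> nat}) (e : {ffun 'I_n' -> nat}) :
    {ffun 'I_(n + n') -> nat} :=
  [ffun i : 'I_(n + n') => match split i with inl a => d a | inr b => e b end].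
pose lif (s : S) (e : {ffun 'I_n' -> nat}) : fpoly R (n + n') :=
  [seq (t.1, inexp t.2 e) | t <- q s].
pose Pl j : fpoly R (n + n') := [seq (t.1, inexp t.2 [ffun=> 0%N]) | t <- P j].
pose Pr j : fpoly R (n + n') := flatten [seq lif t.1 t.2 | t <- P' j].
pose PP (j : 'I_(m + m')) :=
  match split j with inl a => Pl a | inr b => Pr b end.
have monE (C : comPzRingType) (y : 'I_(n + n') -> C) d e :
    \prod_(i < n + n') y i ^+ inexp d e i =
    (\prod_(i < n) y (lshift n' i) ^+ d i) *
    (\prod_(i < n') y (rshift n i) ^+ e i).
  rewrite big_split_ord /=; congr (_ * _); apply: eq_bigr => i _.
    by rewrite ffunE split_lshift.
  by rewrite ffunE split_rshift.
have PlE (C : comPzRingType) (beta : {rmorphism R -> C}) y j :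
    fpoly_eval beta y (Pl j) = fpoly_eval beta (fun i => y (lshift n' i)) (P j).
  rewrite /fpoly_eval big_map; apply: eq_bigr => t _ /=; rewrite monE.
  by rewrite [X in _ * (_ * X)]big1 ?mulr1 // => i _; rewrite ffunE.
have PrE (C : comPzRingType) (h : {rmorphism S -> C}) (beta : {rmorphism R -> C})
    (y : 'I_(n + n') -> C) j :
    (forall r, h (phi r) = beta r) -> (forall i, h (x i) = y (lshift n' i)) ->
    fpoly_eval beta y (Pr j) = fpoly_eval h (fun i => y (rshift n i)) (P' j).
  move=> hphi hx; rewrite /fpoly_eval big_flatten big_map.
  apply: eq_bigr => t _ /=; rewrite -{2}(qE t.1) (fpoly_eval_comp (beta := beta)) //.
  rewrite (eq_fpoly_eval _ _ hx) /fpoly_eval big_map mulr_suml.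
  by apply: eq_bigr => u _ /=; rewrite monE mulrA.
have zl i : z (lshift n' i) = psi (x i).
  by rewrite /z split_lshift.
have zr i : z (rshift n i) = x' i.
  by rewrite /z split_rshift.
exists (n + n')%N, z, (m + m')%N, PP; split.
- move=> j; rewrite /PP; case: (split j) => a.
    rewrite PlE (eq_fpoly_eval _ _ zl) -(fpoly_eval_comp (phi := phi)) //.
    by rewrite (rep_sol xP) rmorph0.
  rewrite (PrE _ psi) // (eq_fpoly_eval _ _ zr).
  exact: (rep_sol xP').
- move=> C beta y yPP.
  have yl j : fpoly_eval beta (fun i => y (lshift n' i)) (P j) = 0.
    by rewrite -PlE; have := yPP (lshift m' j); rewrite /PP split_lshift.
  have [h [h1 h2]] := rep_ex xP yl.
  have yr j : fpoly_eval h (fun i => y (rshift n i)) (P' j) = 0.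
    rewrite -(PrE _ _ beta) //; have := yPP (rshift m j).
    by rewrite /PP split_rshift.
  have [h' [h1' h2']] := rep_ex xP' yr.
  exists h'; split=> [r|i] /=; first by rewrite h1' h1.
  rewrite /z; case: split_ordP => k ->; first by rewrite h1' h2.
  exact: h2'.
- move=> C h h' hh' zz'; apply: (rep_uniq xP') => [s|i]; last by rewrite -zr zz'.
  apply: (rep_uniq xP (h := h \o psi) (h' := h' \o psi)) => [r|i] /=.
    exact: hh'.
  by rewrite -zl zz'.
Qed.

(** Lift first along S, then along T over the lifted structure map. *)
Lemma formally_etale_comp (R S T : comPzRingType) (phi : {rmorphism R -> S})
    (psi : {rmorphism S -> T}) :
  formally_etale phi -> formally_etale psi -> formally_etale (psi \o phi).
Proof.
move=> ephi epsi B C beta pi f pis pi2 fE lifts.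
have [[h1 [h1b h1p]] u1] := ephi B C beta pi (f \o psi) pis pi2 fE.
have [[h [hb hp]] u2] := epsi B C h1 pi f pis pi2 (fun s => esym (h1p s)).
split; first by exists h; split=> // r; rewrite /= hb h1b.
move=> g g' [gb gp] [gb' gp'].
have E s : g (psi s) = g' (psi s).
  apply: (u1 (g \o psi) (g' \o psi)); split=> x; first exact: gb.
  - exact: gp.
  - exact: gb'.
  - exact: gp'.
have [[h2 [hb2 hp2]] u3] := epsi B C (g \o psi) pi f pis pi2
  (fun s => esym (gp (psi s))).
by apply: u3; split=> // s /=; rewrite E.
Qed.

(** Associativity M (x)_R T = (S (x)_R M) (x)_S T: it carries an injection over
    R first to S and then to T, so that flatness composes. *)
Section TensorAssoc.
Variables (R S T : comPzRingType) (phi : {rmorphism R -> S}).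
Variables (psi : {rmorphism S -> T}) (M : lmodType R).
Local Notation L := (tensor M (alg (psi \o phi))).
Local Notation E := (tensor (ext phi M) (alg psi)).

Definition tassoc (t : L) : E :=
  tlift (fun (m : M) (c : alg (psi \o phi)) => etens phi 1 m *t (c : alg psi)) t.

Lemma balanced_tassoc : balanced
  (fun (m : M) (c : alg (psi \o phi)) => etens phi 1 m *t (c : alg psi)).
Proof.
split=> [m m' c|m c c'|a m c].
- by rewrite etensDr tensDl.
- exact: (@tensDr S (ext phi M) (alg psi)).
by rewrite -etensZ -scale_etens tensZ.
Qed.

Lemma tassocE m c : tassoc (m *t c) = etens phi 1 m *t (c : alg psi).
Proof. exact: tlift_tens balanced_tassoc. Qed.

Lemma tassocD : {morph tassoc : t u / t + u}.
Proof. by move=> t u; exact: tliftD balanced_tassoc. Qed.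

Definition tassoc_inner (c : T) (e : ext phi M) : L :=
  @tlift R (alg phi) M _ (fun (s : S) m => m *t (psi s * c : alg (psi \o phi))) e.

Lemma balanced_tassoc_inner c : @balanced R (alg phi) M _
  (fun (s : S) m => m *t (psi s * c : alg (psi \o phi))).
Proof.
apply: balanced_ext => [s s' m|s m m'|r s m].
- by rewrite rmorphD mulrDl -tensDr.
- exact: tensDl.
by rewrite rmorphM -mulrA tensZ.
Qed.

Definition tassocV (t : E) : L :=
  tlift (fun (e : ext phi M) (c : alg psi) => tassoc_inner c e) t.

Lemma balanced_tassocV :
  balanced (fun (e : ext phi M) (c : alg psi) => tassoc_inner c e).
Proof.
split=> [e e' c|e c c'|a e c].
- by apply: tliftD; exact: balanced_tassoc_inner.
- by rewrite /tassoc_inner -tliftfD; apply: eq_tlift => s m;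
    rewrite mulrDr -tensDr.
move: e; apply: ext_eq => [x y|x y|s m].
- by rewrite scalerDr; apply: tliftD; exact: balanced_tassoc_inner.
- by apply: tliftD; exact: balanced_tassoc_inner.
rewrite scale_etens /tassoc_inner !tlift_tens; last 2 first.
- exact: balanced_tassoc_inner.
- exact: balanced_tassoc_inner.
by congr (m *t _); rewrite alg_scaleE rmorphM mulrCA mulrA.
Qed.

Lemma tassocK : cancel tassoc tassocV.
Proof.
apply: (@tensor_eq R M (alg (psi \o phi))) => [x y|//|m c].
  by rewrite tassocD; exact: tliftD balanced_tassocV.
rewrite tassocE /tassocV tlift_tens; last exact: balanced_tassocV.
rewrite /tassoc_inner tlift_tens; last exact: balanced_tassoc_inner.
by rewrite rmorph1 mul1r.
Qed.

End TensorAssoc.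

Section ExtMap.
Variables (R S : comPzRingType) (phi : {rmorphism R -> S}).
Variables (M N : lmodType R) (f : {linear M -> N}).

Definition ext_map (t : ext phi M) : ext phi N :=
  @tlift R (alg phi) M _ (fun (s : S) m => etens phi s (f m)) t.

Lemma balanced_ext_map :
  @balanced R (alg phi) M _ (fun (s : S) m => etens phi s (f m)).
Proof.
apply: balanced_ext => [s s' m|s m m'|r s m].
- exact: etensDl.
- by rewrite linearD etensDr.
by rewrite linearZ etensZ.
Qed.

Lemma ext_mapE s m : ext_map (etens phi s m) = etens phi s (f m).
Proof. exact: tlift_tens balanced_ext_map. Qed.

Lemma ext_mapD : {morph ext_map : t u / t + u}.
Proof. by move=> t u; exact: tliftD balanced_ext_map. Qed.

Lemma ext_map_linear : linear ext_map.
Proof.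
move=> s t u; rewrite ext_mapD; congr (_ + _); move: t.
apply: ext_eq => [x y|x y|s' m].
- by rewrite scalerDr ext_mapD.
- by rewrite ext_mapD scalerDr.
by rewrite scale_etens !ext_mapE scale_etens.
Qed.

HB.instance Definition _ :=
  GRing.isLinear.Build S (ext phi M) (ext phi N) _ ext_map ext_map_linear.

Lemma balanced_tmapl (P : lmodType R) :
  balanced (fun (m : M) (p : P) => f m *t p).
Proof.
split=> [m m' p|m p p'|a m p].
- by rewrite linearD tensDl.
- exact: tensDr.
by rewrite linearZ tensZ.
Qed.

(** Flatness is stated with the algebra as right factor and scalar extension
    has it as left factor. *)
Lemma flat_ext_inj : flat_hom phi -> injective f -> injective ext_map.
Proof.
move=> fphi finj.
pose sw (Q : lmodType R) (t : ext phi Q) : tensor Q (alg phi) :=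
  @tlift R (alg phi) Q _ (fun (s : alg phi) m => m *t s) t.
have bsw Q : @balanced R (alg phi) Q _ (fun (s : alg phi) m => m *t s).
  exact: balanced_flip (tens_balanced _ _).
pose ws (Q : lmodType R) (t : tensor Q (alg phi)) : ext phi Q :=
  tlift (fun m (s : alg phi) => etens phi s m) t.
have bws Q : @balanced R Q (alg phi) _ (fun m (s : alg phi) => etens phi s m).
  exact: balanced_flip (tens_balanced (alg phi) Q).
have swK Q : cancel (@sw Q) (@ws Q).
  apply: ext_eq => [x y|//|s m].
    by rewrite /sw tliftD // /ws tliftD.
  by rewrite /sw /etens tlift_tens // /ws tlift_tens.
have E t : sw N (ext_map t) =
    tlift (fun (m : M) (a : alg phi) => f m *t a) (sw M t).
  move: t; apply: ext_eq => [x y|x y|s m].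
  - by rewrite ext_mapD /sw tliftD.
  - by rewrite /sw tliftD // tliftD //; exact: balanced_tmapl.
  rewrite ext_mapE /sw tlift_tens // tlift_tens // tlift_tens //.
  exact: balanced_tmapl.
move=> t u /(congr1 (@sw N)); rewrite !E => /(fphi _ _ _ finj) /(congr1 (@ws M)).
by rewrite !swK.
Qed.

End ExtMap.

Lemma flat_comp (R S T : comPzRingType) (phi : {rmorphism R -> S})
    (psi : {rmorphism S -> T}) :
  flat_hom phi -> flat_hom psi -> flat_hom (psi \o phi).
Proof.
move=> fphi fpsi M N f finj t u /(congr1 (@tassoc _ _ _ phi psi N)) tu.
apply: (can_inj (@tassocK _ _ _ phi psi M)).
have := fpsi _ _ (@ext_map _ _ phi _ _ f : {linear _ -> _})
  (flat_ext_inj fphi finj); apply.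
have E v : tlift (fun (m : ext phi M) (a : alg psi) => ext_map f m *t a)
    (tassoc v) =
    tassoc (tlift (fun (m : M) (a : alg (psi \o phi)) => f m *t a) v).
  have bm := @balanced_tmapl R M N f (alg (psi \o phi)).
  have bm' := @balanced_tmapl S _ _ (@ext_map _ _ phi _ _ f : {linear _ -> _})
    (alg psi).
  move: v; apply: tensor_eq => [x y|x y|m c].
  - by rewrite tassocD tliftD.
  - by rewrite tliftD // tassocD.
  by rewrite tassocE tlift_tens //= ext_mapE tlift_tens // tassocE.
by rewrite !E.
Qed.

(** An etale homomorphism is flat by a deep theorem; the maps from which the
    coverings are made are flat for elementary reasons, which the definition
    carries along. *)
Definition flat_etale (R S : comPzRingType) (phi : {rmorphism R -> S}) :=
  flat_hom phi /\ etale_hom phi.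

Lemma flat_etale_comp (R S T : comPzRingType) (phi : {rmorphism R -> S})
    (psi : {rmorphism S -> T}) :
  flat_etale phi -> flat_etale psi -> flat_etale (psi \o phi).
Proof.
move=> [f1 [p1 e1]] [f2 [p2 e2]]; split; first exact: flat_comp.
by split; [exact: fpresented_comp | exact: formally_etale_comp].
Qed.

(** * Localization at one element *)

Section EventualSequences.
Variable N : zmodType.

Definition nseqs : Type := nat -> N.
HB.instance Definition _ := gen_eqMixin nseqs.
HB.instance Definition _ := gen_choiceMixin nseqs.

Definition nseqs_add (u v : nseqs) : nseqs := fun i => u i + v i.
Definition nseqs_opp (u : nseqs) : nseqs := fun i => - u i.
Definition nseqs_zero : nseqs := fun=> 0.

Lemma nseqs_addA : associative nseqs_add.
Proof. by move=> u v w; apply/funext => i; rewrite /nseqs_add addrA. Qed.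
Lemma nseqs_addC : commutative nseqs_add.
Proof. by move=> u v; apply/funext => i; rewrite /nseqs_add addrC. Qed.
Lemma nseqs_add0 : left_id nseqs_zero nseqs_add.
Proof. by move=> u; apply/funext => i; rewrite /nseqs_add add0r. Qed.
Lemma nseqs_addN : left_inverse nseqs_zero nseqs_opp nseqs_add.
Proof. by move=> u; apply/funext => i; rewrite /nseqs_add addNr. Qed.

HB.instance Definition _ :=
  GRing.isZmodule.Build nseqs nseqs_addA nseqs_addC nseqs_add0 nseqs_addN.

Definition ev0 : pred nseqs :=
  fun u => `[< exists k, forall i, (k <= i)%N -> u i = 0 >].

Lemma ev0_closed : zmod_closed ev0.
Proof.
split=> [|u v /asboolP [k uk] /asboolP [l vl]]; first by apply/asboolP; exists 0.
apply/asboolP; exists (maxn k l) => i; rewrite geq_max => /andP [ki li].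
by rewrite -[LHS]/(u i - v i) uk // vl // subr0.
Qed.

HB.instance Definition _ := GRing.isZmodClosed.Build nseqs ev0 ev0_closed.

Definition ev0_sub : zmodClosed nseqs :=
  GRing.ZmodClosed.clone nseqs ev0 _.

(** Sequences modulo eventual equality: the module localized at s embeds here,
    m / s^j being sent to the germ of i |-> s^(i-j) m. *)
Definition germs : zmodType := @Quotient.quot nseqs ev0_sub.
Definition germ (u : nseqs) : germs := \pi_(@Quotient.quot nseqs ev0_sub) u.

Lemma germ_eq u v : germ u = germ v <->
  exists k, forall i, (k <= i)%N -> u i = v i.
Proof.
rewrite /germ; split=> [/eqP|[k uv]].
  rewrite -Quotient.idealrBE => /asboolP [k uv]; exists k => i /uv.
  by move/eqP; rewrite -[_ i]/(u i - v i) subr_eq0 => /eqP.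
apply/eqP; rewrite -Quotient.idealrBE; apply/asboolP; exists k => i /uv E.
by rewrite -[LHS]/(u i - v i) E subrr.
Qed.

Lemma germD u v : germ (u + v) = germ u + germ v.
Proof. by rewrite /germ; exact: raddfD. Qed.

Lemma germ0 : germ 0 = 0. Proof. exact: raddf0. Qed.

End EventualSequences.

Section Localization.
Variables (R : comPzRingType) (s : R).

Definition loc_rel (_ : 'I_1) : fpoly R 1 :=
  [:: (s, [ffun=> 1%N]); (- 1, [ffun=> 0%N])].

Definition loc : comPzRingType := pres loc_rel.
Definition loc_map : {rmorphism R -> loc} := @pres_str _ _ _ loc_rel.
Definition loc_inv : loc := pres_var loc_rel ord0.
Local Notation v := loc_inv.

Lemma loc_rel_eval (C : comPzRingType) (beta : {rmorphism R -> C}) y j :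
  fpoly_eval beta y (loc_rel j) = beta s * y ord0 - 1.
Proof.
rewrite /fpoly_eval !big_cons big_nil addr0 !big_ord_recl !big_ord0 /= !ffunE.
by rewrite !mulr1 rmorphN rmorph1.
Qed.

Lemma loc_represents : represents loc_map (fun=> v) loc_rel.
Proof.
apply: presents_represents; have [H1 H2] := presents_pres loc_rel.
have E : pres_var loc_rel =1 (fun=> v) by move=> i; rewrite (ord1 i).
by split=> [a|Q]; [have [Q <-] := H1 a; exists Q|rewrite -H2];
  rewrite -(eq_fpoly_eval _ _ E).
Qed.

Lemma loc_mulV : loc_map s * v = 1.
Proof.
have /eqP := rep_sol loc_represents ord0.
by rewrite loc_rel_eval subr_eq0 => /eqP.
Qed.

Lemma loc_mulVX k : loc_map s ^+ k * v ^+ k = 1.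
Proof. by rewrite -exprMn loc_mulV expr1n. Qed.

Lemma loc_fraction x : exists a j, x = loc_map a * v ^+ j.
Proof.
have [xs _] := represents_presents loc_represents; have [Q <-] := xs x.
elim: Q => [|[r e] Q [a [j IHQ]]].
  by exists 0, 0; rewrite /fpoly_eval big_nil rmorph0 mul0r.
rewrite /fpoly_eval big_cons -/(fpoly_eval _ _ _) IHQ big_ord1.
rewrite -[_ + _]/(loc_map r * v ^+ e ord0 + _).
exists (r * s ^+ j + a * s ^+ (e ord0)), (e ord0 + j)%N.
rewrite rmorphD !rmorphM !rmorphXn mulrDl exprD; congr (_ + _).
  by rewrite -mulrA; congr (_ * _); rewrite mulrCA loc_mulVX mulr1.
by rewrite -mulrA; congr (_ * _); rewrite mulrA loc_mulVX mul1r.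
Qed.

(** If a = (s X - 1) H in R[X], the coefficients of H are - a s^k, so that
    s^k a vanishes beyond the degree of H. *)
Lemma loc_map_eq0 a : loc_map a = 0 -> exists k, s ^+ k * a = 0.
Proof.
move/(pres_eq0 loc_rel) => [H HE]; pose ek k : {ffun 'I_1 -> nat} := [ffun=> k].
pose c k := fpoly_coef (H ord0) (ek k).
have ekE (d : {ffun 'I_1 -> nat}) k : (d == ek k) = (d ord0 == k).
  apply/eqP/eqP => [->|<-]; first by rewrite ffunE.
  by apply/ffunP => i; rewrite ffunE (ord1 i).
have E e : fpoly_coef (fpoly_mul (H ord0) (loc_rel ord0)) e =
    \sum_(t <- H ord0) (t.1 * s) *+ ((t.2 ord0).+1 == e ord0) - fpoly_coef (H ord0) e.
  rewrite fpoly_coef_mul fpoly_coefE -sumrB; apply: eq_bigr => t _.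
  rewrite !big_cons big_nil addr0 /= mulrN1 mulNrn.
  have -> : e = ek (e ord0) by apply/eqP; rewrite ekE.
  by rewrite !ekE !ffunE addn1 addn0.
have E0 : a = - c 0.
  have := HE (ek 0); rewrite big_ord1 E ffunE /= => EE.
  rewrite fpoly_coefE big_seq1 /= eqxx mulr1n in EE.
  by rewrite EE big1 ?sub0r // => t _; rewrite mulr0n.
have ES k : c k.+1 = c k * s.
  have := HE (ek k.+1); rewrite big_ord1 E ffunE fpoly_coefE big_seq1.
  have -> : ([ffun=> 0%N] == ek k.+1) = false by rewrite ekE ffunE.
  move/esym/eqP; rewrite mulr0n subr_eq0 -/(c _) => /eqP <-.
  rewrite /c fpoly_coefE mulr_suml; apply: eq_bigr => t _.
  by rewrite eqSS mulrnAl ekE.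
have cE k : c k = - (a * s ^+ k).
  elim: k => [|k IHk]; first by rewrite mulr1 E0 opprK.
  by rewrite ES IHk mulNr exprSr mulrA.
exists (\sum_(t <- H ord0) t.2 ord0).+1; apply/eqP; rewrite mulrC -oppr_eq0 -cE.
apply/eqP; rewrite /c fpoly_coefE big1_seq // => t /= tH; rewrite ekE.
rewrite ltn_eqF ?mulr0n // ltnS (big_rem t) //=; exact: leq_addr.
Qed.

(** An inverse modulo an ideal of square zero is corrected to an inverse:
    with z = 1 - s b and z^2 = 0, the element b (1 + z) is one. *)
Lemma loc_formally_etale : formally_etale loc_map.
Proof.
move=> B C beta pi f pis pi2 fE /=.
have [b pib] := pis (f v).
have u : exists b', beta s * b' = 1.
  pose z := 1 - beta s * b.
  have z2 : z * z = 0.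
    apply: pi2; rewrite /z rmorphB rmorph1 rmorphM pib -fE -rmorphM loc_mulV;
    by rewrite rmorph1 subrr.
  exists (b * (1 + z)); rewrite mulrA.
  have -> : beta s * b = 1 - z by rewrite /z subKr.
  by rewrite mulrDr mulr1 mulrBl mul1r z2 subr0 subrK.
have [b' ub'] := u.
have [|h [h1 h2]] := rep_ex loc_represents (beta := beta) (y := fun=> b').
  by move=> j; rewrite loc_rel_eval ub' subrr.
split.
  exists h; split=> // a.
  apply: (rep_uniq loc_represents (h := pi \o h)) => [r|_] /=.
    by rewrite h1 fE.
  rewrite (h2 ord0) -[LHS]mulr1 -(rmorph1 f) -loc_mulV rmorphM mulrA fE.
  by rewrite -rmorphM [b' * _]mulrC ub' rmorph1 mul1r.
move=> g g' [g1 _] [g1' _]; apply: (rep_uniq loc_represents) => [r|_].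
  by rewrite g1 g1'.
rewrite -[LHS]mulr1 -(rmorph1 g') -loc_mulV rmorphM g1' -g1 mulrA -rmorphM.
by rewrite [v * _]mulrC loc_mulV rmorph1 mul1r.
Qed.

Section LocFlat.
Variable N : lmodType R.

Let num x : R := projT1 (cid (loc_fraction x)).
Let den x : nat := projT1 (cid (projT2 (cid (loc_fraction x)))).
Let numE x : x = loc_map (num x) * v ^+ den x.
Proof. exact: projT2 (cid (projT2 (cid (loc_fraction x)))). Qed.

Definition loc_germ (n : N) (x : alg loc_map) : germs N :=
  germ ((fun i => (s ^+ (i - den x) * num x) *: n) : nseqs N).

Lemma loc_germE (n : N) a j (x : loc) : x = loc_map a * v ^+ j ->
  loc_germ n x = germ ((fun i => (s ^+ (i - j) * a) *: n) : nseqs N).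
Proof.
move=> xE; apply/germ_eq; pose l := (den x + j)%N.
have : loc_map (s ^+ j * num x - s ^+ den x * a) = 0.
  apply/eqP; rewrite rmorphB !rmorphM !rmorphXn subr_eq0; apply/eqP.
  have := numE x; rewrite {1}xE.
  move/(congr1 (fun y => y * (loc_map s ^+ j * loc_map s ^+ den x))).
  rewrite -mulrA [v ^+ j * _]mulrA [v ^+ j * _]mulrC loc_mulVX mul1r.
  rewrite -[RHS]mulrA [v ^+ _ * _]mulrCA [v ^+ _ * _]mulrC loc_mulVX mulr1.
  by rewrite mulrC => ->; rewrite mulrC.
case/loc_map_eq0=> k kE; exists (k + den x + j)%N => i ki.
congr (_ *: n); apply/eqP; rewrite -subr_eq0.
have -> : (i - den x = (i - (k + den x + j)) + (k + j))%N by lia.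
have -> : (i - j = (i - (k + den x + j)) + (k + den x))%N by lia.
rewrite !exprD -!mulrA -mulrBr -mulrBr.
by rewrite kE mulr0.
Qed.

Lemma loc_germ_balanced : balanced loc_germ.
Proof.
split=> [n n' x|n x y|a n x].
- by rewrite -germD; congr germ; apply/funext => i; rewrite /= scalerDr.
- rewrite (@loc_germE n (num x * s ^+ den y + num y * s ^+ den x)
    (den x + den y)); last first.
    rewrite {1}[x]numE {1}[y]numE rmorphD !rmorphM !rmorphXn mulrDl exprD.
    congr (_ + _).
      by rewrite -mulrA [X in _ = _ * X]mulrCA loc_mulVX mulr1.
    by rewrite -mulrA [X in _ = _ * X]mulrA loc_mulVX mul1r.
  rewrite -germD; apply/germ_eq; exists (den x + den y)%N => i xyi.
  rewrite -[RHS]/(_ *: n + _ *: n) -scalerDl mulrDr; congr ((_ + _) *: _).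
    rewrite mulrCA mulrC -exprD; congr (s ^+ _ * _); lia.
  rewrite mulrCA mulrC -exprD; congr (s ^+ _ * _); lia.
rewrite (@loc_germE n (a * num x) (den x) (a *: x)).
  by congr germ; apply/funext => i; rewrite scalerA mulrCA mulrC.
by rewrite alg_scaleE {1}[x]numE rmorphM mulrA.
Qed.

(** The map to germs detects when a fraction of N (x) R_s vanishes, which the
    tensor product does not show by itself. *)
Lemma loc_tensor_eq0 (n : N) j : n *t (v ^+ j : alg loc_map) = 0 ->
  exists k, s ^+ k *: n = 0.
Proof.
move/(congr1 (tlift loc_germ)).
rewrite tlift_tens ?tlift0; try exact: loc_germ_balanced.
rewrite (@loc_germE n 1 j) ?rmorph1 ?mul1r // -germ0 => /germ_eq [k kE].
by exists (k - j)%N; have := kE k (leqnn k); rewrite mulr1.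
Qed.

Lemma loc_tensor_fraction (t : tensor N (alg loc_map)) :
  exists n j, t = n *t (v ^+ j : alg loc_map).
Proof.
elim/tensor_ind: t => [|n x|_ _ [n [j ->]] [n' [j' ->]]].
- by exists 0, 0; apply: (addrI (0 *t (v ^+ 0 : alg loc_map)));
    rewrite -tensDl !addr0.
- have [a [j ->]] := loc_fraction x; exists (a *: n), j.
  by rewrite tensZ.
exists (s ^+ j' *: n + s ^+ j *: n'), (j + j')%N; rewrite tensDl !tensZ.
congr (_ *t _ + _ *t _); rewrite alg_scaleE rmorphXn exprD.
  by rewrite mulrCA loc_mulVX mulr1.
by rewrite mulrA loc_mulVX mul1r.
Qed.

End LocFlat.

Lemma loc_flat : flat_hom loc_map.
Proof.
move=> M N f finj t u E; apply/eqP; rewrite -subr_eq0; apply/eqP.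
have bf := @balanced_tmapl R M N f (alg loc_map).
have : tlift (fun m (a : alg loc_map) => f m *t a) (t - u) = 0.
  apply: (addIr (tlift (fun m (a : alg loc_map) => f m *t a) u)).
  by rewrite -tliftD // subrK add0r.
have [m [j ->]] := loc_tensor_fraction (t - u).
rewrite tlift_tens // => /loc_tensor_eq0 [k].
rewrite -linearZ -(linear0 f) => /finj km.
have E' : (v ^+ j : alg loc_map) = s ^+ k *: (v ^+ (k + j) : alg loc_map).
  by rewrite alg_scaleE rmorphXn exprD mulrA loc_mulVX mul1r.
rewrite E' -tensZ km; apply: (addrI (0 *t (v ^+ (k + j) : alg loc_map))).
by rewrite -tensDl !addr0.
Qed.

Lemma loc_flat_etale : flat_etale loc_map.
Proof.
split; [exact: loc_flat|split; last exact: loc_formally_etale].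
apply/finitely_presentedP; exists 1%N, (fun=> v), 1%N, loc_rel.
exact: loc_represents.
Qed.

Lemma loc_lift (C : comPzRingType) (beta : {rmorphism R -> C}) (c : C) :
  beta s * c = 1 ->
  exists h : {rmorphism loc -> C}, forall r, h (loc_map r) = beta r.
Proof.
move=> sc; have [|h [h1 _]] :=
  rep_ex loc_represents (beta := beta) (y := fun=> c).
  by move=> j; rewrite loc_rel_eval sc subrr.
by exists h.
Qed.

End Localization.

(** * Adjoining a simple root of a monic polynomial *)

(** A statement about possibly trivial rings follows from its cases of the
    zero ring and of the nontrivial rings, over which polynomials exist. *)
Lemma comPzRing_ind (P : comPzRingType -> Prop) :
  (forall C : comPzRingType, (1 : C) = 0 -> P C) ->
  (forall C : comNzRingType, P C) -> forall C, P C.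
Proof.
move=> P0 P1 C; have [C0|/eqP C1] := pselect ((1 : C) = 0); first exact: P0.
pose D : comNzRingType :=
  HB.pack (GRing.ComPzRing.sort C) (GRing.ComPzRing.class C)
    (GRing.PzSemiRing_isNonZero.Build (GRing.ComPzRing.sort C) C1).
have := P1 D; rewrite /D; clear; by case: C C1.
Qed.

Lemma trivial_ring (C : comPzRingType) (a b : C) : (1 : C) = 0 -> a = b.
Proof. by move=> C0; rewrite -[a]mul1r -[b]mul1r C0 !mul0r. Qed.

Lemma trivial_hom (A C : comPzRingType) : (1 : C) = 0 ->
  exists h : {rmorphism A -> C}, True.
Proof.
move=> C0; pose h (a : A) : C := 0.
have hB : zmod_morphism h by move=> a b; exact: trivial_ring C0.
have hM : monoid_morphism h by split=> [|a b]; exact: trivial_ring C0.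
pose hZ := GRing.isZmodMorphism.Build A C h hB.
pose hR := GRing.isMonoidMorphism.Build A C h hM.
by exists (HB.pack h hZ hR : {rmorphism A -> C}).
Qed.

(** Over a free algebra, an element of M (x) S is determined by its coordinates
    in M, on which an injective map acts injectively. *)
Lemma flat_free (R T : comPzRingType) (phi : {rmorphism R -> T}) d
    (e : 'I_d -> T) (chi : 'I_d -> T -> R) :
  (forall i, {morph chi i : t u / t + u}) ->
  (forall i r t, chi i (phi r * t) = r * chi i t) ->
  (forall t, t = \sum_(i < d) phi (chi i t) * e i) -> flat_hom phi.
Proof.
move=> chiD chiZ chiE M N f finj t u E.
have bc (Q : lmodType R) i :
    balanced (fun (m : Q) (a : alg phi) => chi i a *: m).
  split=> [m m' a|m a a'|r m a].
  - exact: scalerDr.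
  - by rewrite -scalerDl -chiD.
  by rewrite scalerA mulrC -chiZ.
pose c (Q : lmodType R) i (v : tensor Q (alg phi)) : Q :=
  tlift (fun (m : Q) (a : alg phi) => chi i a *: m) v.
have cE (Q : lmodType R) v : v = \sum_(i < d) c Q i v *t (e i : alg phi).
  elim/tensor_ind: v => [|m a|v w {1}-> {1}->].
  - rewrite big1 // => i _; rewrite /c tlift0 //.
    by apply: (addrI (0 *t (e i : alg phi))); rewrite -tensDl !addr0.
  - have m0 : m *t (0 : alg phi) = 0.
      by apply: (addrI (m *t (0 : alg phi))); rewrite -tensDr !addr0.
    rewrite {1}[a]chiE (big_morph (tens m) (@tensDr _ _ _ m) m0).
    by apply: eq_bigr => i _; rewrite /c tlift_tens // tensZ.
  by rewrite -big_split; apply: eq_bigr => i _ /=; rewrite -tensDl /c tliftD.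
have bf := @balanced_tmapl R M N f (alg phi).
have fc i v : f (c M i v) =
    c N i (tlift (fun (m : M) (a : alg phi) => f m *t a) v).
  rewrite /c (tlift_tlift _ _ (bc N i)) (tlift_additive _ _ (linearD f)).
  by apply: eq_tlift => m a; rewrite linearZ tlift_tens.
rewrite [t]cE [u]cE; apply: eq_bigr => i _; congr (_ *t _); apply: finj.
by rewrite !fc E.
Qed.

Import Pdiv.CommonRing Pdiv.RingMonic.

Section Adjoin.
Variables (R : comNzRingType) (f : {poly R}).
Hypotheses (f_monic : f \is monic) (f_size : (1 < size f)%N).

Definition adj : comNzRingType := {poly %/ f}.
Definition adj_map : {rmorphism R -> adj} := in_qpoly f \o polyC.
Definition adj_root : adj := in_qpoly f 'X.
Let d := (size f).-1.

Let mkE : mk_monic f = f. Proof. by rewrite /mk_monic f_size f_monic. Qed.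

Lemma in_qpoly_adj (p : {poly R}) :
  in_qpoly f p = \sum_(i < size p) adj_map p`_i * adj_root ^+ i :> adj.
Proof.
rewrite -[p in LHS]coefK poly_def rmorph_sum; apply: eq_bigr => i _.
by rewrite -mul_polyC rmorphM rmorphXn.
Qed.

Lemma adj_size (t : adj) : (size (t : {poly R}) <= d)%N.
Proof.
rewrite -ltnS /d prednK; last exact: ltnW.
exact: leq_trans (size_mk_monic t) (eq_leq (congr1 (fun p : {poly R} => size p) mkE)).
Qed.

Lemma adjE (t : adj) :
  t = \sum_(i < d) adj_map (t : {poly R})`_i * adj_root ^+ i.
Proof.
have {1}-> : t = in_qpoly f (t : {poly R}).
  apply: val_inj; rewrite /= rmodp_small //.
  exact: size_mk_monic.
rewrite in_qpoly_adj (big_ord_widen _ (fun i => adj_map (t : {poly R})`_i *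
  adj_root ^+ i) (adj_size t)) big_mkcond; apply: eq_bigr => i _.
case: ltnP => // ti; rewrite nth_default //.
by rewrite rmorph0 mul0r.
Qed.

Lemma adj_flat : flat_hom adj_map.
Proof.
apply: (@flat_free R adj adj_map d (fun i => adj_root ^+ i)
  (fun i t => (t : {poly R})`_i)).
- by move=> i t u; rewrite poly_of_qpolyD coefD.
- move=> i r t; rewrite -coefZ -mul_polyC.
  have E (p : {poly R}) : (size p < size f)%N ->
      rmodp (rmodp r%:P (mk_monic f) * p) (mk_monic f) = r%:P * p.
    move=> pf; rewrite mkE [rmodp r%:P f]rmodp_small; last first.
      by rewrite size_polyC (leq_ltn_trans _ f_size) //; case: eqP.
    by rewrite rmodp_small // mul_polyC (leq_ltn_trans (size_scale_leq _ _)).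
  rewrite poly_of_qpolyM /= E //.
  by rewrite (leq_ltn_trans (adj_size t)) // /d prednK // ltnW.
- exact: adjE.
Qed.

Lemma adj_lift (C : comNzRingType) (beta : {rmorphism R -> C}) (c : C) :
  (map_poly beta f).[c] = 0 ->
  exists h : {rmorphism adj -> C},
    (forall r, h (adj_map r) = beta r) /\ h adj_root = c.
Proof.
move=> fc; pose h (t : adj) : C := (map_poly beta (t : {poly R})).[c].
have hE p : h (in_qpoly f p) = (map_poly beta p).[c].
  rewrite /h /= mkE; rewrite [p in RHS](Pdiv.RingMonic.rdivp_eq f_monic).
  by rewrite rmorphD rmorphM /= hornerD hornerM fc mulr0 add0r.
have hB : zmod_morphism h by move=> a b; rewrite /h !rmorphB hornerD hornerN.
have hM : monoid_morphism h.
  split; first by rewrite -[1](rmorph1 (in_qpoly f)) hE rmorph1 hornerC.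
  move=> a b; have -> : a * b = in_qpoly f ((a : {poly R}) * (b : {poly R})).
    exact: val_inj.
  by rewrite hE rmorphM hornerM.
pose hZ := GRing.isZmodMorphism.Build adj C h hB.
pose hR := GRing.isMonoidMorphism.Build adj C h hM.
exists (HB.pack h hZ hR : {rmorphism adj -> C}); split=> [r|] /=.
  by rewrite hE map_polyC hornerC.
by rewrite hE map_polyX hornerX.
Qed.

Lemma adj_root0 : (map_poly adj_map f).[adj_root] = 0.
Proof.
have -> : (map_poly adj_map f).[adj_root] = in_qpoly f f.
  by rewrite in_qpoly_adj horner_coef size_map_poly_id0 ?(monicP f_monic)
    ?rmorph1 ?oner_neq0 //; apply: eq_bigr => i _; rewrite coef_map.
by apply: val_inj; rewrite /= mkE rmodpp.
Qed.

Lemma adj_hom_eq (C : comPzRingType) (h h' : {rmorphism adj -> C}) :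
  (forall r, h (adj_map r) = h' (adj_map r)) -> h adj_root = h' adj_root ->
  h =1 h'.
Proof.
move=> E1 E2 t; rewrite (adjE t) !rmorph_sum; apply: eq_bigr => i _.
by rewrite !rmorphM !rmorphXn E1 E2.
Qed.

Lemma adj_represents : represents adj_map (fun _ : 'I_1 => adj_root)
  (fun _ : 'I_1 => [seq (f`_i, [ffun _ : 'I_1 => i]) | i <- iota 0 (size f)]).
Proof.
have evE (C : comPzRingType) (beta : {rmorphism R -> C}) y :
    fpoly_eval beta y [seq (f`_i, [ffun _ : 'I_1 => i]) | i <- iota 0 (size f)]
    = \sum_(i < size f) beta f`_i * y ord0 ^+ i.
  rewrite /fpoly_eval big_map -[size f in LHS]subn0 -/(index_iota 0 (size f)).
  rewrite big_mkord.
  by apply: eq_bigr => i _; rewrite /= big_ord1 ffunE.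
have hoE (C : comNzRingType) (beta : {rmorphism R -> C}) c :
    \sum_(i < size f) beta f`_i * c ^+ i = (map_poly beta f).[c].
  rewrite horner_coef size_map_poly_id0 ?(monicP f_monic)
    ?rmorph1 ?oner_neq0 //; by apply: eq_bigr => i _; rewrite coef_map.
split.
- by move=> _; rewrite evE hoE adj_root0.
- apply: comPzRing_ind => C; first by move=> C0 beta y _;
    have [h _] := trivial_hom adj C0; exists h; split=> *; exact: trivial_ring C0.
  move=> beta y /(_ ord0); rewrite evE hoE => /adj_lift [h [h1 h2]].
  by exists h; split=> // i; rewrite h2 (ord1 i).
- by move=> C h h' E1 /(_ ord0) E2; exact: adj_hom_eq.
Qed.

(** The ring R[X]/f with the derivative at the root inverted: the root is then
    simple, which makes it deform uniquely. *)
Definition sadj : comPzRingType := loc (map_poly adj_map f^`()).[adj_root].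
Definition sadj_loc : {rmorphism adj -> sadj} := loc_map _.
Definition sadj_map : {rmorphism R -> sadj} := sadj_loc \o adj_map.
Definition sadj_root : sadj := sadj_loc adj_root.

Lemma taylor2 (B : comNzRingType) (p : {poly B}) b z : z * z = 0 ->
  p.[b + z] = p.[b] + p^`().[b] * z.
Proof.
move=> z2; elim/poly_ind: p => [|p c IHp].
  by rewrite deriv0 !horner0 mul0r addr0.
rewrite derivD derivC addr0 derivM derivX mulr1 !hornerE IHp.
have -> : (p.[b] + p^`().[b] * z) * (b + z) + c =
  p.[b] * b + c + (p^`().[b] * b + p.[b]) * z + p^`().[b] * (z * z) by ring.
by rewrite z2 mulr0 addr0.
Qed.

Lemma sadj_hom_eq (C : comPzRingType) (h h' : {rmorphism sadj -> C}) :
  (forall r, h (sadj_map r) = h' (sadj_map r)) -> h sadj_root = h' sadj_root ->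
  h =1 h'.
Proof.
move=> E1 E2; have E : forall t, h (sadj_loc t) = h' (sadj_loc t).
  exact: (adj_hom_eq (h := h \o sadj_loc) (h' := h' \o sadj_loc)).
apply: (rep_uniq (loc_represents _)) => // _ /=.
set v := loc_inv _; pose g := (map_poly adj_map f^`()).[adj_root].
have gv : sadj_loc g * v = 1 by exact: loc_mulV.
rewrite -[LHS]mulr1 -(rmorph1 h') -gv rmorphM -E mulrA -rmorphM.
by rewrite [v * _]mulrC gv rmorph1 mul1r.
Qed.

Lemma sadj_lift (C : comNzRingType) (beta : {rmorphism R -> C}) (c u : C) :
  (map_poly beta f).[c] = 0 -> (map_poly beta f^`()).[c] * u = 1 ->
  exists h : {rmorphism sadj -> C},
    (forall r, h (sadj_map r) = beta r) /\ h sadj_root = c.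
Proof.
move=> /adj_lift [h [h1 h2]] cu.
have gu : h (map_poly adj_map f^`()).[adj_root] * u = 1.
  by rewrite -horner_map h2 -map_poly_comp (eq_map_poly h1).
have [h' h'E] := loc_lift gu.
exists h'; split=> [r|]; first exact: (etrans (h'E _) (h1 r)).
exact: (etrans (h'E _) h2).
Qed.

(** Newton's method: modulo an ideal of square zero, f(b + z) = f(b) + f'(b) z,
    so that one step corrects an approximate root, in a unique way. *)
Lemma sadj_formally_etale : formally_etale sadj_map.
Proof.
move=> B; move: B; apply: comPzRing_ind => B.
  move=> B0 C beta pi g pis _ _ lifts.
  have C0 : (1 : C) = 0 by rewrite -(rmorph1 pi) B0 rmorph0.
  split; last by move=> h h' _ _ a; exact: trivial_ring B0.
  have [h _] := trivial_hom sadj B0; exists h.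
  by split=> *; [exact: trivial_ring B0|exact: trivial_ring C0].
move=> C beta pi g pis pi2 gE lifts.
have ev (p : {poly R}) b : pi b = g sadj_root ->
    pi (map_poly beta p).[b] = g (sadj_loc (map_poly adj_map p).[adj_root]).
  move=> bE; elim/poly_ind: p => [|p c IHp].
    by rewrite !rmorph0 !horner0 !rmorph0.
  rewrite !rmorphD !rmorphM /= !map_polyX !map_polyC /= !hornerE !rmorphD !rmorphM.
  by rewrite IHp bE /= -gE.
have df b : pi b = g sadj_root -> exists u, (map_poly beta f^`()).[b] * u = 1.
  move=> bE; have [w wE] := pis (g (loc_inv _)).
  set D := _.[b]; pose z := 1 - D * w.
  have z2 : z * z = 0.
    apply: pi2; rewrite /z rmorphB rmorph1 rmorphM wE ev // -rmorphM loc_mulV;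
    by rewrite rmorph1 subrr.
  exists (w * (1 + z)); rewrite mulrA.
  have -> : D * w = 1 - z by rewrite /z subKr.
  by rewrite mulrDr mulr1 mulrBl mul1r z2 subr0 subrK.
split.
  have [b bE] := pis (g sadj_root); have [u uE] := df b bE.
  pose z := - ((map_poly beta f).[b] * u).
  have pf : pi (map_poly beta f).[b] = 0 by rewrite ev // adj_root0 !rmorph0.
  have pz : pi z = 0 by rewrite /z rmorphN rmorphM pf mul0r oppr0.
  have bz : pi (b + z) = g sadj_root by rewrite rmorphD pz addr0.
  have [u' u'E] := df _ bz.
  have [|h [h1 h2]] := sadj_lift (beta := beta) (c := b + z) _ u'E.
    rewrite taylor2 ?deriv_map; last exact: pi2.
    by rewrite /z mulrN mulrCA uE mulr1 subrr.
  exists h; split=> // a.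
  apply: (sadj_hom_eq (h := pi \o h)) => [r|] /=; first by rewrite h1 gE.
  by rewrite h2.
move=> h h' [h1 hp] [h1' hp']; apply: sadj_hom_eq => [r|]; first by rewrite h1 h1'.
have rt (k : {rmorphism sadj -> B}) : (forall r, k (sadj_map r) = beta r) ->
    (map_poly beta f).[k sadj_root] = 0.
  move=> kE; pose kk : {rmorphism adj -> B} := k \o sadj_loc.
  have -> : map_poly beta f = map_poly kk (map_poly adj_map f).
    by rewrite -map_poly_comp; apply: eq_map_poly => r; rewrite /= -kE.
  by rewrite -[k _]/(kk adj_root) horner_map adj_root0 rmorph0.
set b := h _; set b' := h' _; pose z := b' - b.
have pz : pi z = 0 by rewrite rmorphB hp hp' subrr.
have := rt h' h1'; rewrite -/b' -[b'](subrKC b) -/z taylor2; last exact: pi2.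
rewrite (rt h h1 : _.[b] = 0) add0r deriv_map; have [u uE] := df b (hp _).
move/(congr1 (fun x => u * x)); rewrite mulrA [u * _]mulrC uE mul1r mulr0.
by move=> z0; apply/esym/eqP; rewrite -subr_eq0 z0 addr0 subrr.
Qed.

Lemma sadj_flat_etale : flat_etale sadj_map.
Proof.
have [f1 [p1 _]] := loc_flat_etale (map_poly adj_map f^`()).[adj_root].
split; first by apply: flat_comp; [exact: adj_flat|].
split; last exact: sadj_formally_etale.
apply: fpresented_comp p1; apply/finitely_presentedP.
exists 1%N, (fun=> adj_root), 1%N; eexists; exact: adj_represents.
Qed.

End Adjoin.

(** * Etale neighbourhoods of a point *)

Lemma flat_etale_id (R : comPzRingType) :
  flat_etale (idfun : {rmorphism R -> R}).
Proof.
split; last split.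
- apply: (@flat_free R R idfun 1 (fun=> 1) (fun=> id)) => // t.
  by rewrite big_ord1 mulr1.
- apply/finitely_presentedP; exists 0%N, (fun=> 0), 0%N, (fun=> [::]).
  split=> [[]//|C beta y _|C h h' E _ a]; last exact: E.
  by exists beta; split=> // -[].
move=> B C beta pi f pis _ fE lifts; split.
  by exists beta; split=> // a; rewrite -fE.
by move=> h h' [h1 _] [h1' _] a; rewrite [LHS]h1 [RHS]h1'.
Qed.

Definition nbhd_pred (R : comPzRingType) (K : fieldType) :=
  forall S : comNzRingType, {rmorphism R -> S} -> {rmorphism S -> K} -> Prop.

(** Q holds on some flat etale neighbourhood Spec S of the K-point x of Spec R,
    to which x lifts with the same field of values. *)
Definition near (R : comPzRingType) (K : fieldType) (x : {rmorphism R -> K})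
    (Q : nbhd_pred R K) :=
  exists (S : comNzRingType) (phi : {rmorphism R -> S}) (y : {rmorphism S -> K}),
    [/\ flat_etale phi, (forall r, y (phi r) = x r) & Q S phi y].

Lemma near_id (R : comNzRingType) (K : fieldType) (x : {rmorphism R -> K})
    (Q : nbhd_pred R K) :
  Q R idfun x -> near x Q.
Proof. by exists R, idfun, x; split=> //; exact: flat_etale_id. Qed.

(** Neighbourhoods compose. *)
Lemma near_bind (R : comPzRingType) (K : fieldType) (x : {rmorphism R -> K})
    (Q Q' : nbhd_pred R K) : near x Q ->
  (forall (S : comNzRingType) (phi : {rmorphism R -> S})
    (y : {rmorphism S -> K}), (forall r, y (phi r) = x r) ->
    Q S phi y -> near y (fun T psi z => Q' T (psi \o phi) z)) ->
  near x Q'.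
Proof.
case=> S [phi [y [fe yx Qy]]] H.
have [T [psi [z [fe' zy Qz]]]] := H _ _ _ yx Qy.
exists T, (psi \o phi), z; split=> //; first exact: flat_etale_comp.
by move=> r /=; rewrite zy yx.
Qed.

Lemma near_mono (R : comPzRingType) (K : fieldType) (x : {rmorphism R -> K})
    (Q Q' : nbhd_pred R K) : near x Q ->
  (forall (S : comNzRingType) (phi : {rmorphism R -> S})
    (y : {rmorphism S -> K}), (forall r, y (phi r) = x r) ->
    Q S phi y -> Q' S phi y) -> near x Q'.
Proof.
by case=> S [phi [y [fe yx Qy]]] H; exists S, phi, y; split=> //; exact: H.
Qed.

(** Finitely many conditions that persist in smaller neighbourhoods can be
    met simultaneously. *)
Lemma near_all (R : comNzRingType) (K : fieldType) (x : {rmorphism R -> K})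
    (I : finType) (Q : I -> nbhd_pred R K) :
  (forall i (S : comNzRingType) (phi : {rmorphism R -> S})
     (y : {rmorphism S -> K}) (T : comNzRingType) (psi : {rmorphism S -> T})
     (z : {rmorphism T -> K}), (forall r, y (phi r) = x r) ->
     (forall s, z (psi s) = y s) -> Q i S phi y -> Q i T (psi \o phi) z) ->
  (forall i (S : comNzRingType) (phi : {rmorphism R -> S})
     (y : {rmorphism S -> K}), (forall r, y (phi r) = x r) ->
     near y (fun T psi z => Q i T (psi \o phi) z)) ->
  near x (fun S phi y => forall i, Q i S phi y).
Proof.
move=> Qst Qne.
suff: near x (fun S phi y => forall i, i \in enum I -> Q i S phi y).
  by move/near_mono; apply=> S phi y _ H i; apply: H; rewrite mem_enum.
elim: (enum I) => [|i s IHs]; first exact: near_id.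
apply: near_bind IHs _ => S phi y yx H.
have [T [psi [z [fe zy Qz]]]] := Qne i S phi y yx.
exists T, psi, z; split=> // j; rewrite inE => /predU1P [-> //|/H].
exact: Qst.
Qed.

Lemma comNz_intro (P : comPzRingType -> Prop) (C : comPzRingType) :
  (1 : C) <> 0 -> P C -> exists D : comNzRingType, P D.
Proof.
elim/comPzRing_ind: C => C; first by move=> C0 /(_ C0).
by exists C.
Qed.

Lemma rmorph_nontrivial (S : comPzRingType) (K : fieldType)
  (y : {rmorphism S -> K}) : (1 : S) <> 0.
Proof.
move=> S0; have /eqP := rmorph1 y; rewrite S0 rmorph0 eq_sym.
by rewrite oner_eq0.
Qed.

Lemma near_inv (R : comPzRingType) (K : fieldType) (x : {rmorphism R -> K}) s :
  x s != 0 -> near x (fun S phi y => exists u, phi s * u = 1).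
Proof.
move=> xs; have [y yE] := loc_lift (divff xs).
have := @comNz_intro (fun S => exists (phi : {rmorphism R -> S})
  (y : {rmorphism S -> K}), [/\ flat_etale phi, (forall r, y (phi r) = x r) &
    exists u, phi s * u = 1]) (loc s) (rmorph_nontrivial y).
case; last by move=> S H; exists S.
exists (loc_map s), y; split=> //; first exact: loc_flat_etale.
exists (loc_inv s); exact: loc_mulV.
Qed.

Lemma near_inv_all (R : comNzRingType) (K : fieldType) (x : {rmorphism R -> K})
    (I : finType) (s : I -> R) : (forall i, x (s i) != 0) ->
  near x (fun S phi y => forall i, exists u, phi (s i) * u = 1).
Proof.
move=> xs; apply: near_all.
  move=> i S phi y T psi z _ _ [u su]; exists (psi u).
  by rewrite /= -rmorphM su rmorph1.
by move=> i S phi y yx; apply: near_inv; rewrite yx.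
Qed.

Lemma horner_map_nz (R S : comNzRingType) (phi : {rmorphism R -> S})
    (f : {poly R}) c :
  (map_poly phi f).[c] = \sum_(i < size f) phi f`_i * c ^+ i.
Proof.
rewrite (@horner_coef_wide _ (size f)) ?size_poly //.
by apply: eq_bigr => i _; rewrite coef_map.
Qed.

(** The henselian property of the etale topology. *)
Lemma near_root (R : comNzRingType) (K : fieldType) (x : {rmorphism R -> K})
    (f : {poly R}) (a : K) : f \is monic ->
  root (map_poly x f) a -> ~~ root (map_poly x f^`()) a ->
  near x (fun S phi y => exists b u, [/\ y b = a, (map_poly phi f).[b] = 0 &
    (map_poly phi f^`()).[b] * u = 1]).
Proof.
move=> f_monic fa f'a.
have f_size : (1 < size f)%N.
  rewrite ltnNge; apply: contraL fa => /size1_polyC fE.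
  move: f_monic; rewrite fE monicE lead_coefC => /eqP ->.
  by rewrite rmorph1 /root hornerC oner_eq0.
have [y [y1 y2]] := sadj_lift f_monic f_size (eqP fa) (divff f'a).
have := @comNz_intro (fun S => exists (phi : {rmorphism R -> S})
  (y : {rmorphism S -> K}), [/\ flat_etale phi, (forall r, y (phi r) = x r) &
    exists b u, [/\ y b = a, \sum_(i < size f) phi f`_i * b ^+ i = 0 &
      (\sum_(i < size f^`()) phi f^`()`_i * b ^+ i) * u = 1]])
  (sadj f) (rmorph_nontrivial y).
case; last first.
  move=> S [phi [z [fe zx [b [u [zb fb f'b]]]]]]; exists S, phi, z; split=> //.
  by exists b, u; rewrite !horner_map_nz.
exists (sadj_map f), y; split=> //; first exact: sadj_flat_etale.
have E (g : {poly R}) : \sum_(i < size g) sadj_map f g`_i * sadj_root f ^+ i =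
    sadj_loc f (map_poly (adj_map f) g).[adj_root f].
  rewrite horner_map_nz rmorph_sum; apply: eq_bigr => i _.
  by rewrite rmorphM rmorphXn.
exists (sadj_root f), (loc_inv _); rewrite !E; split=> //.
  by rewrite adj_root0 // rmorph0.
exact: loc_mulV.
Qed.

(** ** Fields with enough roots *)

Lemma exists_root_ext (K : fieldType) (p : {poly K}) : (1 < size p)%N ->
  exists (L : fieldType) (i : {rmorphism K -> L}) (a : L),
    root (map_poly i p) a.
Proof.
have [n] := ubnP (size p); elim: n p => // n IHn p sp p1.
have [irr|nirr] := pselect (irreducible_poly p).
  have [L _ [z pz _]] := irredp_FAdjoin irr.
  by exists L, (in_alg L), z.
have [q [q1 qp qnp]] : exists q : {poly K},
    [/\ size q != 1%N, q %| p & ~~ (q %= p)].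
  apply: contrapT => nq; apply: nirr; split=> // q q1 qp.
  by apply: contrapT => /negP qnp; apply: nq; exists q.
have p0 : p != 0 by rewrite -size_poly_gt0 ltnW.
have q0 : q != 0 by apply: contraNneq p0 => q0; move: qp; rewrite q0 dvd0p.
have sq : (size q < size p)%N.
  rewrite ltn_neqAle dvdp_leq // andbT; apply: contra qnp => /eqP E.
  by rewrite -dvdp_size_eqp // E.
have [|L [i [a qa]]] := IHn q (leq_trans sq sp).
  by rewrite ltn_neqAle eq_sym q1 size_poly_gt0.
exists L, i, a; have /dvdpP [r ->] := qp.
by rewrite rmorphM rootM qa orbT.
Qed.

Lemma exists_split_ext (K : fieldType) (p : {poly K}) : p != 0 ->
  exists (L : fieldType) (i : {rmorphism K -> L}) (rs : seq L),
    map_poly i p = (i (lead_coef p)) *: \prod_(a <- rs) ('X - a%:P).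
Proof.
have [n] := ubnP (size p); elim: n K p => // n IHn K p sp p0.
have [p1|p1] := leqP (size p) 1.
  exists K, idfun, [::]; rewrite big_nil map_poly_id // (size1_polyC p1).
  by rewrite lead_coefC /= alg_polyC.
have [L [i [a pa]]] := exists_root_ext p1.
have /factor_theorem [q qE] := pa.
have q0 : q != 0.
  by apply: contraNneq p0 => q0; rewrite -(map_poly_eq0 i) qE q0 mul0r.
have [|M [j [rs rsE]]] := IHn L q _ q0.
  rewrite -ltnS (leq_trans _ sp) // ltnS -(size_map_poly i p) qE.
  by rewrite size_Mmonic ?monicXsubC // size_XsubC addn2.
exists M, (j \o i), (j a :: rs); rewrite map_poly_comp qE rmorphM /= rsE.
rewrite big_cons rmorphB /= map_polyX map_polyC /= -scalerAl mulrC.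
congr (j _ *: _); rewrite -lead_coef_map qE lead_coef_Mmonic //.
exact: monicXsubC.
Qed.

(** * Algebras given by structure constants *)

(** An associative unital algebra structure on R^N with N > 0, where acst i j
    is the product of the i-th and j-th basis vectors. The algebras in question
    are dual to coordinate rings and known only through such constants. *)
Record fdalg (R : comPzRingType) := FdAlg {
  apred : nat;
  acst : 'I_apred.+1 -> 'I_apred.+1 -> 'rV[R]_apred.+1;
  aone : 'rV[R]_apred.+1;
  acstA : forall i j k, \sum_l acst j k 0 l *: acst i l =
                        \sum_l acst i j 0 l *: acst l k;
  acst1l : forall i, \sum_l aone 0 l *: acst l i = delta_mx 0 i;
  acst1r : forall i, \sum_l aone 0 l *: acst i l = delta_mx 0 i
}.

Notation adim B := (apred B).+1.

Definition fdext (R : comPzRingType) (B : fdalg R) (S : comPzRingType)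
  (phi : {rmorphism R -> S}) : Type := 'rV[S]_(adim B).

Section FdExt.
Variables (R : comPzRingType) (B : fdalg R) (S : comPzRingType).
Variable phi : {rmorphism R -> S}.
Local Notation N := (adim B).
Local Notation D := (fdext B phi).
Local Notation c i j := (map_mx phi (acst i j) : 'rV[S]_N).

HB.instance Definition _ := GRing.Lmodule.copy D 'rV[S]_N.

Definition fdone : D := map_mx phi (aone B).
Definition fdmul (x y : D) : D :=
  \sum_i \sum_j ((x : 'rV_N) 0 i * (y : 'rV_N) 0 j) *: c i j.
Definition fdb (i : 'I_N) : D := delta_mx 0 i.

Lemma fdmulDl : left_distributive fdmul +%R.
Proof.
move=> x y z; rewrite /fdmul -big_split; apply: eq_bigr => i _ /=.
by rewrite -big_split; apply: eq_bigr => j _ /=; rewrite mxE mulrDl scalerDl.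
Qed.

Lemma fdmulDr : right_distributive fdmul +%R.
Proof.
move=> x y z; rewrite /fdmul -big_split; apply: eq_bigr => i _ /=.
by rewrite -big_split; apply: eq_bigr => j _ /=; rewrite mxE mulrDr scalerDl.
Qed.

Lemma fdmulZl a x y : fdmul (a *: x) y = a *: fdmul x y.
Proof.
rewrite /fdmul scaler_sumr; apply: eq_bigr => i _; rewrite scaler_sumr.
by apply: eq_bigr => j _; rewrite mxE scalerA mulrA.
Qed.

Lemma fdmulZr a x y : fdmul x (a *: y) = a *: fdmul x y.
Proof.
rewrite /fdmul scaler_sumr; apply: eq_bigr => i _; rewrite scaler_sumr.
by apply: eq_bigr => j _; rewrite mxE scalerA mulrCA.
Qed.

Lemma fdb_sum (x : D) : x = \sum_i (x : 'rV_N) 0 i *: fdb i.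
Proof. exact: row_sum_delta. Qed.

Lemma fdmul_suml I r (P : pred I) (F : I -> D) y :
  fdmul (\sum_(i <- r | P i) F i) y = \sum_(i <- r | P i) fdmul (F i) y.
Proof.
apply: (big_morph (fdmul^~ y)) => [a b|]; first exact: fdmulDl.
by apply: (addrI (fdmul 0 y)); rewrite -fdmulDl !addr0.
Qed.

Lemma fdmul_sumr I r (P : pred I) (F : I -> D) x :
  fdmul x (\sum_(i <- r | P i) F i) = \sum_(i <- r | P i) fdmul x (F i).
Proof.
apply: (big_morph (fdmul x)) => [a b|]; first exact: fdmulDr.
by apply: (addrI (fdmul x 0)); rewrite -fdmulDr !addr0.
Qed.

Lemma fdmulbb i j : fdmul (fdb i) (fdb j) = c i j.
Proof.
rewrite /fdmul (bigD1 i) //= (bigD1 j) //= !mxE !eqxx mulr1 scale1r.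
rewrite !big1 ?addr0 // => k /negPf ki; last by rewrite mxE ki mulr0 scale0r.
by rewrite big1 // => l _; rewrite mxE ki andbF mul0r scale0r.
Qed.

Lemma fd_eq_basis (Z : zmodType) (f g : D -> Z) :
  {morph f : x y / x + y} -> {morph g : x y / x + y} ->
  (forall a i, f (a *: fdb i) = g (a *: fdb i)) -> f =1 g.
Proof.
move=> fD gD fg x; rewrite (fdb_sum x).
have f0 (h : D -> Z) : {morph h : x y / x + y} -> h 0 = 0.
  by move=> hD; apply: (addrI (h 0)); rewrite -hD !addr0.
rewrite (big_morph f fD (f0 f fD)) (big_morph g gD (f0 g gD)).
by apply: eq_bigr => i _; exact: fg.
Qed.

Lemma fdmulA : associative fdmul.
Proof.
move=> x y z; move: x; apply: fd_eq_basis => [x x'|x x'|a i].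
- exact: fdmulDl.
- by rewrite !fdmulDl.
rewrite !fdmulZl; congr (_ *: _); move: y; apply: fd_eq_basis => [y y'|y y'|b j].
- by rewrite fdmulDl fdmulDr.
- by rewrite fdmulDr fdmulDl.
rewrite fdmulZl !fdmulZr fdmulZl; congr (_ *: _); move: z.
apply: fd_eq_basis => [y y'|y y'|b' k]; rewrite ?fdmulDr // !fdmulZr.
congr (_ *: _); rewrite !fdmulbb (fdb_sum (c j k)) (fdb_sum (c i j)).
rewrite fdmul_sumr fdmul_suml.
under eq_bigr do rewrite fdmulZr fdmulbb mxE -map_mxZ.
under [RHS]eq_bigr do rewrite fdmulZl fdmulbb mxE -map_mxZ.
by rewrite -!raddf_sum acstA.
Qed.

Lemma fdmul1 : left_id fdone fdmul.
Proof.
apply: fd_eq_basis => [x y|//|a i]; first exact: fdmulDr.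
rewrite fdmulZr; congr (_ *: _); rewrite (fdb_sum fdone) fdmul_suml.
under eq_bigr do rewrite fdmulZl fdmulbb mxE -map_mxZ.
by rewrite -raddf_sum acst1l; exact: map_delta_mx.
Qed.

Lemma fdmulr1 : right_id fdone fdmul.
Proof.
apply: fd_eq_basis => [x y|//|a i]; first exact: fdmulDl.
rewrite fdmulZl; congr (_ *: _); rewrite (fdb_sum fdone) fdmul_sumr.
under eq_bigr do rewrite fdmulZr fdmulbb mxE -map_mxZ.
by rewrite -raddf_sum acst1r; exact: map_delta_mx.
Qed.

HB.instance Definition _ := GRing.Zmodule_isPzRing.Build D
  fdmulA fdmul1 fdmulr1 fdmulDl fdmulDr.

Lemma fd_scalerAl a (x y : D) : (a *: x) * y = a *: (x * y).
Proof. exact: fdmulZl. Qed.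

Lemma fd_scalerAr a (x y : D) : x * (a *: y) = a *: (x * y).
Proof. exact: fdmulZr. Qed.

Lemma fdbM i j : fdb i * fdb j = c i j.
Proof. exact: fdmulbb. Qed.

(** Multiplications on the left and on the right, as matrices acting on row
    vectors. *)
Definition fdL (x : D) : 'M[S]_N := \matrix_i (x * fdb i : D).
Definition fdR (x : D) : 'M[S]_N := \matrix_i (fdb i * x : D).

Lemma mul_fdL (x y : D) : (y : 'rV_N) *m fdL x = x * y.
Proof.
rewrite mulmx_sum_row [in RHS](fdb_sum y) mulr_sumr; apply: eq_bigr => i _.
by rewrite rowK fd_scalerAr.
Qed.

Lemma mul_fdR (x y : D) : (y : 'rV_N) *m fdR x = y * x.
Proof.
rewrite mulmx_sum_row [in RHS](fdb_sum y) mulr_suml; apply: eq_bigr => i _.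
by rewrite rowK fd_scalerAl.
Qed.

Lemma fd_mx_eq (A B' : 'M[S]_N) : (forall y : D, (y : 'rV_N) *m A = y *m B') ->
  A = B'.
Proof. by move=> AB; apply/row_matrixP => i; rewrite !rowE. Qed.

Lemma fdLM x y : fdL (x * y) = fdL y *m fdL x.
Proof. by apply: fd_mx_eq => z; rewrite mulmxA !mul_fdL mulrA. Qed.

Lemma fdRM x y : fdR (x * y) = fdR x *m fdR y.
Proof. by apply: fd_mx_eq => z; rewrite mulmxA !mul_fdR mulrA. Qed.

Lemma fdLR x y : fdL x *m fdR y = fdR y *m fdL x.
Proof. by apply: fd_mx_eq => z; rewrite !mulmxA !(mul_fdL, mul_fdR) mulrA. Qed.

Lemma fdL_sum x : fdL x = \sum_i (x : 'rV_N) 0 i *: fdL (fdb i).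
Proof.
apply: fd_mx_eq => z; rewrite mul_fdL mulmx_sumr {1}(fdb_sum x) mulr_suml.
by apply: eq_bigr => i _; rewrite -scalemxAr mul_fdL fd_scalerAl.
Qed.

Lemma fdR_sum x : fdR x = \sum_i (x : 'rV_N) 0 i *: fdR (fdb i).
Proof.
apply: fd_mx_eq => z; rewrite mul_fdR mulmx_sumr {1}(fdb_sum x) mulr_sumr.
by apply: eq_bigr => i _; rewrite -scalemxAr mul_fdR fd_scalerAr.
Qed.

End FdExt.

Arguments fdb {R B S} phi i.

Section FdMap.
Variables (R : comPzRingType) (B : fdalg R) (S T : comPzRingType).
Variables (phi : {rmorphism R -> S}) (psi : {rmorphism S -> T}).
Variable chi : {rmorphism R -> T}.
Hypothesis E : forall r, psi (phi r) = chi r.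
Local Notation N := (adim B).

Definition fdmap of (forall r, psi (phi r) = chi r) :
  fdext B phi -> fdext B chi := fun x => map_mx psi x.
Local Notation h := (fdmap E).

Lemma fdmapE x i : (h x : 'rV_N) 0 i = psi ((x : 'rV_N) 0 i).
Proof. by rewrite mxE. Qed.

Lemma fdmapB : {morph h : x y / x - y}.
Proof. by move=> x y; exact: map_mxB. Qed.

Lemma map_acst i j :
  map_mx psi (map_mx phi (@acst _ B i j)) = map_mx chi (acst i j).
Proof. by rewrite -map_mx_comp; apply: eq_map_mx. Qed.

Lemma fdmapM : monoid_morphism h.
Proof.
split; first by rewrite -[LHS]map_mx_comp; apply: eq_map_mx.
move=> x y; rewrite -[LHS]/(map_mx psi (fdmul x y)) /fdmul raddf_sum.
apply: eq_bigr => i _; rewrite raddf_sum; apply: eq_bigr => j _.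
by rewrite /= map_mxZ rmorphM map_acst !mxE.
Qed.

HB.instance Definition _ :=
  GRing.isZmodMorphism.Build (fdext B phi) (fdext B chi) h fdmapB.
HB.instance Definition _ :=
  GRing.isMonoidMorphism.Build (fdext B phi) (fdext B chi) h fdmapM.

Lemma fdmapZ a x : h (a *: x) = psi a *: h x.
Proof. exact: map_mxZ. Qed.

Lemma fdmapb i : h (fdb phi i) = fdb chi i.
Proof. exact: map_delta_mx. Qed.

Lemma map_fdL x : map_mx psi (fdL x) = fdL (h x).
Proof.
apply/row_matrixP => i; rewrite -map_row !rowK -[LHS]/(h _) fdmapM.2.
by rewrite fdmapb.
Qed.

Lemma map_fdR x : map_mx psi (fdR x) = fdR (h x).
Proof.
apply/row_matrixP => i; rewrite -map_row !rowK -[LHS]/(h _) fdmapM.2.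
by rewrite fdmapb.
Qed.

End FdMap.

(** * Splitting a von Neumann regular algebra over a field extension *)

Section Extensions.
Variable R : comPzRingType.

Definition ext_of (K K' : fieldType) (x : {rmorphism R -> K})
    (x' : {rmorphism R -> K'}) :=
  exists i : {rmorphism K -> K'}, forall r, i (x r) = x' r.

Lemma ext_of_refl (K : fieldType) (x : {rmorphism R -> K}) : ext_of x x.
Proof. by exists idfun. Qed.

Lemma ext_of_trans (K K' K'' : fieldType) (x : {rmorphism R -> K})
    (x' : {rmorphism R -> K'}) (x'' : {rmorphism R -> K''}) :
  ext_of x x' -> ext_of x' x'' -> ext_of x x''.
Proof. by move=> [i ix] [j jx]; exists (j \o i) => r /=; rewrite ix jx. Qed.

Lemma ext_of_comp (K K' : fieldType) (x : {rmorphism R -> K})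
    (i : {rmorphism K -> K'}) : ext_of x (i \o x).
Proof. by exists i. Qed.

End Extensions.

Section Splitting.
Variables (R : comPzRingType) (B : fdalg R).
Local Notation N := (adim B).

(** Von Neumann regularity, which for finite-dimensional algebras is
    semisimplicity. *)
Definition vnr (K : fieldType) (x : {rmorphism R -> K}) :=
  forall a : fdext B x, exists w, a * w * a = a.

Definition orth_dec (K : fieldType) (x : {rmorphism R -> K}) m
    (e : 'I_m -> fdext B x) :=
  [/\ forall i j, e i * e j = if i == j then e i else 0, forall i, e i <> 0 &
      \sum_i e i = 1].

Lemma orth_dec_le (K : fieldType) (x : {rmorphism R -> K}) m
  (e : 'I_m -> fdext B x) : orth_dec e -> (m <= N)%N.
Proof.
case=> ee e0 _; pose M : 'M[K]_(m, N) := \matrix_i (e i : 'rV_N).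
suff /eqP <- : row_free M by exact: rank_leq_col.
apply: inj_row_free => v vM; apply/rowP => j; rewrite mxE.
have /(congr1 (fun z : fdext B x => z * e j)) :
    \sum_i v 0 i *: e i = 0 :> fdext B x.
  rewrite -[RHS]vM mulmx_sum_row; apply: eq_bigr => i _.
  by rewrite rowK.
rewrite mul0r mulr_suml (bigD1 j) //= big1 ?addr0 => [|i /negPf ij]; last first.
  by rewrite fd_scalerAl ee ij scaler0.
rewrite fd_scalerAl ee eqxx => /eqP; rewrite scaler_eq0 => /orP [/eqP //|].
by move/eqP/e0.
Qed.

(** A decomposition that stays of maximal length over all field extensions. *)
Definition max_dec (K : fieldType) (x : {rmorphism R -> K}) m
    (e : 'I_m -> fdext B x) :=
  orth_dec e /\ forall (L : fieldType) (y : {rmorphism R -> L}) n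
    (f : 'I_n -> fdext B y), ext_of x y -> orth_dec f -> (n <= m)%N.

Lemma fdmap_field_inj (K L : fieldType) (x : {rmorphism R -> K})
    (y : {rmorphism R -> L}) (i : {rmorphism K -> L})
    (E : forall r, i (x r) = y r) : injective (@fdmap _ B _ _ x i y E).
Proof. by move=> a b /map_mx_inj. Qed.

Lemma orth_dec_map (K L : fieldType) (x : {rmorphism R -> K})
    (y : {rmorphism R -> L}) (i : {rmorphism K -> L})
    (E : forall r, i (x r) = y r) m (e : 'I_m -> fdext B x) :
  orth_dec e -> orth_dec (fun j => fdmap E (e j)).
Proof.
case=> ee e0 e1; split=> [j k|j|].
- by rewrite -rmorphM ee; case: eqP => // _; rewrite rmorph0.
- by move=> E0; apply: (e0 j); apply: (fdmap_field_inj (E := E)); rewrite E0 rmorph0.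
by rewrite -rmorph_sum e1 rmorph1.
Qed.

Lemma max_dec_map (K L : fieldType) (x : {rmorphism R -> K})
    (y : {rmorphism R -> L}) (i : {rmorphism K -> L})
    (E : forall r, i (x r) = y r) m (e : 'I_m -> fdext B x) :
  max_dec e -> max_dec (fun j => fdmap E (e j)).
Proof.
case=> oe me; split; first exact: orth_dec_map.
move=> M z n f yz; apply: me; apply: ext_of_trans yz; by exists i.
Qed.

Lemma fdext_one_neq0 (K : fieldType) (x : {rmorphism R -> K}) :
  (1 : fdext B x) <> 0.
Proof.
move=> /(congr1 (fun z => fdb x 0 * z)); rewrite mulr1 mulr0.
move/(congr1 (fun z : 'rV_N => z 0 0)); rewrite !mxE eqxx => /eqP.
by rewrite oner_eq0.
Qed.

(** Orthogonal nonzero idempotents are linearly independent, so that the length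
    of a decomposition is bounded by the dimension over every field. *)
Lemma max_dec_exists (K : fieldType) (x : {rmorphism R -> K}) :
  exists (L : fieldType) (y : {rmorphism R -> L}) m (e : 'I_m -> fdext B y),
    ext_of x y /\ max_dec e.
Proof.
pose P m := `[< exists (L : fieldType) (y : {rmorphism R -> L})
  (e : 'I_m -> fdext B y), ext_of x y /\ orth_dec e >].
have P1 : exists m, P m.
  exists 1%N; apply/asboolP; exists K, x, (fun=> 1); split.
    exact: ext_of_refl.
  split=> [i j|_|]; last by rewrite big_ord1.
    by rewrite (ord1 i) (ord1 j) eqxx mulr1.
  exact: fdext_one_neq0.
have PN m : P m -> (m <= N)%N.
  by move/asboolP=> [L [y [e [_ /orth_dec_le]]]].
case: (ex_maxnP P1 PN) => m /asboolP [L [y [e [xy oe]]]] mmax.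
exists L, y, m, e; split=> //; split=> // M z n f yz oz; apply: mmax.
by apply/asboolP; exists M, z, f; split=> //; exact: ext_of_trans xy yz.
Qed.

Section MaxDec.
Variables (K : fieldType) (x : {rmorphism R -> K}) (m : nat).
Variable e : 'I_m -> fdext B x.
Hypothesis me : max_dec e.

Let ee : forall i j, e i * e j = if i == j then e i else 0.
Proof. by case: me.1. Qed.
Let e0 : forall i, e i <> 0.
Proof. by case: me.1. Qed.
Let e1 : \sum_i e i = 1.
Proof. by case: me.1. Qed.
Let eid i : e i * e i = e i.
Proof. by rewrite ee eqxx. Qed.

(** A proper subidempotent f of e_j would refine the decomposition by
    replacing e_j with f and e_j - f. *)
Lemma max_dec_primitive j (f : fdext B x) : f * f = f -> e j * f = f ->
  f * e j = f -> f <> 0 -> f = e j.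
Proof.
move=> ff ef fe f0; apply: contrapT => fej.
pose g (i : 'I_m.+1) := if unlift ord0 i is Some k then
  (if k == j then e j - f else e k) else f.
suff og : orth_dec g by have := me.2 K x _ g (ext_of_refl x) og; rewrite ltnn.
have fk k : k != j -> f * e k = 0.
  by move=> /negPf kj; rewrite -fe -mulrA ee eq_sym kj mulr0.
have kf k : k != j -> e k * f = 0.
  by move=> /negPf kj; rewrite -ef mulrA ee kj mul0r.
split.
- move=> a b; rewrite /g.
  case: (unliftP ord0 a) => [k ->|->]; case: (unliftP ord0 b) => [l ->|->] //=.
  - rewrite (inj_eq lift_inj).
    have [kj|kj] := eqVneq k j; have [lj|lj] := eqVneq l j.
    + by rewrite kj lj eqxx mulrBl !mulrBr eid ef fe ff subrr subr0.
    + by rewrite kj mulrBl ee fk // eq_sym (negPf lj) subr0.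
    + by rewrite lj mulrBr ee kf // (negPf kj) subr0.
    + exact: ee.
  - have [_|kj] := eqVneq k j; last exact: kf.
    by rewrite mulrBl ef ff subrr.
  - have [_|kj] := eqVneq l j; last exact: fk.
    by rewrite mulrBr fe ff subrr.
- move=> a; rewrite /g; case: unliftP => [k _|//].
  case: eqP => // _ E; apply: fej; apply/eqP; rewrite eq_sym -subr_eq0.
  by rewrite E.
- rewrite big_ord_recl /g unlift_none -[RHS]e1 (bigD1 j) //=.
  rewrite [RHS](bigD1 j) //= liftK eqxx addrA subrKC; congr (_ + _).
  by apply: eq_bigr => i /negPf ij; rewrite liftK ij.
Qed.

Hypothesis reg : vnr x.

(** If y w y = y in the corner e_j D e_j, then w y is a nonzero idempotent
    there, hence e_j: the corner is a division algebra. *)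
Lemma corner_inv j (y : fdext B x) : e j * y = y -> y * e j = y -> y <> 0 ->
  exists w, w * y = e j.
Proof.
move=> ey ye y0; have [w wy] := reg y; exists (e j * w).
apply: max_dec_primitive.
- by rewrite -[in RHS]wy !mulrA -[_ * y * e j]mulrA ye.
- by rewrite !mulrA eid.
- by rewrite -mulrA ye.
by move=> E; apply: y0; rewrite -wy -{1}ye -!mulrA [e j * _]mulrA E mulr0.
Qed.

End MaxDec.

Lemma horner_fdR (K : fieldType) (x : {rmorphism R -> K}) (z : fdext B x)
    (rs : seq K) :
  horner_mx (fdR z) (\prod_(a <- rs) ('X - a%:P)) =
  fdR (\prod_(a <- rs) (z - a *: (1 : fdext B x))).
Proof.
have fdR1 : fdR (1 : fdext B x) = 1%:M.
  by apply: (@fd_mx_eq _ B _ x) => y; rewrite mul_fdR mulr1 mulmx1.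
elim: rs => [|a rs IHrs]; first by rewrite !big_nil rmorph1 fdR1.
rewrite !big_cons rmorphM /= IHrs fdRM; congr (_ *m _).
rewrite rmorphB /= horner_mx_X horner_mx_C; apply: (@fd_mx_eq _ B _ x) => y.
by rewrite mulmxBr !mul_fdR mul_mx_scalar mulrBr fd_scalerAr mulr1.
Qed.

(** The corners of a maximal decomposition are scalar. Over an extension where
    the characteristic polynomial of z splits, the product of the z - a
    vanishes; the corner has no zero divisors there by maximality, so that
    z = a e_j for some root a. Comparing coordinates, a is in K. *)
Lemma corner_scalar (K : fieldType) (x : {rmorphism R -> K}) m
    (e : 'I_m -> fdext B x) j z :
  (forall (L : fieldType) (y : {rmorphism R -> L}), ext_of x y -> vnr y) ->
  max_dec e -> e j * z = z -> z * e j = z -> exists c, z = c *: e j.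
Proof.
move=> reg me ez ze; pose q := char_poly (fdR z).
have [L [i [rs qE]]] := exists_split_ext (monic_neq0 (char_poly_monic (fdR z))).
rewrite (monicP (char_poly_monic _)) rmorph1 scale1r in qE.
pose y : {rmorphism R -> L} := i \o x; have E r : i (x r) = y r by [].
pose h := @fdmap _ B _ _ x i y E.
have me' := max_dec_map E me; have [[ee e0' _] _] := me'.
have CH : \prod_(a <- rs) (h z - a *: (1 : fdext B y)) = 0.
  rewrite -[LHS]mul1r -mul_fdR -horner_fdR -qE map_char_poly (map_fdR E).
  by rewrite Cayley_Hamilton mulmx0.
have {CH} : h (e j) * \prod_(a <- rs) (h z - a *: (1 : fdext B y)) = 0 by rewrite CH mulr0.
have hez : h (e j) * h z = h z by rewrite -rmorphM ez.
have hze : h z * h (e j) = h z by rewrite -rmorphM ze.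
have hee : h (e j) * h (e j) = h (e j) by rewrite ee eqxx.
have [[a aE]|na] := pselect (exists a, h z = a *: h (e j)).
  move=> _; have [_ e0 _] := me.1.
  have [l el] : exists l, (e j : 'rV_N) 0 l != 0.
    apply: contrapT => nl; apply: (e0 j); apply/rowP => l; rewrite mxE.
    by apply/eqP; apply: contrapT => /negP el; apply: nl; exists l.
  exists ((z : 'rV_N) 0 l / (e j : 'rV_N) 0 l).
  have aE' : a = i ((z : 'rV_N) 0 l / (e j : 'rV_N) 0 l).
    have := congr1 (fun v : 'rV_N => v 0 l) aE; rewrite !mxE rmorphM fmorphV /=.
    by move=> ->; rewrite mulfK // fmorph_eq0.
  by apply: (fdmap_field_inj (E := E)); rewrite fdmapZ -aE'.
elim: rs {qE} => [|a rs IHrs].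
  by rewrite big_nil mulr1 => /e0'.
rewrite big_cons mulrA.
have -> : h (e j) * (h z - a *: (1 : fdext B y)) = h z - a *: h (e j).
  by rewrite mulrBr hez fd_scalerAr mulr1.
set u := h z - _ => u0; apply: IHrs.
have [|||w wu] := @corner_inv L y m _ me' (reg _ _ (ext_of_comp x i)) j u.
- by rewrite mulrBr hez fd_scalerAr hee.
- by rewrite mulrBl hze fd_scalerAl hee.
- by move/eqP; rewrite subr_eq0 => /eqP E0; apply: na; exists a.
by rewrite -[h (e j)]wu -mulrA u0 mulr0.
Qed.

End Splitting.

(** Up to sign the discriminant of the characteristic polynomial f: the norm
    of f'(T), which is nonzero when T has distinct eigenvalues. Being a
    polynomial in the entries, it allows approximation. *)
Definition mx_disc (F : comNzRingType) n (T : 'M[F]_n.+1) :=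
  \det (horner_mx T (char_poly T)^`()).

Lemma map_mx_disc (F F' : comNzRingType) (f : {rmorphism F -> F'}) n
    (T : 'M[F]_n.+1) : f (mx_disc T) = mx_disc (map_mx f T).
Proof. by rewrite /mx_disc -det_map_mx map_horner_mx -deriv_map map_char_poly. Qed.

Lemma prod_XsubC_disc (K : fieldType) n (T : 'M[K]_n.+1) rs :
  char_poly T = \prod_(a <- rs) ('X - a%:P) -> uniq rs -> mx_disc T != 0.
Proof.
move=> fE; rewrite -separable_prod_XsubC -fE => cop.
rewrite unlock in cop; have [u uE] := Bezout_eq1_coprimepP _ _ cop.
have := congr1 (horner_mx T) uE.
rewrite rmorphD !rmorphM rmorph1 /= Cayley_Hamilton mulr0 add0r => E.
apply/eqP => d0; have : \det (1 : 'M[K]_n.+1) = 0.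
  by rewrite -E -[_ * _]/(_ *m _) det_mulmx -/(mx_disc T) d0 mulr0.
by rewrite det1 => /eqP; rewrite oner_eq0.
Qed.

Lemma exists_unity_roots_ext (K : fieldType) n :
  exists (L : fieldType) (i : {rmorphism K -> L}) M (rs : seq L),
    [/\ (n < M)%N, M%:R != 0 :> K, 'X^M - 1 = \prod_(a <- rs) ('X - a%:P) &
        uniq rs && (size rs == M)].
Proof.
have [M [nM M0]] : exists M, (n < M)%N /\ M%:R != 0 :> K.
  have [M0|] := eqVneq (n.+1%:R : K) 0; last by exists n.+1.
  exists n.+2; split=> //; rewrite -natr1 M0 add0r; exact: oner_neq0.
have M_gt0 : (0 < M)%N by exact: leq_ltn_trans nM.
have pm : ('X^M - 1 : {poly K}) \is monic by exact: monicXnsubC.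
have [L [i [rs]]] := exists_split_ext (monic_neq0 pm).
rewrite (monicP pm) rmorph1 scale1r rmorphB /= map_polyXn rmorph1 => rsE.
exists L, i, M, rs; split=> //; apply/andP; split.
  rewrite -separable_prod_XsubC -rsE; apply/separable_Xn_sub_1.
  by rewrite -(rmorph_nat i) fmorph_eq0.
by rewrite -eqSS -(size_prod_XsubC rs idfun) -rsE size_XnsubC.
Qed.

Lemma unity_rootsP (L : fieldType) M (rs : seq L) a :
  'X^M - 1 = \prod_(a <- rs) ('X - a%:P) -> a \in rs -> a ^+ M = 1.
Proof.
move=> rsE; rewrite -root_prod_XsubC -rsE /root !hornerE subr_eq0.
by move/eqP.
Qed.

Lemma exists_prim_root_ext (K : fieldType) n :
  exists (L : fieldType) (i : {rmorphism K -> L}) (w : L) M,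
    (n < M)%N /\ M.-primitive_root w.
Proof.
have [L [i [M [rs [nM _ rsE /andP [urs /eqP srs]]]]]] := exists_unity_roots_ext K n.
have /hasP [w _ wM] : has M.-primitive_root rs.
  apply: cyclic.has_prim_root => //; last by rewrite srs.
    exact: leq_ltn_trans nM.
  apply/allP => a ars; rewrite unity_rootE; apply/eqP.
  exact: unity_rootsP rsE ars.
by exists L, i, w, M.
Qed.

Lemma peirce_decomposition (A : pzRingType) m (e : 'I_m -> A) a :
  \sum_i e i = 1 -> a = \sum_j \sum_l e j * a * e l.
Proof.
move=> e1; rewrite -[LHS]mul1r -[LHS]mulr1 -e1 mulr_suml mulr_suml.
by apply: eq_bigr => j _; rewrite mulr_sumr.
Qed.

Section GoodPair.
Variables (R : comPzRingType) (B : fdalg R).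
Local Notation N := (adim B).

(** Over a maximal decomposition the pieces e_j D e_l are lines: a nonzero a
    in one of them has a partner w with w a = e_l up to a scalar, and b = (b w) a
    where b w is in the scalar corner of e_j. *)
Lemma corner_line (K : fieldType) (x : {rmorphism R -> K}) m
    (e : 'I_m -> fdext B x) j l a b :
  (forall (L : fieldType) (y : {rmorphism R -> L}), ext_of x y -> vnr B y) ->
  max_dec e -> e j * a = a -> a * e l = a -> a <> 0 ->
  e j * b = b -> b * e l = b -> exists c, b = c *: a.
Proof.
move=> reg me ja al a0 jb bl; have [[ee _ _] _] := me.
have [w aw] := reg _ _ (ext_of_refl x) a.
have [c wc] : exists c, e l * w * a = c *: e l.
  apply: (corner_scalar reg me); first by rewrite !mulrA ee eqxx.
  by rewrite -mulrA al.
have c1 : c *: a = a by rewrite -{1}al -fd_scalerAr -wc !mulrA al aw.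
have wl : e l * w * a = e l.
  rewrite wc; apply/eqP; rewrite -subr_eq0 -[X in _ - X]scale1r -scalerBl.
  rewrite scaler_eq0; apply/orP; left; rewrite subr_eq0; apply/eqP.
  apply/eqP; rewrite -subr_eq0; move/eqP: c1.
  by rewrite -subr_eq0 -[X in _ - X]scale1r -scalerBl scaler_eq0 => /orP [//|/eqP/a0].
have [c' wc'] : exists c', e j * (b * w) * e j = c' *: e j.
  apply: (corner_scalar reg me); first by rewrite !mulrA ee eqxx.
  by rewrite -!mulrA ee eqxx.
have bwa : b * w * a = b by rewrite -[RHS]bl -wl !mulrA bl.
exists c'; apply: esym; rewrite -[in LHS]ja -fd_scalerAl -wc'.
by rewrite -!mulrA ja !mulrA jb.
Qed.

(** With d and d' generic combinations of the idempotents of a decomposition,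
    the maps a |-> d a d' has the lines e_j D e_l as eigenlines, with
    distinct eigenvalues. The weights w^j and w^(m l), for w a root of unity of
    order larger than m^2, give distinct products. *)
Lemma exists_good_pair (K : fieldType) (x : {rmorphism R -> K}) :
  (forall (L : fieldType) (y : {rmorphism R -> L}), ext_of x y -> vnr B y) ->
  exists (L : fieldType) (y : {rmorphism R -> L}) (d d' : fdext B y),
    ext_of x y /\ mx_disc (fdL d *m fdR d') != 0.
Proof.
move=> reg0; have [K1 [x1 [m [e1 [xx1 me1]]]]] := max_dec_exists B x.
have [K2 [i [w [M [mM wM]]]]] := exists_prim_root_ext K1 (m * m).
pose y : {rmorphism R -> K2} := i \o x1; have E r : i (x1 r) = y r by [].
have xy : ext_of x y by apply: ext_of_trans xx1 _; exists i.
have reg (L : fieldType) (z : {rmorphism R -> L}) : ext_of y z -> vnr B z.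
  by move=> yz; apply: reg0; exact: ext_of_trans yz.
pose e j := fdmap E (e1 j); have me : max_dec e by exact: max_dec_map.
have [[ee e0 es] _] := me.
pose d := \sum_(j < m) w ^+ (j : nat) *: e j.
pose d' := \sum_(l < m) w ^+ (m * l) *: e l.
exists K2, y, d, d'; split=> //.
pose T := fdL d *m fdR d'.
have vT (j l : 'I_m) (v : fdext B y) : e j * v = v -> v * e l = v ->
    (v : 'rV_N) *m T = w ^+ (j + m * l) *: (v : 'rV_N).
  move=> jv vl; rewrite mulmxA mul_fdL mul_fdR -{1}jv -{1}vl.
  rewrite !mulrA -[_ * e l * d']mulrA.
  have -> : d * e j = w ^+ j *: e j.
    rewrite mulr_suml (bigD1 j) //= fd_scalerAl ee eqxx big1 ?addr0 // => k.
    by move=> /negPf kj; rewrite fd_scalerAl ee kj scaler0.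
  have -> : e l * d' = w ^+ (m * l) *: e l.
    rewrite mulr_sumr (bigD1 l) //= fd_scalerAr ee eqxx big1 ?addr0 // => k.
    by move=> /negPf kl; rewrite fd_scalerAr ee eq_sym kl scaler0.
  by rewrite fd_scalerAr !fd_scalerAl scalerA jv vl mulrC -exprD.
pose inP (p : 'I_m * 'I_m) := `[< exists v : fdext B y, e p.1 * v * e p.2 <> 0 >].
pose Ps : {set 'I_m * 'I_m} := [set p | inP p].
have vP (k : 'I_#|Ps|) : exists v : fdext B y, [/\ v <> 0,
    e (enum_val k).1 * v = v & v * e (enum_val k).2 = v].
  have := enum_valP k; rewrite inE => /asboolP [v v0].
  exists (e (enum_val k).1 * v * e (enum_val k).2); split=> //.
    by rewrite !mulrA ee eqxx.
  by rewrite -!mulrA ee eqxx.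
pose V k := projT1 (cid (vP k)).
have VE k : [/\ V k <> 0, e (enum_val k).1 * V k = V k &
    V k * e (enum_val k).2 = V k] by exact: projT2 (cid (vP k)).
pose MV : 'M[K2]_(#|Ps|, N) := \matrix_k (V k : 'rV_N).
(* By the Peirce decomposition every element is a sum of elements of the
   lines, so that the chosen generators V k span D. *)
have full : row_full MV.
  rewrite -sub1mx; apply/row_subP => r.
  have -> : row r 1%:M = fdb y r by rewrite row1.
  set a := fdb y r.
  have -> : a = \sum_j \sum_l e j * a * e l :> fdext B y.
    exact: peirce_decomposition.
  apply: summx_sub => j _; apply: summx_sub => l _.
  have [->|/eqP a0] := eqVneq (e j * a * e l) 0; first exact: sub0mx.
  have jlP : (j, l) \in Ps by rewrite inE; apply/asboolP; exists a.
  have [V0 jV Vl] := VE (enum_rank_in jlP (j, l)).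
  rewrite enum_rankK_in // in jV Vl.
  have [||c ->] := corner_line (b := e j * a * e l) reg me jV Vl V0.
  - by rewrite !mulrA ee eqxx.
  - by rewrite -!mulrA ee eqxx.
  rewrite scalemx_sub //; apply: (eq_row_sub (enum_rank_in jlP (j, l))).
  by rewrite rowK.
pose rs := [seq w ^+ (p.1 + m * p.2) | p : 'I_m * 'I_m <- enum Ps].
have srs : (N <= size rs)%N.
  by rewrite size_map -cardE -(eqP full) rank_leq_row.
have rsr : all (root (char_poly T)) rs.
  apply/allP => _ /mapP [p pP ->]; rewrite -eigenvalue_root_char.
  rewrite mem_enum in pP; have [V0 jV Vl] := VE (enum_rank_in pP p).
  rewrite enum_rankK_in // in jV Vl; apply/eigenvalueP.
  exists (V (enum_rank_in pP p)); first exact: vT.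
  by apply/eqP.
have urs : uniq rs.
  rewrite map_inj_uniq ?enum_uniq // => -[a b] [c c'] /= /eqP.
  have lt_mm (a' b' : 'I_m) : (a' + m * b' < m * m)%N.
    by have := ltn_ord a'; have := ltn_ord b'; nia.
  rewrite (eq_prim_root_expr wM) !modn_small; try exact: ltn_trans mM.
  move/eqP => abE; have m_gt0 : (0 < m)%N by exact: leq_ltn_trans (ltn_ord a).
  congr (_, _); apply: val_inj => /=.
    have := congr1 (modn^~ m) abE.
    by rewrite !(addnC _ (m * _)%N) ![(m * _)%N]mulnC !modnMDl !modn_small.
  have := congr1 (divn^~ m) abE.
  by rewrite !(addnC _ (m * _)%N) ![(m * _)%N]mulnC !divnMDl // !divn_small ?addn0.
have f0 := monic_neq0 (char_poly_monic T).
have srsN : size rs = N.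
  apply/eqP; rewrite eqn_leq srs andbT -ltnS -(size_char_poly T).
  exact: max_poly_roots.
apply: (prod_XsubC_disc (rs := rs)) => //.
rewrite [LHS](all_roots_prod_XsubC (rs := rs)) ?uniq_rootsE //.
  by rewrite (monicP (char_poly_monic _)) scale1r.
by rewrite size_char_poly srsN.
Qed.

End GoodPair.

(** ** Approximating parameters by sections over etale neighbourhoods *)

Lemma horner_mx_disc (F : comNzRingType) n (T0 T1 : 'M[F]_n.+1) a :
  (mx_disc (map_mx polyC T0 + 'X *: map_mx polyC T1)).[a] =
  mx_disc (T0 + a *: T1).
Proof.
rewrite -[LHS]/(horner_eval a _) map_mx_disc; congr mx_disc.
apply/matrixP => i j; rewrite !mxE /= rmorphD rmorphM /=.
by rewrite /horner_eval hornerX !hornerC.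
Qed.

(** A nonzero polynomial in one parameter does not vanish at all roots of
    unity of large order, and these lift to sections of etale coverings. *)
Lemma disc_approx1 (R : comNzRingType) (K : fieldType) (x : {rmorphism R -> K})
    n (T0 T1 : 'M[K]_n.+1) (t : K) : mx_disc (T0 + t *: T1) != 0 ->
  exists (L : fieldType) (i : {rmorphism K -> L}),
    near (i \o x) (fun S phi y =>
      exists s, mx_disc (map_mx i T0 + y s *: map_mx i T1) != 0).
Proof.
move=> d0; pose P := mx_disc (map_mx polyC T0 + 'X *: map_mx polyC T1).
have P0 : P != 0.
  by apply: contraNneq d0 => P0; rewrite -horner_mx_disc -/P P0 horner0.
have [L [i [M [rs [PM M0 rsE /andP [urs /eqP srs]]]]]] :=
  exists_unity_roots_ext K (size P).
have [a ars Pa] : exists2 a, a \in rs & ~~ root (map_poly i P) a.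
  apply/hasP; rewrite has_predC; apply: contraTN (PM) => Prs.
  rewrite -leqNgt -(size_map_poly i) -srs ltnW //.
  by apply: max_poly_roots => //; rewrite map_poly_eq0.
have aM := unity_rootsP rsE ars.
have M_gt0 : (0 < M)%N by exact: leq_ltn_trans PM.
exists L, i; have [|||S [phi [y [fe yx [b [u [ba _ _]]]]]]] :=
    @near_root R L (i \o x) ('X^M - 1) a.
- exact: monicXnsubC.
- by rewrite rmorphB /= map_polyXn rmorph1 /root !hornerE aM subrr.
- rewrite derivB derivXn derivC subr0 raddfMn /= map_polyXn /root hornerMn.
  rewrite hornerXn -mulr_natl mulf_neq0 ?expf_neq0 //.
    by rewrite -(rmorph_nat i) fmorph_eq0.
  by apply: contra_eq_neq aM => ->; rewrite expr0n gtn_eqF // eq_sym oner_neq0.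
exists S, phi, y; split=> //; exists b; rewrite ba; apply: contra Pa => /eqP d.
have -> : map_poly i P =
    mx_disc (map_mx polyC (map_mx i T0) + 'X *: map_mx polyC (map_mx i T1)).
  rewrite /P map_mx_disc; congr mx_disc; apply/matrixP => k l.
  by rewrite !mxE rmorphD rmorphM /= map_polyX !map_polyC.
by rewrite /root horner_mx_disc d.
Qed.

(** One coordinate is replaced at a time, the others staying fixed. *)
Lemma disc_approx n : forall (R : comNzRingType) (K : fieldType)
    (x : {rmorphism R -> K}) N (T0 : 'M[K]_N.+1) (T : 'I_n -> 'M[K]_N.+1) t,
  mx_disc (T0 + \sum_i t i *: T i) != 0 ->
  exists (L : fieldType) (i : {rmorphism K -> L}),
    near (i \o x) (fun S phi y => exists s : 'I_n -> S,
      mx_disc (map_mx i T0 + \sum_j y (s j) *: map_mx i (T j)) != 0).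
Proof.
elim: n => [|n IHn] R K x N T0 T t d0.
  exists K, idfun; apply: near_id; exists (fun=> 0).
  by move: d0; rewrite !big_ord0 !addr0 map_mx_id.
move: d0; rewrite big_ord_recl /= addrCA addrC => /(disc_approx1 x).
move=> [L [i [S [phi [y [fe yx [s]]]]]]].
rewrite raddfD raddf_sum /= addrAC.
under [X in _ + X]eq_bigr do rewrite map_mxZ.
case/(IHn S L y) => [M [j [S' [phi' [z [fe' zy [s' ds]]]]]]].
exists M, (j \o i), S', (phi' \o phi), z; split.
- exact: flat_etale_comp.
- by move=> r /=; rewrite zy /= yx.
exists (fun k => if unlift ord0 k is Some l then s' l else phi' s).
rewrite big_ord_recl unlift_none; move: ds.
under eq_bigr do rewrite -map_mx_comp.
under [in X in _ -> X]eq_bigr do rewrite liftK.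
by rewrite map_mxD map_mxZ -!map_mx_comp zy addrA.
Qed.

(** ** Simple eigenvalues *)

Lemma mul_horner_mx_eigen (F : comNzRingType) n (T : 'M[F]_n.+1) m
    (v : 'M[F]_(m, n.+1)) a p :
  v *m T = a *: v -> v *m horner_mx T p = p.[a] *: v.
Proof.
move=> vT; elim/poly_ind: p => [|p c IHp].
  by rewrite rmorph0 mulmx0 horner0 scale0r.
rewrite rmorphD rmorphM /= horner_mx_X horner_mx_C mulmxDr mul_mx_scalar.
by rewrite mulmxA IHp -scalemxAl vT hornerMXaddC scalerDl scalerA.
Qed.

Lemma disc_simple_root (K : fieldType) n (T : 'M[K]_n.+1) a :
  mx_disc T != 0 -> root (char_poly T) a -> ~~ root (char_poly T)^`() a.
Proof.
move=> d0; rewrite -eigenvalue_root_char => /eigenvalueP [v vT v0].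
apply: contra v0 => /eqP fa; have := mul_horner_mx_eigen (char_poly T)^`() vT.
rewrite fa scale0r => /(congr1 (mulmx^~ (invmx (horner_mx T (char_poly T)^`())))).
by rewrite mul0mx mulmxK ?unitmxE ?unitfE // => ->.
Qed.

Lemma disc_uniq_roots (K : fieldType) n (T : 'M[K]_n.+1) rs :
  mx_disc T != 0 -> char_poly T = \prod_(a <- rs) ('X - a%:P) -> uniq rs.
Proof.
move=> d0 fE; have : forall a, a \in rs ->
    ~~ root (\prod_(a <- rs) ('X - a%:P))^`() a.
  move=> a ars; rewrite -fE; apply: disc_simple_root => //.
  by rewrite fE root_prod_XsubC.
elim: rs {fE d0} => //= a rs IHrs; rewrite big_cons derivM derivXsubC mul1r => H.
have a_rs : a \notin rs.
  have := H a (mem_head _ _); rewrite /root !hornerE subrr mul0r addr0.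
  by rewrite -[_ == 0]/(root _ a) root_prod_XsubC.
rewrite a_rs; apply: IHrs => b brs; have := H b; rewrite inE brs orbT => /(_ isT).
apply: contra => /eqP rb; rewrite /root !hornerE rb mulr0 addr0.
by rewrite -[_ == 0]/(root _ b) root_prod_XsubC.
Qed.

Section SplitPair.
Variables (R : comNzRingType) (B : fdalg R).
Local Notation N := (adim B).

(** The good pair over a field of exists_good_pair has coordinates that no
    section need attain; moving first the coordinates of d, then those of d',
    keeps the discriminant nonzero and makes both of them sections. *)
Lemma exists_split_pair (K : fieldType) (x : {rmorphism R -> K}) :
  (forall (L : fieldType) (y : {rmorphism R -> L}), ext_of x y -> vnr B y) ->
  exists (L : fieldType) (x' : {rmorphism R -> L}), ext_of x x' /\
    near x' (fun S phi y => exists (d d' : fdext B phi) (rs : seq L),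
      uniq rs /\ char_poly (map_mx y (fdL d *m fdR d')) =
                 \prod_(a <- rs) ('X - a%:P)).
Proof.
move=> reg; have [K1 [x1 [d [d' [xx1 dd]]]]] := exists_good_pair reg.
have [K2 [i [S [phi [y [fe yx [s ds]]]]]]] : exists (L : fieldType)
    (i : {rmorphism K1 -> L}), near (i \o x1) (fun S phi y =>
    exists s : 'I_N -> S, mx_disc (map_mx i 0 +
      \sum_j y (s j) *: map_mx i (fdL (fdb x1 j) *m fdR d')) != 0).
  apply: (@disc_approx _ _ _ _ _ _ _ ((d : 'rV_N) 0)).
  rewrite add0r; move: dd; rewrite [fdL d]fdL_sum mulmx_suml.
  by under eq_bigr do rewrite -scalemxAl.
have E2 r : i (x1 r) = (i \o x1) r by [].
pose d1 : fdext B phi := \row_j s j.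
have [K3 [j [S' [psi [z [fe' zy [s' ds']]]]]]] : exists (L : fieldType)
    (j : {rmorphism K2 -> L}), near (j \o y) (fun S phi z =>
    exists s' : 'I_N -> S, mx_disc (map_mx j 0 +
      \sum_k z (s' k) *:
        map_mx j (fdL (fdmap yx d1) *m fdR (fdb (i \o x1) k))) != 0).
  apply: (@disc_approx _ _ _ _ _ _ _ ((fdmap E2 d' : 'rV_N) 0)).
  have <- : fdL (fdmap yx d1) *m fdR (fdmap E2 d') =
      0 + \sum_k (fdmap E2 d' : 'rV_N) 0 k *:
        (fdL (fdmap yx d1) *m fdR (fdb (i \o x1) k)).
    rewrite add0r [fdR (fdmap E2 d')]fdR_sum mulmx_sumr.
    by apply: eq_bigr => k _; rewrite scalemxAr.
  have <- : map_mx i 0 +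
      \sum_j y (s j) *: map_mx i (fdL (fdb x1 j) *m fdR d') =
      fdL (fdmap yx d1) *m fdR (fdmap E2 d').
    rewrite map_mx0 add0r [fdL (fdmap yx d1)]fdL_sum mulmx_suml.
    apply: eq_bigr => k _; rewrite map_mxM (map_fdR E2) (map_fdL E2) fdmapb.
    by rewrite -scalemxAl fdmapE mxE.
  exact: ds.
have zx r : z ((psi \o phi) r) = (j \o (i \o x1)) r by rewrite /= zy /= yx.
have E3 r : j ((i \o x1) r) = (j \o (i \o x1)) r by [].
have E4 r : psi (phi r) = (psi \o phi) r by [].
pose d2 : fdext B (psi \o phi) := fdmap E4 d1.
pose d3 : fdext B (psi \o phi) := \row_k s' k.
have disc3 : mx_disc (map_mx z (fdL d2 *m fdR d3)) != 0.
  have -> : map_mx z (fdL d2 *m fdR d3) = map_mx j 0 + \sum_k z (s' k) *: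
      map_mx j (fdL (fdmap yx d1) *m fdR (fdb (i \o x1) k)).
    rewrite map_mx0 add0r map_mxM (map_fdL zx) (map_fdR zx).
    rewrite [fdR (fdmap _ d3)]fdR_sum mulmx_sumr; apply: eq_bigr => k _.
    rewrite map_mxM (map_fdL E3) (map_fdR E3) fdmapb.
    rewrite -scalemxAr fdmapE mxE; congr (_ *: (fdL _ *m _)).
    by apply/rowP => l; rewrite !fdmapE zy.
  exact: ds'.
pose T := map_mx z (fdL d2 *m fdR d3).
have [L [k [rs]]] := exists_split_ext (monic_neq0 (char_poly_monic T)).
rewrite (monicP (char_poly_monic _)) rmorph1 scale1r map_char_poly => rsE.
exists L, (k \o (j \o (i \o x1))); split.
  apply: ext_of_trans xx1 _; by exists (k \o (j \o i)).
exists S', (psi \o phi), (k \o z); split.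
- exact: flat_etale_comp.
- by move=> r; rewrite /= -[z _]/(z ((psi \o phi) r)) zx.
exists d2, d3, rs; have TE : map_mx (k \o z) (fdL d2 *m fdR d3) = map_mx k T.
  exact: map_mx_comp.
rewrite TE; split=> //; apply: disc_uniq_roots rsE.
by rewrite -map_mx_disc fmorph_eq0.
Qed.

End SplitPair.

(** * Lifting idempotents to etale neighbourhoods *)

(** The locus where an idempotent matrix vanishes is open: (1 - P) P = 0 makes
    det (1 - P) annihilate P, and this determinant is 1 where P is 0. *)
Lemma near_idem0 (S : comNzRingType) (K : fieldType) (y : {rmorphism S -> K}) n
    (P : 'M[S]_n) : P *m P = P -> map_mx y P = 0 ->
  near y (fun T psi z => map_mx psi P = 0).
Proof.
move=> PP P0; apply: near_mono (near_inv (s := \det (1%:M - P)) _) _.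
  by rewrite -det_map_mx map_mxB map_mx1 P0 subr0 det1 oner_eq0.
move=> T psi z _ [u uE].
have : \det (1%:M - P) *: P = 0.
  rewrite -mul_scalar_mx -mul_adj_mx -mulmxA mulmxBl mul1mx PP subrr.
  exact: mulmx0.
move/(congr1 (map_mx psi)); rewrite map_mxZ map_mx0.
by move/(congr1 (fun A => u *: A)); rewrite scalerA mulrC uE scale1r scaler0.
Qed.

(** The image of the idempotent P is free of rank n, with basis the rows of J
    and coordinates given by L. *)
Definition free_image (S : comPzRingType) N (P : 'M[S]_N) :=
  exists n (J : 'M[S]_(n, N)) (L : 'M[S]_(N, n)), J *m L = 1%:M /\ L *m J = P.

Lemma free_image_map (S T : comPzRingType) (f : {rmorphism S -> T}) N
  (P : 'M[S]_N) : free_image P -> free_image (map_mx f P).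
Proof.
case=> n [J [L [JL LJ]]]; exists n, (map_mx f J), (map_mx f L).
by rewrite -!map_mxM JL LJ map_mx1.
Qed.

Lemma minor_unit (K : fieldType) N (P : 'M[K]_N) :
  exists (f g : 'I_(\rank P) -> 'I_N),
    mxsub f g P \in unitmx /\ (P <= rowsub f P)%MS.
Proof.
pose f := maxrankfun P; pose C := (rowsub f P)^T.
have Cf : row_full C.
  rewrite /row_full mxrank_tr; apply/eqP.
  exact: eqP (maxrowsub_free P).
exists f, (fullrankfun Cf); split; last by rewrite eq_maxrowsub.
have := fullrowsub_unit Cf.
by rewrite -unitmx_tr; congr (_ \in unitmx); apply/matrixP => i j; rewrite !mxE.
Qed.

(** Rows of P that span its image at the point give a free summand in a
    neighbourhood; the projection P - L J on what is left is an idempotent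
    that vanishes at the point. *)
Lemma near_image (S : comNzRingType) (K : fieldType) (y : {rmorphism S -> K}) n
    (P : 'M[S]_n) : P *m P = P ->
  near y (fun T psi z => free_image (map_mx psi P)).
Proof.
move=> PP; have [f [g [fgu Pf]]] := minor_unit (map_mx y P).
pose D := mxsub f g P.
have yD : map_mx y D = mxsub f g (map_mx y P) by exact: map_mxsub.
apply: near_bind (near_inv (s := \det D) _) _.
  by rewrite -det_map_mx yD -unitfE -unitmxE.
move=> T psi z zy [u uE]; set P' := map_mx psi P.
have PP' : P' *m P' = P' by rewrite -map_mxM PP.
pose J := rowsub f P'; pose L := u *: (colsub g P' *m \adj (mxsub f g P')).
have JL : J *m L = 1%:M.
  rewrite -scalemxAr mulmxA; have -> : J *m colsub g P' = mxsub f g P'.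
    rewrite -[in RHS]PP'; apply/matrixP => i j; rewrite !mxE.
    by apply: eq_bigr => k _; rewrite !mxE.
  rewrite mul_mx_adj scale_scalar_mx -map_mxsub det_map_mx mulrC.
  by rewrite uE.
pose Q := L *m J; have QQ : Q *m Q = Q by rewrite mulmxA -[_ *m L]mulmxA JL mulmx1.
have JP : J *m P' = J by rewrite mul_rowsub_mx PP'.
have PL : P' *m L = L.
  rewrite -scalemxAr mulmxA; congr (_ *: (_ *m _)).
  rewrite -[in RHS]PP'; apply/matrixP => i j; rewrite !mxE.
  by apply: eq_bigr => k _; rewrite !mxE.
have QP : Q *m P' = Q by rewrite -mulmxA JP.
have PQ : P' *m Q = Q by rewrite mulmxA PL.
have zP : map_mx z P' = map_mx y P.
  by rewrite -map_mx_comp; apply: eq_map_mx => s /=; rewrite zy.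
apply: near_mono (near_idem0 (P := P' - Q) (y := z) _ _) _.
- by rewrite mulmxBl !mulmxBr PP' PQ QP QQ subrr subr0.
- have /submxP [W WE] : (map_mx z P' <= map_mx z J)%MS by rewrite map_mxsub zP.
  rewrite map_mxB -[in map_mx z Q]PQ map_mxM WE -mulmxA -map_mxM.
  by rewrite [J *m Q]mulmxA JL mul1mx subrr.
move=> T' psi' z' _ /eqP; rewrite map_mxB subr_eq0 => /eqP E.
have -> : map_mx (psi' \o psi) P = map_mx psi' P' by rewrite map_mx_comp.
rewrite E; apply: free_image_map; by exists _, J, L.
Qed.

(** ** Rank-one idempotents from simple eigenvalues *)

Section Primitive.
Variables (R : comNzRingType) (B : fdalg R).
Local Notation N := (adim B).

(** An idempotent e with e D e = S e, such that D e is free and nonzero at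
    every point. *)
Definition prim_idem (S : comPzRingType) (phi : {rmorphism R -> S})
    (e : fdext B phi) :=
  [/\ e * e = e, forall i, exists c, e * fdb phi i * e = c *: e,
      exists (u : fdext B phi) (k : 'cV[S]_N), (u * e : 'rV_N) *m k = 1%:M &
      free_image (fdR e)].

Lemma prim_idem_map (S T : comPzRingType) (phi : {rmorphism R -> S})
    (psi : {rmorphism S -> T}) (chi : {rmorphism R -> T})
    (E : forall r, psi (phi r) = chi r) (e : fdext B phi) :
  prim_idem e -> prim_idem (fdmap E e).
Proof.
case=> ee ebe [u [k uk]] fi; split.
- by rewrite -rmorphM ee.
- move=> i; have [c ec] := ebe i; exists (psi c).
  by rewrite -(fdmapb E) -!rmorphM ec; exact: fdmapZ.
- exists (fdmap E u), (map_mx psi k); rewrite -rmorphM.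
  by rewrite -[LHS]map_mxM uk map_mx1.
by rewrite -map_fdR; exact: free_image_map.
Qed.

Lemma prim_idemP (S : comPzRingType) (phi : {rmorphism R -> S})
    (e : fdext B phi) : prim_idem e -> forall z, exists c, e * z * e = c *: e.
Proof.
case=> _ ebe _ _ z; pose c i := projT1 (cid (ebe i)).
have cE i : e * fdb phi i * e = c i *: e by exact: projT2 (cid (ebe i)).
exists (\sum_i (z : 'rV_N) 0 i * c i).
rewrite {1}(fdb_sum z) mulr_sumr mulr_suml scaler_suml; apply: eq_bigr => i _.
by rewrite fd_scalerAr fd_scalerAl cE scalerA.
Qed.

(** A common eigenline of the commuting multiplications by d on the left and
    d' on the right, which is the whole eigenspace, is stable under
    z |-> u z u. *)
Lemma eigenline_sandwich (S : comNzRingType) (phi : {rmorphism R -> S})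
    (d d' : fdext B phi) b w g (u : fdext B phi) (k : 'cV[S]_N) :
  let T := fdL d *m fdR d' in
  w * g.[b] = 1 -> k *m (u : 'rV_N) = w *: horner_mx T g ->
  (u : 'rV_N) *m k = 1%:M -> horner_mx T g *m T = b *: horner_mx T g ->
  forall z, exists c, u * z * u = c *: u.
Proof.
move=> T wg ku uk gT z; set E := k *m (u : 'rV_N).
have uE : (u : 'rV_N) *m E = u by rewrite mulmxA uk mul1mx.
have commE A : A *m T = T *m A -> A *m E = E *m A.
  move=> AT; rewrite /E ku -scalemxAr -scalemxAl; congr (_ *: _).
  by have := @comm_mx_horner _ _ A T g AT; exact.
have line A : A *m T = T *m A -> exists c, (u : 'rV_N) *m A = c *: (u : 'rV_N).
  move=> AT; exists (((u : 'rV_N) *m A *m k) 0 0).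
  rewrite -{1}uE -mulmxA -commE // /E !mulmxA -mul_scalar_mx.
  by rewrite -mx11_scalar.
have [l dl] : exists l, d * u = l *: u.
  have [|l lE] := line (fdL d); last by exists l; rewrite -mul_fdL.
  by rewrite /T -mulmxA fdLR.
have [l' dl'] : exists l, u * d' = l *: u.
  have [|l1 lE] := line (fdR d'); last by exists l1; rewrite -mul_fdR.
  by rewrite /T mulmxA -fdLR.
have uT : (u : 'rV_N) *m T = b *: (u : 'rV_N).
  rewrite -{1}uE /E ku -scalemxAr -scalemxAl -mulmxA gT.
  by rewrite -scalemxAr scalerA mulrC -scalerA scalemxAr -ku uE.
have ll : l * l' = b.
  have : (l * l') *: (u : 'rV_N) = b *: (u : 'rV_N).
    rewrite -uT mulmxA mul_fdL mul_fdR dl fd_scalerAl dl'.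
    by rewrite scalerA.
  move/(congr1 (mulmx^~ k)); rewrite -!scalemxAl uk => /matrixP /(_ 0 0).
  by rewrite !mxE !mulr1.
have vT : (u * z * u : 'rV_N) *m T = b *: (u * z * u : 'rV_N).
  rewrite mulmxA mul_fdL mul_fdR -mulrA !mulrA dl -!mulrA dl'.
  by rewrite !fd_scalerAl !fd_scalerAr scalerA ll.
exists (((u * z * u : 'rV_N) *m k) 0 0).
have : (u * z * u : 'rV_N) *m E = u * z * u.
  by rewrite /E ku -scalemxAr (mul_horner_mx_eigen g vT) scalerA wg scale1r.
rewrite /E mulmxA => H; rewrite -[LHS]H [X in X *m _]mx11_scalar.
exact: mul_scalar_mx.
Qed.

(** When u D u lies on the line of u and u b_i u = c u with c invertible,
    c^-1 b_i u is an idempotent generating the same left ideal as u. *)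
Lemma sandwich_idem (S : comNzRingType) (phi : {rmorphism R -> S})
    (u : fdext B phi) (k : 'cV[S]_N) c c' i :
  (forall z, exists c, u * z * u = c *: u) -> (u : 'rV_N) *m k = 1%:M ->
  u * fdb phi i * u = c *: u -> c * c' = 1 ->
  let e := c' *: (fdb phi i * u) in
  [/\ e * e = e, forall j, exists c, e * fdb phi j * e = c *: e & u * e = u].
Proof.
move=> uzu uk uc cc e.
have ue : u * e = u by rewrite fd_scalerAr mulrA uc scalerA mulrC cc scale1r.
have eu z : e * z = c' *: (fdb phi i * (u * z)) by rewrite fd_scalerAl mulrA.
split=> //; first by rewrite eu ue.
move=> j; have [c1 c1E] := uzu (fdb phi j * (c' *: fdb phi i)).
exists c1; rewrite -mulrA eu.
have -> : u * (fdb phi j * e) = u * (fdb phi j * (c' *: fdb phi i)) * u.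
  by rewrite /e -fd_scalerAl !mulrA.
by rewrite c1E fd_scalerAr scalerA mulrC -scalerA.
Qed.

Section Line.
Variables (K : fieldType) (x : {rmorphism R -> K}).
Hypothesis reg : vnr B x.
Variables (S : comNzRingType) (phi : {rmorphism R -> S}) (y : {rmorphism S -> K}).
Hypothesis yx : forall r, y (phi r) = x r.
Variables (d d' : fdext B phi).
Let T := fdL d *m fdR d'.
Variables (a : K) (v : fdext B x).
Hypothesis disc : mx_disc (map_mx y T) != 0.
Hypothesis vT : (v : 'rV_N) *m map_mx y T = a *: (v : 'rV_N).
Hypothesis v0 : v <> 0.
Hypothesis v_line : forall w : 'rV_N, w *m map_mx y T = a *: w ->
  exists c, w = c *: (v : 'rV_N).

(** The projector g(T) / f'(b) onto the eigenline for a root b of the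
    characteristic polynomial f = (X - b) g. *)
Lemma near_projector : near y (fun S' psi z => exists b w g,
  let T' := map_mx psi T in
  [/\ z b = a, w * g.[b] = 1 & horner_mx T' g *m T' = b *: horner_mx T' g]).
Proof.
have ra : root (char_poly (map_mx y T)) a.
  rewrite -eigenvalue_root_char; apply/eigenvalueP; exists v => //.
  exact/eqP.
have [||S' [psi [z [fe zy [b [w [zb fb f'b]]]]]]] :=
    near_root (x := y) (a := a) (char_poly_monic T).
- by rewrite map_char_poly.
- by rewrite -deriv_map map_char_poly; exact: disc_simple_root.
exists S', psi, z; split=> //; move: fb f'b; rewrite -deriv_map map_char_poly.
set T' := map_mx psi T; move/eqP/factor_theorem => [g gE].
rewrite gE derivM derivXsubC mulr1 !hornerE subrr mulr0 add0r => gw.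
exists b, w, g; split=> //; first by rewrite mulrC.
have := Cayley_Hamilton T'; rewrite gE rmorphM rmorphB /= horner_mx_X horner_mx_C.
move/eqP; rewrite mulrBr subr_eq0 => /eqP E; exact: etrans E (mul_mx_scalar _ _).
Qed.

(** The projector G has rank one at the point, so that near it G = k u for a
    row u and a column k with u k = 1. *)
Lemma near_eigenline : near y (fun S' psi z => exists b w g
    (u : fdext B (psi \o phi)) (k : 'cV[S']_N),
  let T' := map_mx psi T in
  [/\ w * g.[b] = 1, horner_mx T' g *m T' = b *: horner_mx T' g,
      (u : 'rV_N) *m k = 1%:M, k *m (u : 'rV_N) = w *: horner_mx T' g &
      exists c, map_mx z (u : 'rV_N) = c *: (v : 'rV_N)]).
Proof.
apply: near_bind near_projector _ => S1 psi1 z1 zy1 [b [w [g [zb wg gT]]]].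
set T1 := map_mx psi1 T in gT; pose G := w *: horner_mx T1 g.
have zT1 : map_mx z1 T1 = map_mx y T.
  by rewrite -map_mx_comp; apply: eq_map_mx => s; exact: zy1.
have GG : G *m G = G.
  rewrite /G -scalemxAr -scalemxAl (mul_horner_mx_eigen g gT).
  by rewrite [w *: (g.[b] *: _)]scalerA wg scale1r.
have GT : map_mx z1 G *m map_mx y T = a *: map_mx z1 G.
  rewrite -zT1 -map_mxM /G -scalemxAl gT scalerA mulrC -scalerA.
  by rewrite map_mxZ zb.
have vG : (v : 'rV_N) *m map_mx z1 G = v.
  have vT1 : (v : 'rV_N) *m map_mx z1 T1 = a *: (v : 'rV_N) by rewrite zT1.
  rewrite map_mxZ map_horner_mx -scalemxAr (mul_horner_mx_eigen _ vT1).
  by rewrite -zb horner_map scalerA -rmorphM wg rmorph1 scale1r.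
have [i [j Gij]] : exists i j, z1 (G i j) != 0.
  apply: contrapT => nG; apply: v0; rewrite -[v]vG; apply/rowP => j.
  rewrite !mxE big1 // => i _; rewrite mxE.
  have [->|z0] := eqVneq (z1 (G i j)) 0; first by rewrite mulr0.
  by case: nG; exists i, j.
apply: near_bind (near_inv Gij) _ => S2 psi2 z2 zy2 [c cE].
set G2 := map_mx psi2 G; pose u := row i G2; pose k := c *: col j G2.
have GG2 : G2 *m G2 = G2 by rewrite -map_mxM GG.
have uG : u *m G2 = u by rewrite /u rowE -mulmxA GG2.
have Gk : G2 *m k = k by rewrite /k colE -scalemxAr mulmxA GG2.
have uk : u *m k = 1%:M.
  rewrite /u /k -scalemxAr rowE colE !mulmxA -[_ *m G2 *m G2]mulmxA GG2.
  rewrite -rowE -colE; apply/matrixP => p q; rewrite (ord1 p) (ord1 q).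
  rewrite [RHS]mxE eqxx mxE [X in c * X]mxE [X in c * X]mxE [X in c * X]mxE.
  by rewrite mulrC.
have zG2 : map_mx z2 G2 = map_mx z1 G.
  by rewrite -map_mx_comp; apply: eq_map_mx => s; exact: zy2.
have lines p : exists c, row p (map_mx z1 G) = c *: (v : 'rV_N).
  apply: v_line; rewrite -row_mul GT; apply/rowP => q; by rewrite !mxE.
have [c0 c0E] := lines i.
have zu : map_mx z2 u = c0 *: (v : 'rV_N) by rewrite /u map_row zG2.
have c0n : c0 != 0.
  apply/eqP => c00.
  have := congr1 (map_mx z2) uk; rewrite map_mxM zu c00 scale0r mul0mx map_mx1.
  by move/matrixP => /(_ 0 0) /esym/eqP; rewrite !mxE oner_eq0.
have /submxP [W WE] : (map_mx z2 G2 <= map_mx z2 u)%MS.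
  apply/row_subP => p; rewrite zG2 zu; have [c1 ->] := lines p.
  by rewrite -[c1](divfK c0n) -scalerA; apply: scalemx_sub.
have kuG : k *m u *m G2 = k *m u by rewrite -mulmxA uG.
have Gku : G2 *m (k *m u) = k *m u by rewrite mulmxA Gk.
have kuku : k *m u *m (k *m u) = k *m u.
  by rewrite mulmxA -[k *m u *m k]mulmxA uk mulmx1.
apply: near_mono (near_idem0 (P := G2 - k *m u) (y := z2) _ _) _.
- by rewrite mulmxBl !mulmxBr GG2 Gku kuG kuku subrr subr0.
- rewrite map_mxB -[in X in _ - X]Gku map_mxM WE -mulmxA -map_mxM.
  by rewrite [u *m _]mulmxA uk mul1mx subrr.
move=> S3 psi3 z3 zy3 /eqP; rewrite map_mxB subr_eq0 => /eqP E3.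
pose chi : {rmorphism S1 -> S3} := psi3 \o psi2.
have TE : map_mx ((psi3 \o psi2) \o psi1) T = map_mx chi T1.
  by rewrite -map_mx_comp.
have wg3 : chi w * (map_poly chi g).[chi b] = 1.
  by rewrite horner_map -rmorphM wg rmorph1.
have gT3 : horner_mx (map_mx chi T1) (map_poly chi g) *m map_mx chi T1 =
    chi b *: horner_mx (map_mx chi T1) (map_poly chi g).
  by rewrite -map_horner_mx -map_mxM gT map_mxZ.
have ku3 : map_mx psi3 k *m map_mx psi3 u =
    chi w *: horner_mx (map_mx chi T1) (map_poly chi g).
  by rewrite -map_horner_mx -map_mxZ -map_mxM -E3 -map_mx_comp.
exists (chi b), (chi w), (map_poly chi g), (map_mx psi3 u), (map_mx psi3 k).
rewrite TE; split; [exact: wg3|exact: gT3| |exact: ku3|].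
  by rewrite -map_mxM uk map_mx1.
exists c0; rewrite -zu -map_mx_comp; apply: eq_map_mx => s; exact: zy3.
Qed.

(** By regularity of the fibre u w u = u for some w, so that some u b_i u is a
    nonzero multiple of u; the eigenline of u then carries an idempotent. *)
Lemma near_prim_idem : near y (fun S' psi z => exists e : fdext B (psi \o phi),
  prim_idem e /\ v * (map_mx z (e : 'rV_N) : fdext B x) = v).
Proof.
apply: near_bind near_eigenline _ => S1 psi1 z1 zy1.
move=> [b [w [g [u [k [wg gT uk ku [c cv]]]]]]].
have E1 r : psi1 (phi r) = (psi1 \o phi) r by [].
have z1x r : z1 ((psi1 \o phi) r) = x r by rewrite /= zy1.
have TE : map_mx psi1 T = fdL (fdmap E1 d) *m fdR (fdmap E1 d').
  by rewrite map_mxM (map_fdL E1) (map_fdR E1).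
rewrite TE in gT ku; have uzu := eigenline_sandwich wg ku uk gT.
have c0 : c != 0.
  apply/eqP => c00.
  have := congr1 (map_mx z1) uk; rewrite map_mxM cv c00 scale0r mul0mx map_mx1.
  by move/matrixP => /(_ 0 0) /esym/eqP; rewrite !mxE oner_eq0.
pose ci i := projT1 (cid (uzu (fdb (psi1 \o phi) i))).
have ciE i : u * fdb (psi1 \o phi) i * u = ci i *: u.
  exact: projT2 (cid (uzu (fdb (psi1 \o phi) i))).
pose uK := fdmap z1x u.
have uKv : uK = c *: v by exact: cv.
have [l cl] : exists l, z1 (ci l) != 0.
  apply: contrapT => nl; have [w' w'E] := reg uK; apply: v0.
  have : uK = 0.
    rewrite -w'E (fdb_sum w') mulr_sumr mulr_suml big1 // => i _.
    rewrite fd_scalerAr fd_scalerAl -(fdmapb z1x) -!rmorphM ciE.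
    rewrite [X in _ *: X]fdmapZ.
    have [->|ni] := eqVneq (z1 (ci i)) 0; first by rewrite scale0r scaler0.
    by case: nl; exists i.
  by rewrite uKv => /eqP; rewrite scaler_eq0 (negPf c0) => /eqP.
apply: near_bind (near_inv cl) _ => S2 psi2 z2 zy2 [c' cc'].
have E2 r : psi2 ((psi1 \o phi) r) = (psi2 \o (psi1 \o phi)) r by [].
pose u2 := fdmap E2 u; pose k2 := map_mx psi2 k.
have uk2 : (u2 : 'rV_N) *m k2 = 1%:M by rewrite -map_mxM uk map_mx1.
have uzu2 z : exists c, u2 * z * u2 = c *: u2.
  exists (\sum_i (z : 'rV_N) 0 i * psi2 (ci i)).
  rewrite {1}(fdb_sum z) mulr_sumr mulr_suml scaler_suml; apply: eq_bigr => i _.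
  rewrite fd_scalerAr fd_scalerAl -scalerA; congr (_ *: _).
  by rewrite -(fdmapb E2) -!rmorphM ciE; exact: fdmapZ.
have u2c : u2 * fdb _ l * u2 = psi2 (ci l) *: u2.
  by rewrite -(fdmapb E2) -!rmorphM ciE; exact: fdmapZ.
have [ee ebe ue] := sandwich_idem uzu2 uk2 u2c cc'.
set e := _ *: _ in ee ebe ue.
apply: near_mono (near_image (P := fdR e) z2 _) _; first by rewrite -fdRM ee.
move=> S3 psi3 z3 zy3 fi.
have E3 r : psi3 ((psi2 \o (psi1 \o phi)) r) =
  (((psi3 \o psi2) \o psi1) \o phi) r by [].
exists (fdmap E3 e); split; last first.
  have z2x r : z2 ((psi2 \o (psi1 \o phi)) r) = x r by rewrite /= zy2 z1x.
  have -> : map_mx z3 (fdmap E3 e : 'rV_N) = fdmap z2x e.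
    by rewrite -map_mx_comp; apply: eq_map_mx => s; exact: zy3.
  apply: (scalerI c0); rewrite -fd_scalerAl -uKv.
  have -> : uK = fdmap z2x u2.
    by rewrite /fdmap -map_mx_comp; apply: eq_map_mx => s; rewrite /= zy2.
  exact: etrans (esym (rmorphM (fdmap z2x) u2 e)) (congr1 (fdmap z2x) ue).
split.
- by rewrite -rmorphM ee.
- move=> i; have [c1 c1E] := ebe i; exists (psi3 c1).
  rewrite -[RHS](fdmapZ E3) -c1E (rmorphM (fdmap E3) (e * _) e).
  rewrite (rmorphM (fdmap E3) e _); congr (_ * _ * _).
  exact: esym (fdmapb E3 i).
- exists (fdmap E3 u2), (map_mx psi3 k2).
  have -> : fdmap E3 u2 * fdmap E3 e = fdmap E3 u2.
    exact: etrans (esym (rmorphM (fdmap E3) u2 e)) (congr1 (fdmap E3) ue).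
  by rewrite -[LHS]map_mxM uk2 map_mx1.
by rewrite -map_fdR.
Qed.

End Line.

End Primitive.

(** * Splitting in an etale neighbourhood *)

(** Orthogonal systems of rank-one idempotents meeting every block: Morita
    equivalence between D and a finite power of S, put in terms of elements so
    that it persists under any change of base. *)
Definition split_datum (R : comNzRingType) (B : fdalg R) (S : comPzRingType)
    (phi : {rmorphism R -> S}) :=
  exists r (e : 'I_r -> fdext B phi),
  [/\ forall i, prim_idem (e i),
      forall i j, i <> j -> forall z, e i * z * e j = 0 &
      exists s (k : 'I_s -> 'I_r) (a b : 'I_s -> fdext B phi),
        1 = \sum_t a t * e (k t) * b t].

Section Eigenbasis.
Variables (K : fieldType) (n : nat) (T : 'M[K]_n.+1) (rs : seq K).
Hypotheses (urs : uniq rs) (Trs : char_poly T = \prod_(a <- rs) ('X - a%:P)).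

Lemma eigenbasis_size : size rs = n.+1.
Proof.
by apply/eqP; rewrite -eqSS -(size_prod_XsubC rs idfun) -Trs size_char_poly.
Qed.

(** Distinct eigenvalues: the eigenvectors form a basis V and each eigenspace
    is a line. *)
Lemma eigenbasis : exists V : 'M[K]_n.+1, V \in unitmx /\
  forall t : 'I_n.+1, row t V *m T = nth 0 rs t *: row t V /\
    forall w : 'rV_n.+1, w *m T = nth 0 rs t *: w -> exists c, w = c *: row t V.
Proof.
have srs := eigenbasis_size; pose a (t : 'I_n.+1) := nth 0 rs t.
have vP t : exists v : 'rV_n.+1, v *m T = a t *: v /\ v != 0.
  have : root (char_poly T) (a t) by rewrite Trs root_prod_XsubC mem_nth ?srs.
  rewrite -eigenvalue_root_char => /eigenvalueP [v vT v0]; by exists v.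
pose v t := projT1 (cid (vP t)).
have vT t : v t *m T = a t *: v t by case: (projT2 (cid (vP t))).
have v0 t : v t != 0 by case: (projT2 (cid (vP t))).
pose V := \matrix_t v t.
have aI s t : a s = a t -> s = t.
  by move/eqP; rewrite nth_uniq ?srs // => /eqP /val_inj.
have VE (c : 'rV_n.+1) : c *m V = \sum_t c 0 t *: v t.
  by rewrite mulmx_sum_row; apply: eq_bigr => t _; rewrite rowK.
have Vfree : row_free V.
  apply: inj_row_free => c; rewrite VE => cV; apply/rowP => t; rewrite mxE.
  pose p := \prod_(s | s != t) ('X - (a s)%:P).
  move/(congr1 (mulmx^~ (horner_mx T p))): cV; rewrite mul0mx mulmx_suml.
  rewrite (bigD1 t) //= big1 ?addr0 => [|s st]; last first.
    rewrite -scalemxAl (mul_horner_mx_eigen p (vT s)) /p (bigD1 s) //=.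
    by rewrite hornerM hornerXsubC subrr mul0r scale0r scaler0.
  rewrite -scalemxAl (mul_horner_mx_eigen p (vT t)) => /eqP.
  rewrite !scaler_eq0 (negPf (v0 t)) orbF => /orP [/eqP //|].
  rewrite /p horner_prod => /eqP /eqP; rewrite prodf_seq_eq0 => /hasP [s _].
  rewrite hornerXsubC subr_eq0 => /andP [st /eqP /aI E].
  by rewrite E eqxx in st.
have Vu : V \in unitmx by rewrite -row_free_unit.
exists V; split=> // t; rewrite rowK; split=> // w wT.
pose c := w *m invmx V; have wE : w = c *m V by rewrite mulmxKV.
have cE s : s != t -> c 0 s = 0.
  move=> st; pose c' : 'rV_n.+1 := \row_s (c 0 s * (a s - a t)).
  have : c' *m V = 0.
    have H : w *m T - a t *: w = 0 by rewrite wT subrr.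
    rewrite VE -[RHS]H wE VE mulmx_suml scaler_sumr -sumrB.
    apply: eq_bigr => q _; rewrite -scalemxAl vT mxE mulrBr scalerBl.
    by rewrite !scalerA [a t * _]mulrC.
  move/(congr1 (mulmx^~ (invmx V))); rewrite mulmxK // mul0mx.
  move/rowP => /(_ s); rewrite !mxE => /eqP; rewrite mulf_eq0 subr_eq0.
  by case/orP => [/eqP //|/eqP /aI E]; rewrite E eqxx in st.
exists (c 0 t); rewrite {1}wE VE (bigD1 t) //= big1 ?addr0 // => s st.
by rewrite cE // scale0r.
Qed.

End Eigenbasis.

Section Split.
Variables (R : comNzRingType) (B : fdalg R).
Local Notation N := (adim B).
Variables (K : fieldType) (x : {rmorphism R -> K}).
Hypothesis reg : vnr B x.

Lemma prim_idem_neq0 (e : fdext B x) : prim_idem e -> e <> 0.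
Proof.
case=> _ _ [u [k uk]] _ e0; move: uk; rewrite e0 mulr0 mul0mx.
by move/matrixP => /(_ 0 0) /esym/eqP; rewrite !mxE oner_eq0.
Qed.

Lemma fdmap_id_eq (S : comPzRingType) (phi chi : {rmorphism R -> S})
    (E : forall r, idfun (phi r) = chi r) (e : fdext B phi) :
  fdmap E e = e :> 'rV_N.
Proof. exact: map_mx_id. Qed.

(** Each of the N eigenlines of the multiplication by d and d' gives an
    idempotent e with v e = v for the eigenvector v, so that the left ideals
    D e together span D. *)
Lemma near_idems (S : comNzRingType) (phi : {rmorphism R -> S})
    (y : {rmorphism S -> K}) (yx : forall r, y (phi r) = x r)
    (d d' : fdext B phi) rs : uniq rs ->
  char_poly (map_mx y (fdL d *m fdR d')) = \prod_(a <- rs) ('X - a%:P) ->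
  exists V : 'M[K]_N, V \in unitmx /\
    near y (fun S' psi z => forall t : 'I_N, exists e : fdext B (psi \o phi),
      prim_idem e /\
      (row t V : fdext B x) * (map_mx z (e : 'rV_N) : fdext B x) = row t V).
Proof.
move=> urs cE; have [V [Vu VP]] := eigenbasis urs cE.
have disc := prod_XsubC_disc cE urs.
exists V; split=> //; apply: near_all.
  move=> t S1 psi1 z1 S2 psi2 z2 _ z21 [e [pe ve]].
  have E r : psi2 ((psi1 \o phi) r) = ((psi2 \o psi1) \o phi) r by [].
  exists (fdmap E e); split; first exact: prim_idem_map.
  rewrite -[RHS]ve; congr (_ * _); rewrite -[LHS]map_mx_comp.
  exact: eq_map_mx.
move=> t S1 psi z zy; have [vT vl] := VP t.
have zx r : z ((psi \o phi) r) = x r by rewrite /= zy yx.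
have E r : psi (phi r) = (psi \o phi) r by [].
have TE : map_mx z (fdL (fdmap E d) *m fdR (fdmap E d')) =
    map_mx y (fdL d *m fdR d').
  rewrite -(map_fdL E) -(map_fdR E) -map_mxM -map_mx_comp.
  by apply: eq_map_mx => s; exact: zy.
have v0 : (row t V : fdext B x) <> 0.
  move=> /(congr1 (mulmx^~ (invmx V))); rewrite -row_mul mulmxV // mul0mx.
  by move/rowP => /(_ t) /eqP; rewrite !mxE eqxx oner_eq0.
have := @near_prim_idem R B K x reg S1 (psi \o phi) z zx (fdmap E d)
  (fdmap E d') (nth 0 rs t) (row t V).
rewrite TE => /(_ disc vT v0 vl) /near_mono; apply=> S2 psi2 z2 _ [e [pe ve]].
have E2 r : idfun ((psi2 \o (psi \o phi)) r) = ((psi2 \o psi) \o phi) r by [].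
exists (fdmap E2 e); split; first exact: prim_idem_map.
by rewrite fdmap_id_eq.
Qed.

End Split.

Section Selection.
Variables (R : comNzRingType) (B : fdalg R).
Local Notation N := (adim B).
Variables (K : fieldType) (x : {rmorphism R -> K}).
Hypothesis reg : vnr B x.
Variables (S : comNzRingType) (phi : {rmorphism R -> S}) (y : {rmorphism S -> K}).
Hypothesis yx : forall r, y (phi r) = x r.
Variable e : 'I_N -> fdext B phi.
Hypothesis pe : forall t, prim_idem (e t).
Variable V : 'M[K]_N.
Hypothesis Vu : V \in unitmx.
Let eK t : fdext B x := fdmap yx (e t).
Hypothesis Ve : forall t, (row t V : fdext B x) * eK t = row t V.

Let peK t : prim_idem (eK t). Proof. exact: prim_idem_map. Qed.

Let indep (A : {set 'I_N}) := [forall i in A, forall j in A,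
  (i != j) ==> `[< forall z, eK i * z * eK j = 0 >]].

(** Every block contains an idempotent of a maximal family no two members of
    which lie in the same block. *)
Lemma exists_block_reps : exists A : {set 'I_N},
  (forall i j, i \in A -> j \in A -> i <> j -> forall z, eK i * z * eK j = 0) /\
  forall t, exists2 i, i \in A & exists z w, eK t * z * eK i * w * eK t <> 0.
Proof.
have i0 : indep set0 by apply/forall_inP => i; rewrite inE.
case: (arg_maxnP (fun A : {set 'I_N} => #|A|) i0) => A /forall_inP iA Amax.
exists A; split=> [i j iA' jA ij z|t].
  have /forall_inP /(_ _ jA) /implyP H := iA _ iA'.
  by move/asboolP: (H (introN eqP ij)); exact.
have eet : eK t * eK t = eK t by case: (peK t).
have [tA|tA] := boolP (t \in A).
  exists t => //; exists 1, 1; rewrite !mulr1 !eet.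
  exact: prim_idem_neq0.
apply: contrapT => nA.
have nA' i : i \in A -> forall z w, eK t * z * eK i * w * eK t = 0.
  move=> iA' z w; apply: contrapT => H; apply: nA; exists i => //.
  by exists z, w.
have half1 i : i \in A -> forall z, eK t * z * eK i = 0.
  move=> iA' z; have [w wE] := reg (eK t * z * eK i).
  rewrite -wE; have -> : eK t * z * eK i * w * (eK t * z * eK i) =
    eK t * z * eK i * w * eK t * (z * eK i) by rewrite !mulrA.
  by rewrite nA' ?mul0r.
have half2 i : i \in A -> forall z, eK i * z * eK t = 0.
  move=> iA' z; have [w wE] := reg (eK i * z * eK t).
  rewrite -wE -[X in X * _ * _]mulr1 -!mulrA.
  have -> : eK i * (z * (eK t * (1 * (w * (eK i * (z * eK t)))))) =
    eK i * z * (eK t * w * eK i * z * eK t) by rewrite mul1r !mulrA.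
  by rewrite nA' ?mulr0.
have /Amax : indep (t |: A).
  apply/forall_inP => i; rewrite !inE => iA'; apply/forall_inP => j.
  rewrite !inE => jA; apply/implyP => ij; apply/asboolP => z.
  case/predU1P: iA' => [Ei|iA']; case/predU1P: jA => [Ej|jA].
  - by rewrite Ei Ej eqxx in ij.
  - by rewrite Ei half1.
  - by rewrite Ej half2.
  have /forall_inP /(_ _ jA) /implyP H := iA _ iA'.
  by move/asboolP: (H ij); exact.
by rewrite cardsU1 tA /= ltnn.
Qed.

(** The map w |-> e_i w e_j is an idempotent matrix, so that its vanishing at
    the point spreads to a neighbourhood. *)
Lemma near_idems_orth i j : (forall z, eK i * z * eK j = 0) ->
  near y (fun T psi z => forall w : fdext B (psi \o phi),
    (map_mx psi (e i : 'rV_N) : fdext B (psi \o phi)) * w * map_mx psi (e j : 'rV_N)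
     = 0).
Proof.
move=> ij; pose P := fdL (e i) *m fdR (e j).
have PP : P *m P = P.
  have [[ii _ _ _] [jj _ _ _]] := (pe i, pe j).
  rewrite mulmxA -[fdL _ *m _ *m fdL _]mulmxA -fdLR -mulmxA -mulmxA -fdRM jj.
  by rewrite mulmxA -fdLM ii.
have P0 : map_mx y P = 0.
  apply: (@fd_mx_eq _ B _ x) => w.
  by rewrite map_mxM (map_fdL yx) (map_fdR yx) mulmxA mul_fdL mul_fdR ij mulmx0.
apply: near_mono (near_idem0 PP P0) _ => T psi z _ PT w.
have E r : psi (phi r) = (psi \o phi) r by [].
have : (w : 'rV_N) *m map_mx psi P = 0 by rewrite PT mulmx0.
by rewrite map_mxM (map_fdL E) (map_fdR E) mulmxA mul_fdL mul_fdR.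
Qed.

(** If e_t z e_i w e_t is nonzero at the point, it is an invertible multiple
    of e_t near it. *)
Lemma near_idems_block t i : (exists z w, eK t * z * eK i * w * eK t <> 0) ->
  near y (fun T psi z => exists a b : fdext B (psi \o phi),
    map_mx psi (e t : 'rV_N) =
    a * (map_mx psi (e i : 'rV_N) : fdext B (psi \o phi)) * b).
Proof.
move=> [z [w zw]].
have [l [m lm]] : exists l m,
    eK t * fdb x l * eK i * fdb x m * eK t <> 0.
  apply: contrapT => nlm; apply: zw.
  rewrite (fdb_sum z) mulr_sumr !mulr_suml big1 // => l _.
  rewrite (fdb_sum w) mulr_sumr mulr_suml big1 // => m _.
  have [lm0|/eqP lm] := eqVneq (eK t * fdb x l * eK i * fdb x m * eK t) 0.
    by rewrite !(fd_scalerAr, fd_scalerAl) lm0 !scaler0.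
  by case: nlm; exists l, m.
have [c cE] := prim_idemP (pe t) (fdb phi l * e i * fdb phi m).
have yc : y c != 0.
  apply/eqP => c0; apply: lm.
  have := congr1 (fdmap yx) cE; rewrite fdmapZ c0 scale0r => H.
  apply: etrans H; by rewrite !rmorphM /= !fdmapb !mulrA.
apply: near_mono (near_inv yc) _ => T psi z' _ [u uE].
have E r : psi (phi r) = (psi \o phi) r by [].
exists (u *: (fdmap E (e t) * fdb _ l)), (fdb _ m * fdmap E (e t)).
rewrite -![map_mx psi _]/(fdmap E _) !fd_scalerAl.
have -> : fdmap E (e t) * fdb _ l * fdmap E (e i) * (fdb _ m * fdmap E (e t)) =
    psi c *: fdmap E (e t).
  rewrite -fdmapZ -cE !rmorphM /= !fdmapb.
  by rewrite !mulrA.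
by rewrite scalerA mulrC uE scale1r.
Qed.

(** The products b_l e_t span the fibre, and a basis of the fibre stays a basis
    near the point. *)
Lemma near_idems_span : near y (fun T psi z =>
  exists s (k : 'I_s -> 'I_N) (a : 'I_s -> fdext B (psi \o phi)),
  1 = \sum_t a t * (map_mx psi (e (k t) : 'rV_N) : fdext B (psi \o phi))).
Proof.
pose I : finType := ('I_N * 'I_N)%type.
pose ev (p : 'I_#|I|) := enum_val p.
pose Z : 'M[S]_(#|I|, N) := \matrix_p (fdb phi (ev p).1 * e (ev p).2).
have ZK p : row p (map_mx y Z) = fdb x (ev p).1 * eK (ev p).2.
  by rewrite -map_row rowK -[LHS]/(fdmap yx _) rmorphM /= fdmapb.
have full : row_full (map_mx y Z).
  rewrite -sub1mx -(mulVmx Vu) mulmx_sub //; apply/row_subP => t.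
  rewrite -Ve [X in X * _](fdb_sum (row t V : fdext B x)) mulr_suml.
  apply: summx_sub => l _; rewrite fd_scalerAl; apply: scalemx_sub.
  apply: (eq_row_sub (enum_rank ((l, t) : I))).
  by rewrite ZK /ev enum_rankK.
pose g := fullrankfun full; pose D := rowsub g Z.
have yD : y (\det D) != 0.
  rewrite -det_map_mx map_mxsub -unitfE -unitmxE.
  exact: fullrowsub_unit.
apply: near_mono (near_inv yD) _ => T psi z' _ [u uE].
have E r : psi (phi r) = (psi \o phi) r by [].
pose c : 'rV[T]_N := u *: ((1 : fdext B (psi \o phi)) *m \adj (map_mx psi D)).
have c1 : c *m map_mx psi D = (1 : fdext B (psi \o phi)).
  rewrite -scalemxAl -mulmxA mul_adj_mx mul_mx_scalar scalerA det_map_mx.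
  by rewrite mulrC uE scale1r.
exists N, (fun q => (ev (g q)).2), (fun q => c 0 q *: fdb _ (ev (g q)).1).
rewrite -[LHS]c1 mulmx_sum_row; apply: eq_bigr => q _.
rewrite fd_scalerAl; congr (_ *: _); rewrite -map_row row_rowsub rowK.
by rewrite -[LHS]/(fdmap E _) rmorphM /= fdmapb.
Qed.

End Selection.

(** The conditions that turn a list of rank-one idempotents into a splitting
    datum: those indexed by A are orthogonal, each of the others is in the
    block of one of them, and together they generate the unit ideal. *)
Definition datum_cond (R : comNzRingType) (B : fdalg R)
    (A : {set 'I_(adim B)})
    (q : ('I_(adim B) * 'I_(adim B)) + 'I_(adim B) + unit)
    (S : comPzRingType) (phi : {rmorphism R -> S})
    (f : 'I_(adim B) -> fdext B phi) :=
  match q with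
  | inl (inl (i, j)) => i \in A -> j \in A -> i <> j ->
      forall w, f i * w * f j = 0
  | inl (inr t) => exists2 i, i \in A & exists a b, f t = a * f i * b
  | inr _ => exists s (k : 'I_s -> 'I_(adim B)) (a : 'I_s -> fdext B phi),
      1 = \sum_t a t * f (k t)
  end.

Lemma datum_cond_map (R : comNzRingType) (B : fdalg R) (A : {set 'I_(adim B)}) q
    (S T : comPzRingType) (phi : {rmorphism R -> S})
    (psi : {rmorphism S -> T}) (chi : {rmorphism R -> T})
    (E : forall r, psi (phi r) = chi r) (f : 'I_(adim B) -> fdext B phi)
    (g : 'I_(adim B) -> fdext B chi) :
  (forall t, g t = fdmap E (f t)) -> datum_cond A q f -> datum_cond A q g.
Proof.
move=> gE; case: q => [[[i j]|t]|u] /=.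
- move=> H iA jA ij w; rewrite (fdb_sum w) mulr_sumr mulr_suml big1 // => l _.
  rewrite fd_scalerAr fd_scalerAl !gE -(fdmapb E) -!rmorphM H //.
  by rewrite rmorph0 scaler0.
- move=> [i iA [a [b H]]]; exists i => //; exists (fdmap E a), (fdmap E b).
  by rewrite !gE H !rmorphM.
move=> [s [k [a H]]]; exists s, k, (fun t => fdmap E (a t)).
rewrite -(rmorph1 (fdmap E)) H rmorph_sum; apply: eq_bigr => t _.
by rewrite rmorphM gE.
Qed.

Lemma near_split_datum (R : comNzRingType) (B : fdalg R) (K : fieldType)
    (x : {rmorphism R -> K}) (reg : vnr B x) (S : comNzRingType)
    (phi : {rmorphism R -> S}) (y : {rmorphism S -> K})
    (yx : forall r, y (phi r) = x r) (e : 'I_(adim B) -> fdext B phi)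
    (V : 'M[K]_(adim B)) :
  (forall t, prim_idem (e t)) -> V \in unitmx ->
  (forall t, (row t V : fdext B x) * fdmap yx (e t) = row t V) ->
  near y (fun T psi z => split_datum B (psi \o phi)).
Proof.
move=> pe Vu Ve; have [A [Aorth Arep]] := exists_block_reps reg yx pe.
pose em (T : comNzRingType) (psi : {rmorphism S -> T}) t : fdext B (psi \o phi) :=
  map_mx psi (e t : 'rV_(adim B)).
suff: near y (fun T psi z => forall q, datum_cond A q (em T psi)).
  move/near_mono; apply=> T psi z _ H.
  have E r : psi (phi r) = (psi \o phi) r by [].
  exists #|A|, (fun i => em T psi (enum_val i)); split=> [i|i j ij w|].
  - exact: (prim_idem_map E).
  - apply: (H (inl (inl (enum_val i, enum_val j)))); try exact: enum_valP.
    by move/enum_val_inj.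
  have [s [k [a kE]]] := H (inr tt).
  have bP t : exists i (a b : fdext B (psi \o phi)),
      em T psi t = a * em T psi (enum_val (A := mem A) i) * b.
    have [i iA [c [d cd]]] := H (inl (inr t)).
    by exists (enum_rank_in iA i), c, d; rewrite enum_rankK_in.
  pose i t := projT1 (cid (bP t)).
  pose c t := projT1 (cid (projT2 (cid (bP t)))).
  pose d t := projT1 (cid (projT2 (cid (projT2 (cid (bP t)))))).
  have cd t : em T psi t = c t * em T psi (enum_val (i t)) * d t.
    exact: projT2 (cid (projT2 (cid (projT2 (cid (bP t)))))).
  exists s, (fun t => i (k t)), (fun t => a t * c (k t)), (fun t => d (k t)).
  by rewrite [LHS]kE; apply: eq_bigr => t _; rewrite cd !mulrA.
apply: near_all => [q S1 psi1 z1 S2 psi2 z2 _ _|q S1 psi z zy].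
  have E r : psi2 ((psi1 \o phi) r) = ((psi2 \o psi1) \o phi) r by [].
  by apply: (datum_cond_map (E := E)) => t; rewrite /em [LHS]map_mx_comp.
have zx r : z ((psi \o phi) r) = x r by rewrite /= zy yx.
have E r : psi (phi r) = (psi \o phi) r by [].
have pe' t : prim_idem (em S1 psi t) by exact: (prim_idem_map E).
have eK t : fdmap zx (em S1 psi t) = fdmap yx (e t).
  by rewrite /fdmap /em -map_mx_comp; apply: eq_map_mx => s; exact: zy.
have Ve' t : (row t V : fdext B x) * fdmap zx (em S1 psi t) = row t V.
  by rewrite eK.
suff: near z (fun T psi2 z2 => datum_cond A q (fun t =>
    map_mx psi2 (em S1 psi t : 'rV_(adim B)) : fdext B (psi2 \o (psi \o phi)))).
  move/near_mono; apply=> T psi2 z2 _.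
  have E2 r : idfun ((psi2 \o (psi \o phi)) r) = ((psi2 \o psi) \o phi) r by [].
  apply: (datum_cond_map (E := E2)) => t; rewrite fdmap_id_eq.
  by rewrite /em [LHS]map_mx_comp.
case: q => [[[i j]|t]|u].
- have [iA|iA] := boolP (i \in A); last first.
    by apply: near_id => /=; rewrite (negPf iA).
  have [jA|jA] := boolP (j \in A); last first.
    by apply: near_id => /=; rewrite (negPf jA).
  have [ij|/eqP ij] := eqVneq i j; first by apply: near_id => /= _ _ /(_ ij).
  have := @near_idems_orth R B K x S1 (psi \o phi) z zx (em S1 psi) pe' i j.
  case=> [w|T [psi2 [z2 [fe zy2 H]]]]; first by rewrite !eK; exact: Aorth.
  by exists T, psi2, z2; split=> // _ _ _; exact: H.
- have [i iA [w [w' ww]]] := Arep t.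
  have := @near_idems_block R B K x S1 (psi \o phi) z zx (em S1 psi) pe' t i.
  case=> [|T [psi2 [z2 [fe zy2 H]]]]; first by exists w, w'; rewrite !eK.
  by exists T, psi2, z2; split=> //; exists i.
have := @near_idems_span R B K x S1 (psi \o phi) z zx (em S1 psi) V Vu Ve'.
by case=> [T [psi2 [z2 [fe zy2 H]]]]; exists T, psi2, z2.
Qed.

(** An algebra whose geometric fibre at x is semisimple is split over an etale
    neighbourhood of x. *)
Lemma near_split (R : comNzRingType) (B : fdalg R) (K : fieldType)
    (x : {rmorphism R -> K}) :
  (forall (L : fieldType) (y : {rmorphism R -> L}), ext_of x y -> vnr B y) ->
  exists (L : fieldType) (x' : {rmorphism R -> L}), ext_of x x' /\
    near x' (fun S phi y => split_datum B phi).
Proof.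
move=> reg; have [L [x' [xx' H]]] := exists_split_pair reg.
exists L, x'; split=> //; apply: near_bind H _.
move=> S phi y yx [d [d' [rs [urs cE]]]].
have [V [Vu nV]] := near_idems (reg _ _ xx') yx urs cE.
apply: near_bind nV _ => S1 psi z zy eP.
pose e t := projT1 (cid (eP t)).
have [pe Ve] : (forall t, prim_idem (e t)) /\ (forall t,
    (row t V : fdext B x') * (map_mx z (e t : 'rV_(adim B)) : fdext B x')
    = row t V).
  by split=> t; case: (projT2 (cid (eP t))).
have zx r : z ((psi \o phi) r) = x' r by rewrite /= zy yx.
have := near_split_datum (reg _ _ xx') (yx := zx) pe Vu Ve.
move/near_mono; apply=> T psi2 z2 _ [r [f [pf fo [s [k [a [b ab]]]]]]].
have E r' : idfun ((psi2 \o (psi \o phi)) r') = ((psi2 \o psi) \o phi) r'.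
  by [].
exists r, (fun i => fdmap E (f i)); split=> [i|i j ij w|].
- exact: prim_idem_map.
- have [w' ->] : exists w', w = fdmap E w' by exists w; rewrite fdmap_id_eq.
  by rewrite -!rmorphM fo // rmorph0.
exists s, k, (fun t => fdmap E (a t)), (fun t => fdmap E (b t)).
rewrite -(rmorph1 (fdmap E)) ab rmorph_sum; apply: eq_bigr => t _.
by rewrite !rmorphM.
Qed.

(** * Comodules in coordinates *)

Section BasisAlong.
Variables (R : comPzRingType) (G : affGroup R).
Local Notation A := (coord_ring G).
Local Notation eta := (str G).
Variables (S : comPzRingType) (phi : {rmorphism R -> S}).

(** The elements 1 (x) a l form a basis of S (x)_R A, with coordinate
    functions extending the phi-semilinear chi l. *)
Record basis_along N (a : 'I_N -> A) (chi : 'I_N -> A -> S) : Prop := {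
  ba_add : forall l, {morph chi l : b c / b + c};
  ba_scale : forall l r b, chi l (eta r * b) = phi r * chi l b;
  ba_dual : forall l m, chi l (a m) = (l == m)%:R;
  ba_gen : forall b, ptens phi eta 1 b = \sum_l ptens phi eta (chi l b) (a l)
}.

Variables (N : nat) (a : 'I_N -> A) (chi : 'I_N -> A -> S).
Hypothesis ba : basis_along a chi.

(** The form in which the basis is used: a balanced map expands along it. *)
Lemma ba_expand (Z : zmodType) (f : S -> A -> Z) :
  @balanced R (alg phi) (alg eta) Z f ->
  forall b, f 1 b = \sum_l f (chi l b) (a l).
Proof.
move=> bf b; have := congr1 (@tlift R (alg phi) (alg eta) Z f) (ba_gen ba b).
rewrite /ptens tlift_tens // => ->; rewrite tlift_sum //.
by apply: eq_bigr => l _; rewrite tlift_tens.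
Qed.

Lemma ba_semilinear (g : A -> S) : {morph g : b c / b + c} ->
  (forall r b, g (eta r * b) = phi r * g b) ->
  forall b, g b = \sum_l chi l b * g (a l).
Proof.
move=> gD gZ b; have := @ba_expand S (fun s b => s * g b) _ b.
rewrite mul1r; apply; apply: balanced_ring => [s s' c|s c c'|r s c].
- by rewrite mulrDl.
- by rewrite gD mulrDr.
by rewrite gZ mulrCA mulrA.
Qed.

Lemma ba_balanced2 (g h : A -> S) :
  {morph g : b c / b + c} -> (forall r b, g (eta r * b) = phi r * g b) ->
  {morph h : b c / b + c} -> (forall r b, h (eta r * b) = phi r * h b) ->
  @balanced R (alg eta) (alg eta) S (fun b c => g b * h c).
Proof.
move=> gD gZ hD hZ; apply: balanced_ring => [b b' c|b c c'|r b c].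
- by rewrite gD mulrDl.
- by rewrite hD mulrDr.
by rewrite gZ hZ mulrCA mulrA.
Qed.

Lemma ba_balanced i j :
  @balanced R (alg eta) (alg eta) S (fun b c => chi i b * chi j c).
Proof. by apply: ba_balanced2; case: ba. Qed.

(** Coordinates of the comultiplication. *)
Definition ba_cst i j l : S :=
  @tlift R (alg eta) (alg eta) S (fun b c => chi i b * chi j c) (comul G (a l)).

Lemma ba_comul i j b :
  @tlift R (alg eta) (alg eta) S (fun b c => chi i b * chi j c) (comul G b) =
  \sum_l chi l b * ba_cst i j l.
Proof.
apply: (@ba_semilinear (fun b => @tlift R (alg eta) (alg eta) S
  (fun b c => chi i b * chi j c) (comul G b))) => [c c'|r c].
  by rewrite rmorphD tliftD //; exact: ba_balanced.
have -> : comul G (eta r * c) = r *: (comul G c : tensor (alg eta) (alg eta)).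
  by rewrite -comulZ.
rewrite tlift_scale; last exact: ba_balanced.
rewrite (tlift_additive (h := fun s => phi r * s)); last first.
  by move=> s s'; rewrite mulrDr.
by apply: eq_tlift => d e; rewrite alg_scaleE (ba_scale ba) mulrA.
Qed.

(** Coassociativity in coordinates. *)
Lemma ba_cstA i j k m : \sum_l ba_cst j k l * ba_cst i l m =
                        \sum_l ba_cst i j l * ba_cst l k m.
Proof.
have bf : balanced3 (fun b c d : alg eta => chi i b * chi j c * chi k d).
  have [chiD chiZ _ _] := ba.
  by split=> [b|d]; apply: balanced_ring => *; rewrite ?chiD ?chiZ; ring.
have := comulA3 (a m) bf.
have E1 b c : tlift (fun c d : alg eta => chi i b * chi j c * chi k d) (comul G c)
    = \sum_l ba_cst j k l * (chi i b * chi l c).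
  transitivity (chi i b * tlift (fun c d : alg eta => chi j c * chi k d)
      (comul G c)).
    rewrite (tlift_additive (h := fun s => chi i b * s)); last first.
      by move=> s s'; rewrite mulrDr.
    by apply: eq_tlift => d e; rewrite mulrA.
  rewrite ba_comul mulr_sumr; apply: eq_bigr => l _.
  by ring.
have E2 b d : tlift (fun b c : alg eta => chi i b * chi j c * chi k d) (comul G b)
    = \sum_l ba_cst i j l * (chi l b * chi k d).
  transitivity (tlift (fun b c : alg eta => chi i b * chi j c)
      (comul G b) * chi k d).
    rewrite (tlift_additive (h := fun s => s * chi k d)) //.
    by move=> s s'; rewrite mulrDl.
  rewrite ba_comul mulr_suml; apply: eq_bigr => l _.
  by ring.
have sw (F : 'I_N -> S) (f : 'I_N -> A -> A -> S) t :
    tlift (fun b c : alg eta => \sum_l F l * f l b c) t =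
    \sum_l F l * tlift (fun b c : alg eta => f l b c) t.
  rewrite /tlift exchange_big; apply: eq_bigr => l _.
  by rewrite mulr_sumr.
move=> H; transitivity (tlift (fun b c : alg eta =>
    \sum_l ba_cst j k l * (chi i b * chi l c)) (comul G (a m))).
  by rewrite sw.
transitivity (tlift (fun b c : alg eta =>
    \sum_l ba_cst i j l * (chi l b * chi k c)) (comul G (a m))); last first.
  by rewrite sw.
transitivity (tlift (fun b c : alg eta =>
    tlift (fun c d : alg eta => chi i b * chi j c * chi k d) (comul G c))
    (comul G (a m))); first by apply: eq_tlift => b c; rewrite E1.
by rewrite H; apply: eq_tlift => b c; rewrite E2.
Qed.

Lemma ba_counit b :
  phi (counit G b) = \sum_l chi l b * phi (counit G (a l)).
Proof.
apply: (@ba_semilinear (fun b => phi (counit G b))) => [c d|r c].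
  by rewrite !rmorphD.
by rewrite !rmorphM counit_str.
Qed.

Lemma ba_cst1l i m :
  \sum_l phi (counit G (a l)) * ba_cst l i m = (i == m)%:R.
Proof.
have [chiD chiZ chid _] := ba; rewrite -(chid i m) -[a m in RHS]counitl.
rewrite (tlift_additive (h := chi i)); last exact: chiD.
rewrite /ba_cst /tlift; under eq_bigr do rewrite mulr_sumr.
rewrite exchange_big; apply: eq_bigr => p _ /=.
rewrite chiZ ba_counit mulr_suml; apply: eq_bigr => l _.
by rewrite mulrA [chi l _ * _]mulrC.
Qed.

Lemma ba_cst1r i m :
  \sum_l phi (counit G (a l)) * ba_cst i l m = (i == m)%:R.
Proof.
have [chiD chiZ chid _] := ba; rewrite -(chid i m) -[a m in RHS]counitr.
rewrite (tlift_additive (h := chi i)); last exact: chiD.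
rewrite /ba_cst /tlift; under eq_bigr do rewrite mulr_sumr.
rewrite exchange_big; apply: eq_bigr => p _ /=.
rewrite [p.1 * _]mulrC chiZ ba_counit mulr_suml; apply: eq_bigr => l _.
by ring.
Qed.

Section Action.
Variables (M : lmodType R) (sc : S -> M -> M).

(** Scalars from S act on an R-module M: this presents S-modules as modules over
    R, which is where linear reductivity is assumed. *)
Record act_along : Prop := {
  act_addl : forall s s' m, sc (s + s') m = sc s m + sc s' m;
  act_addr : forall s m m', sc s (m + m') = sc s m + sc s m';
  act_scale : forall r m, sc (phi r) m = r *: m;
  act_mul : forall s s' m, sc (s * s') m = sc s (sc s' m)
}.

Hypothesis scP : act_along.

Lemma act_1 m : sc 1 m = m.
Proof. by rewrite -(rmorph1 phi) act_scale // scale1r. Qed.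

Lemma act_scalel r s m : sc (phi r * s) m = r *: sc s m.
Proof. by rewrite act_mul // act_scale. Qed.

Lemma act_scaler r s m : sc s (r *: m) = r *: sc s m.
Proof. by rewrite -!(act_scale scP) -!act_mul // mulrC. Qed.

Lemma act_0 s : sc s 0 = 0.
Proof. by apply: (addrI (sc s 0)); rewrite -act_addr // !addr0. Qed.

Definition tcoord l (t : tensor M (alg eta)) : M :=
  tlift (fun (m : M) (b : alg eta) => sc (chi l b) m) t.

Lemma balanced_tcoord l :
  balanced (fun (m : M) (b : alg eta) => sc (chi l b) m).
Proof.
have [chiD chiZ _ _] := ba.
split=> [m m' b|m b b'|r m b]; first exact: act_addr.
  by rewrite chiD act_addl.
by rewrite act_scaler alg_scaleE chiZ act_scalel.
Qed.

Lemma tcoordD l : {morph tcoord l : t u / t + u}.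
Proof. by move=> t u; exact: tliftD (balanced_tcoord l). Qed.

Lemma tcoord_tens l m b : tcoord l (m *t (b : alg eta)) = sc (chi l b) m.
Proof. exact: tlift_tens (balanced_tcoord l). Qed.

Lemma tcoord_sum l I r (F : I -> tensor M (alg eta)) :
  tcoord l (\sum_(i <- r) F i) = \sum_(i <- r) tcoord l (F i).
Proof. exact: tlift_sum (balanced_tcoord l). Qed.

Lemma tcoord_basis l (w : 'I_N -> M) :
  tcoord l (\sum_m w m *t (a m : alg eta)) = w l.
Proof.
have [_ _ chid _] := ba.
rewrite tcoord_sum (bigD1 l) //= big1 ?addr0 => [|m /negPf ml].
  by rewrite tcoord_tens chid eqxx act_1.
rewrite tcoord_tens chid eq_sym ml mulr0n -(rmorph0 phi) act_scale //.
exact: scale0r.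
Qed.

Lemma act_tens m b : m *t (b : alg eta) =
  \sum_l sc (chi l b) m *t (a l : alg eta).
Proof.
rewrite -{1}[m]act_1.
apply: (@ba_expand _ (fun s b => sc s m *t (b : alg eta))).
apply: balanced_ring => [s s' c|s c c'|r s c].
- by rewrite act_addl // tensDl.
- exact: tensDr.
by rewrite act_scalel // tensZ.
Qed.

Lemma tcoordE t : t = \sum_l tcoord l t *t (a l : alg eta).
Proof.
elim/tensor_ind: t => [|m b|t u {1}-> {1}->].
- rewrite big1 // => l _; rewrite /tcoord tlift0; last exact: balanced_tcoord.
  by apply: (addrI (0 *t (a l : alg eta))); rewrite -tensDl !addr0.
- by rewrite {1}act_tens; apply: eq_bigr => l _; rewrite tcoord_tens.
by rewrite -big_split; apply: eq_bigr => l _ /=; rewrite tcoordD tensDl.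
Qed.

Lemma act_tens2 m (t : tensor (alg eta) (alg eta)) :
  tlift (fun c d : alg eta => m *t (c *t d)) t =
  \sum_i \sum_j sc (@tlift R (alg eta) (alg eta) S
    (fun b c => chi i b * chi j c) t) m *t
    ((a i : alg eta) *t (a j : alg eta)).
Proof.
have bt : balanced (fun c d : alg eta => m *t (c *t d)).
  by case: (balanced3_tens M (alg eta) (alg eta)) => + _; apply.
move: t; apply: (@tensor_eq R (alg eta) (alg eta)) => [x y|x y|c d].
- exact: tliftD.
- rewrite -big_split; apply: eq_bigr => i _; rewrite -big_split.
  apply: eq_bigr => j _ /=; rewrite tliftD; last exact: ba_balanced.
  by rewrite act_addl // tensDl.
rewrite tlift_tens //.
have b1 (d' : alg eta) m' : @balanced R (alg phi) (alg eta) _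
    (fun s c => sc s m' *t ((c : alg eta) *t d')).
  apply: balanced_ring => [s s' e|s e e'|r s e].
  - by rewrite act_addl // tensDl.
  - by rewrite -tensDr; congr (_ *t _); exact: tensDl.
  by rewrite act_scalel // tensZ scale_tens.
have b2 (c' : alg eta) m' : @balanced R (alg phi) (alg eta) _
    (fun s d => sc s m' *t (c' *t (d : alg eta))).
  apply: balanced_ring => [s s' e|s e e'|r s e].
  - by rewrite act_addl // tensDl.
  - by rewrite -tensDr; congr (_ *t _); exact: tensDr.
  by rewrite act_scalel // tensZ scale_tens tensZ.
rewrite -{1}[m]act_1 (ba_expand (b1 d m) c); apply: eq_bigr => i _.
rewrite -{1}[sc _ m]act_1 (ba_expand (b2 _ _) d); apply: eq_bigr => j _.
rewrite tlift_tens; last exact: ba_balanced.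
by rewrite -act_mul // mulrC.
Qed.

End Action.

End BasisAlong.

Section DualAlgebra.
Variables (R : comPzRingType) (G : affGroup R).
Local Notation A := (coord_ring G).
Local Notation eta := (str G).
Variables (S : comPzRingType) (phi : {rmorphism R -> S}).
Variables (n : nat) (a : 'I_n.+1 -> A) (chi : 'I_n.+1 -> A -> S).
Hypothesis ba : basis_along phi a chi.
Local Notation cst := (ba_cst a chi).

Lemma dual_acstA i j k :
  \sum_l (\row_m cst j k m : 'rV_n.+1) 0 l *: (\row_m cst i l m : 'rV[S]_n.+1) =
  \sum_l (\row_m cst i j m : 'rV_n.+1) 0 l *: (\row_m cst l k m : 'rV_n.+1).
Proof.
apply/rowP => m; rewrite !summxE.
under eq_bigr do rewrite !mxE; under [RHS]eq_bigr do rewrite !mxE.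
exact: (ba_cstA ba).
Qed.

Lemma dual_acst1l i : \sum_l (\row_m phi (counit G (a m)) : 'rV_n.+1) 0 l *:
  (\row_m cst l i m : 'rV[S]_n.+1) = delta_mx 0 i.
Proof.
apply/rowP => m; rewrite summxE [RHS]mxE eqxx /= eq_sym.
under eq_bigr do rewrite !mxE; exact: (ba_cst1l ba).
Qed.

Lemma dual_acst1r i : \sum_l (\row_m phi (counit G (a m)) : 'rV_n.+1) 0 l *:
  (\row_m cst i l m : 'rV[S]_n.+1) = delta_mx 0 i.
Proof.
apply/rowP => m; rewrite summxE [RHS]mxE eqxx /= eq_sym.
under eq_bigr do rewrite !mxE; exact: (ba_cst1r ba).
Qed.

(** The convolution algebra dual to S (x)_R A, in the dual basis; comodules
    are its left modules. *)
Definition dual_alg : fdalg S := FdAlg dual_acstA dual_acst1l dual_acst1r.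

Section ModData.
Variables (M : lmodType R) (sc : S -> M -> M).
Hypothesis scP : act_along phi sc.

(** The action rho l of the l-th dual basis vector determines a module. *)
Record mod_data (rho : 'I_n.+1 -> M -> M) : Prop := {
  md_add : forall l, {morph rho l : m m' / m + m'};
  md_sc : forall l s m, rho l (sc s m) = sc s (rho l m);
  md_mul : forall i j m, rho i (rho j m) = \sum_l sc (cst i j l) (rho l m);
  md_one : forall m, \sum_l sc (phi (counit G (a l))) (rho l m) = m
}.

Variable rho : 'I_n.+1 -> M -> M.
Hypothesis rhoP : mod_data rho.

Definition data_coact (m : M) : tensor M (alg eta) :=
  \sum_l rho l m *t (a l : alg eta).

Lemma data_coact_linear : linear data_coact.
Proof.
move=> r m m'; rewrite /data_coact scaler_sumr -big_split.
apply: eq_bigr => l _ /=; rewrite (md_add rhoP) tensDl; congr (_ + _).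
by rewrite scale_tens -!(act_scale scP) (md_sc rhoP).
Qed.

HB.instance Definition _ :=
  GRing.isLinear.Build R M (tensor M (alg eta)) _ data_coact data_coact_linear.

Lemma tlift_data_coact (Z : zmodType) (f : M -> alg eta -> Z) m : balanced f ->
  tlift f (data_coact m) = \sum_l f (rho l m) (a l).
Proof.
move=> bf; rewrite /data_coact tlift_sum //; apply: eq_bigr => l _.
exact: tlift_tens.
Qed.

Lemma data_coactA (v : M) :
  tlift (fun (w : M) (b : alg eta) =>
    tlift (fun c d : alg eta => w *t (c *t d)) (comul G b)) (data_coact v) =
  tlift (fun (w : M) (b : alg eta) =>
    tlift (fun (u : M) (c : alg eta) => u *t (c *t b)) (data_coact w))
      (data_coact v).
Proof.
have b3 := balanced3_tens M (alg eta) (alg eta).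
rewrite !tlift_data_coact; last 2 first.
- apply: balanced_compl (balanced_nestedl b3); first exact: linearD.
  by move=> r m; exact: linearZ.
- apply: balanced_compr (balanced_nestedr b3); first exact: comulD.
  exact: comulZ.
under eq_bigr do rewrite (act_tens2 ba scP).
under [RHS]eq_bigr => j _.
  rewrite tlift_data_coact; last by case: b3 => _; exact.
  under eq_bigr do rewrite (md_mul rhoP).
  over.
rewrite exchange_big /= [RHS]exchange_big /=; apply: eq_bigr => i _.
rewrite exchange_big /=; apply: eq_bigr => j _.
symmetry; apply: (big_morph (fun m => m *t ((a i : alg eta) *t (a j : alg eta)))).
  by move=> m m'; exact: tensDl.
by apply: (addrI (0 *t ((a i : alg eta) *t (a j : alg eta))));
  rewrite -tensDl !addr0.
Qed.

Lemma data_coact1 (v : M) :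
  tlift (fun (w : M) (b : alg eta) => counit G b *: w) (data_coact v) = v.
Proof.
rewrite tlift_data_coact; last first.
  split=> [m m' b|m b b'|r m b].
  - by rewrite scalerDr.
  - by rewrite rmorphD scalerDl.
  by rewrite scalerA; congr (_ *: _); rewrite alg_scaleE rmorphM counit_str mulrC.
rewrite -[RHS](md_one rhoP); apply: eq_bigr => l _.
by rewrite (act_scale scP).
Qed.

Definition data_comod : comod G := Comod data_coactA data_coact1.

Lemma data_coactE (m : M) :
  coact data_comod m = \sum_l rho l m *t (a l : alg eta).
Proof. by []. Qed.

Lemma data_invariant (m : M) : @invariant R G data_comod m <->
  forall l, rho l m = sc (chi l 1) m.
Proof.
rewrite /invariant data_coactE; split=> [H l|H].
  have := congr1 (tcoord chi sc l) H.
  by rewrite (tcoord_basis ba scP) (tcoord_tens ba scP).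
by rewrite (act_tens ba scP); apply: eq_bigr => l _; rewrite H.
Qed.

End ModData.

Lemma data_morphism (M M' : lmodType R) (sc : S -> M -> M) (sc' : S -> M' -> M')
    (scP : act_along phi sc) (scP' : act_along phi sc') rho rho'
    (rhoP : mod_data sc rho) (rhoP' : mod_data sc' rho') (f : {linear M -> M'}) :
  (forall l m, f (rho l m) = rho' l (f m)) ->
  @comod_morphism R G (data_comod scP rhoP) (data_comod scP' rhoP') f.
Proof.
move=> fr m; rewrite !data_coactE.
rewrite (@tlift_data_coact M rho _ (fun u b => f u *t b)); last first.
  exact: balanced_tmapl.
by apply: eq_bigr => l _; rewrite fr.
Qed.

End DualAlgebra.

(** Conversely, over the base of the group, the coordinates of the coaction
    make every comodule a module over the dual algebra. *)

Section ComodToModule.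
Variables (S : comPzRingType) (G : affGroup S).
Local Notation A := (coord_ring G).
Local Notation eta := (str G).
Local Notation id_S := (idfun : {rmorphism S -> S}).
Variables (n : nat) (a : 'I_n.+1 -> A) (chi : 'I_n.+1 -> A -> S).
Hypothesis ba : basis_along id_S a chi.

Lemma act_scaler_id (V : lmodType S) : act_along id_S ( *:%R : S -> V -> V).
Proof.
split=> *; rewrite ?scalerDl ?scalerDr ?scalerA //.
Qed.

Variable W : comod G.

Definition comod_rho l (w : W) : W := tcoord chi *:%R l (coact W w).

Lemma comod_rhoE w :
  coact W w = \sum_l comod_rho l w *t (a l : alg eta).
Proof. exact: (tcoordE ba (act_scaler_id W)). Qed.

Lemma comod_mod_data : mod_data id_S a chi *:%R comod_rho.
Proof.
have scP := act_scaler_id W; have [chiD chiZ _ _] := ba.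
have tZ l s t : tcoord chi *:%R l (s *: t : tensor W (alg eta)) =
    s *: tcoord chi *:%R l t.
  rewrite /tcoord tlift_scale; last exact: (balanced_tcoord ba scP).
  rewrite (tlift_additive (h := *:%R s)); last exact: scalerDr.
  by apply: eq_tlift => m b; rewrite !scalerA mulrC.
split=> [l m m'|l s m|i j m|m].
- by rewrite /comod_rho linearD (tcoordD ba scP).
- by rewrite /comod_rho linearZ tZ.
- pose f (w : W) (b c : alg eta) := (chi i b * chi j c) *: w.
  have bf : balanced3 f.
    split=> [w|c]; split=> *; rewrite /f ?alg_scaleE ?chiD ?chiZ.
    + by rewrite mulrDl scalerDl.
    + by rewrite mulrDr scalerDl.
    + by congr (_ *: _); rewrite /=; ring.
    + by rewrite scalerDr.
    + by rewrite mulrDl scalerDl.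
    + by rewrite scalerA; congr (_ *: _); rewrite /=; ring.
  have H := coactA3 m bf.
  rewrite [X in comod_rho i X = _]/comod_rho [X in comod_rho i X = _]/tcoord.
  rewrite (tlift_additive (h := comod_rho i)); last first.
    by move=> w w'; rewrite /comod_rho linearD (tcoordD ba scP).
  transitivity (tlift (fun (w : W) (b : alg eta) =>
      tlift (fun u c => f u c b) (coact W w)) (coact W m)).
    apply: eq_tlift => w b; rewrite /comod_rho linearZ tZ /tcoord.
    rewrite (tlift_additive (h := *:%R (chi j b))); last exact: scalerDr.
    by apply: eq_tlift => u c; rewrite scalerA mulrC.
  rewrite -H /comod_rho /tcoord.
  under [RHS]eq_bigr => l _.
    rewrite (tlift_additive (h := *:%R (ba_cst a chi i j l))); last first.
      exact: scalerDr.
    over.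
  rewrite /tlift [RHS]exchange_big; apply: eq_bigr => p _ /=.
  rewrite -/(tlift (f p.1) (comul G p.2)) /f.
  have -> : tlift (fun b c : alg eta => (chi i b * chi j c) *: p.1)
      (comul G p.2) = tlift (fun b c : alg eta => chi i b * chi j c)
      (comul G p.2) *: p.1.
    rewrite (tlift_additive (h := fun s => s *: p.1)) // => s s'.
    exact: scalerDl.
  rewrite (ba_comul ba) scaler_suml; apply: eq_bigr => l _.
  by rewrite scalerA mulrC.
rewrite -[RHS](coact1 m) [in RHS]comod_rhoE tlift_sum; last first.
  split=> [w w' b|w b b'|r w b].
  - by rewrite scalerDr.
  - by rewrite rmorphD scalerDl.
  by rewrite scalerA; congr (_ *: _); rewrite alg_scaleE rmorphM counit_str mulrC.
apply: eq_bigr => l _; rewrite tlift_tens //.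
split=> [w w' b|w b b'|r w b].
- by rewrite scalerDr.
- by rewrite rmorphD scalerDl.
by rewrite scalerA; congr (_ *: _); rewrite alg_scaleE rmorphM counit_str mulrC.
Qed.

End ComodToModule.

(** ** Base change of the group in coordinates *)

Section BasisBaseChange.
Variables (R : comPzRingType) (G : affGroup R).
Local Notation A := (coord_ring G).
Local Notation eta := (str G).
Variables (S T : comPzRingType) (phi : {rmorphism R -> S}).
Variables (psi : {rmorphism S -> T}) (chi : {rmorphism R -> T}).
Hypothesis E : forall r, psi (phi r) = chi r.
Variables (n : nat) (a : 'I_n.+1 -> A) (co : 'I_n.+1 -> A -> S).
Hypothesis ba : basis_along phi a co.

Lemma basis_along_comp : basis_along chi a (fun l b => psi (co l b)).
Proof.
have [coD coZ cod cog] := ba; split.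
- by move=> l b c; rewrite coD rmorphD.
- by move=> l r b; rewrite coZ rmorphM E.
- by move=> l m; rewrite cod rmorph_nat.
move=> b; have bf : @balanced R (alg phi) (alg eta) _
    (fun s c => ptens chi eta (psi s) c).
  apply: balanced_ring => [s s' c|s c c'|r s c].
  - by rewrite rmorphD ptensDl.
  - exact: ptensDr.
  by rewrite rmorphM E ptensZ.
by rewrite -(rmorph1 psi) (ba_expand ba bf).
Qed.

Lemma ba_cst_comp i j l :
  ba_cst a (fun l b => psi (co l b)) i j l = psi (ba_cst a co i j l).
Proof.
rewrite /ba_cst [RHS](tlift_additive (h := psi)); last exact: rmorphD.
by apply: eq_tlift => b c; rewrite rmorphM.
Qed.

Definition bc_basis l : coord_ring (base_change chi G) := ptens chi eta 1 (a l).

Definition bc_coef l (t : coord_ring (base_change chi G)) : T :=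
  @tlift R (alg chi) (alg eta) T (fun s b => s * psi (co l b)) t.

Lemma balanced_bc_coef l :
  @balanced R (alg chi) (alg eta) T (fun s b => s * psi (co l b)).
Proof.
have [coD coZ _ _] := ba; apply: balanced_ring => [s s' b|s b b'|r s b].
- by rewrite mulrDl.
- by rewrite coD rmorphD mulrDr.
by rewrite coZ rmorphM E mulrCA mulrA.
Qed.

Lemma bc_coefE l s b : bc_coef l (ptens chi eta s b) = s * psi (co l b).
Proof. exact: tlift_tens (balanced_bc_coef l). Qed.

Lemma bc_coefD l : {morph bc_coef l : t u / t + u}.
Proof. by move=> t u; exact: tliftD (balanced_bc_coef l). Qed.

Lemma bc_gen t : t = \sum_l bc_str chi G (bc_coef l t) * bc_basis l.
Proof.
move: t; apply: tring_eq => [//|t u|s b].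
  rewrite -big_split; apply: eq_bigr => l _ /=.
  by rewrite bc_coefD rmorphD mulrDl.
have sbE : ptens chi eta s b = bc_str chi G s * ptens chi eta 1 b.
  by rewrite /= /tinl ptensM mulr1 mul1r.
rewrite {1}sbE (ba_gen basis_along_comp) mulr_sumr; apply: eq_bigr => l _.
by rewrite bc_coefE /bc_basis /= /tinl !ptensM !(mulr1, mul1r).
Qed.

Lemma basis_along_bc :
  @basis_along T (base_change chi G) T idfun n.+1 bc_basis bc_coef.
Proof.
have [coD coZ cod cog] := ba; split.
- exact: bc_coefD.
- move=> l s t; move: t; apply: tring_eq => [t u|t u|s' b].
  + by rewrite mulrDr bc_coefD.
  + by rewrite bc_coefD mulrDr.
  rewrite /= /tinl -[LHS]/(bc_coef l (ptens chi eta s 1 * ptens chi eta s' b)).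
  by rewrite ptensM mul1r !bc_coefE mulrA.
- by move=> l m; rewrite bc_coefE mul1r cod rmorph_nat.
move=> t; rewrite {1}(bc_gen t).
have D : {morph ptens (idfun : {rmorphism T -> T}) (bc_str chi G) 1 : u v / u + v}.
  by move=> u v; exact: ptensDr.
have D0 : ptens (idfun : {rmorphism T -> T}) (bc_str chi G) 1 0 = 0.
  by apply: (addrI (ptens idfun (bc_str chi G) 1 0)); rewrite -ptensDr !addr0.
rewrite (big_morph _ D D0); apply: eq_bigr => l _.
by rewrite -ptensZ /= mulr1.
Qed.

Lemma ba_cst_bc i j l :
  @ba_cst T (base_change chi G) T n.+1 bc_basis bc_coef i j l =
  psi (ba_cst a co i j l).
Proof.
rewrite /ba_cst [LHS]tlift_bc_comul; last exact: (ba_balanced basis_along_bc).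
rewrite [RHS](tlift_additive (h := psi)); last exact: rmorphD.
by apply: eq_tlift => b c; rewrite !bc_coefE !mul1r rmorphM.
Qed.

Lemma counit_bc_basis l :
  counit (base_change chi G) (bc_basis l) = chi (counit G (a l)).
Proof. by rewrite [LHS]bc_counitE mul1r. Qed.

Lemma bc_coef1 l : bc_coef l 1 = psi (co l 1).
Proof. by rewrite [LHS]bc_coefE mul1r. Qed.

End BasisBaseChange.

(** * Matrix comodules and comodules of homomorphisms *)

Section Comatrix.
Variables (K : comPzRingType) (G : affGroup K).
Local Notation A := (coord_ring G).
Local Notation eta := (str G).
Local Notation id_K := (idfun : {rmorphism K -> K}).
Variables (n : nat) (a : 'I_n.+1 -> A) (co : 'I_n.+1 -> A -> K).
Hypothesis ba : basis_along id_K a co.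
Local Notation cst := (ba_cst a co).

Let coD := ba_add ba.
Let coZ : forall l r b, co l (eta r * b) = r * co l b := ba_scale ba.

Lemma co_sum l I r (P : pred I) (F : I -> A) :
  co l (\sum_(i <- r | P i) F i) = \sum_(i <- r | P i) co l (F i).
Proof.
apply: (big_morph (co l)) => [b c|]; first exact: coD.
by apply: (addrI (co l 0)); rewrite -coD !addr0.
Qed.

Lemma co_gen b : b = \sum_l eta (co l b) * a l.
Proof.
have bf : @balanced K (alg id_K) (alg eta) A (fun s c => eta s * c).
  apply: balanced_ring => [s s' c|s c c'|r s c].
  - by rewrite rmorphD mulrDl.
  - by rewrite mulrDr.
  by rewrite rmorphM mulrCA mulrA.
by have := ba_expand ba bf b; rewrite rmorph1 mul1r.
Qed.

Lemma co_inj b c : (forall l, co l b = co l c) -> b = c.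
Proof.
by move=> bc; rewrite (co_gen b) (co_gen c); apply: eq_bigr => l _; rewrite bc.
Qed.

(** The matrix form of a module with action v |-> v r_l of the dual basis. *)
Record mx_data m (r : 'I_n.+1 -> 'M[K]_m) : Prop := {
  mxd_mul : forall i j, r j *m r i = \sum_l cst i j l *: r l;
  mxd_one : \sum_l counit G (a l) *: r l = 1%:M
}.

(** The matrix over the coordinate ring that describes the coaction. *)
Definition comx m (r : 'I_n.+1 -> 'M[K]_m) : 'M[A]_m :=
  \sum_l map_mx (fun s => eta s * a l) (r l).

Lemma comxE m (r : 'I_n.+1 -> 'M[K]_m) p q :
  comx r p q = \sum_l eta (r l p q) * a l.
Proof. by rewrite summxE; apply: eq_bigr => l _; rewrite mxE. Qed.

Lemma co_comx m (r : 'I_n.+1 -> 'M[K]_m) l p q : co l (comx r p q) = r l p q.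
Proof.
rewrite comxE co_sum (bigD1 l) //= big1 ?addr0 => [|k kl].
  by rewrite coZ (ba_dual ba) eqxx mulr1.
by rewrite coZ (ba_dual ba) eq_sym (negPf kl) mulr0.
Qed.

Let AA : comPzRingType := tring eta eta.
Let il : {rmorphism A -> AA} := tinl eta eta.
Let ir : {rmorphism A -> AA} := tinr eta eta.

Definition co2 i j (t : AA) : K :=
  @tlift K (alg eta) (alg eta) K (fun b c => co i b * co j c) t.

Lemma co2D i j : {morph co2 i j : t u / t + u}.
Proof. by move=> t u; exact: tliftD (ba_balanced ba i j). Qed.

Lemma co2_sum i j I r (P : pred I) (F : I -> AA) :
  co2 i j (\sum_(k <- r | P k) F k) = \sum_(k <- r | P k) co2 i j (F k).
Proof.
apply: (big_morph (co2 i j)) => [b c|]; first exact: co2D.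
by apply: (addrI (co2 i j 0)); rewrite -co2D !addr0.
Qed.

Lemma co2E i j b c : co2 i j (il b * ir c) = co i b * co j c.
Proof.
rewrite /il /ir /= /tinl /tinr ptensM mulr1 mul1r.
exact: tlift_tens (ba_balanced ba i j).
Qed.

Lemma co2E3 i j b c d : co2 i j (il b * ir c * il d) = co i (b * d) * co j c.
Proof. by rewrite mulrAC -rmorphM co2E. Qed.

Lemma co2_comul i j b : co2 i j (comul G b) = \sum_l co l b * cst i j l.
Proof. exact: (ba_comul ba). Qed.

Lemma co2_gen (t : AA) :
  t = \sum_i \sum_j il (eta (co2 i j t)) * (il (a i) * ir (a j)).
Proof.
move: t; apply: tring_eq => [//|t u|b c].
  rewrite -big_split; apply: eq_bigr => i _; rewrite -big_split.
  by apply: eq_bigr => j _ /=; rewrite co2D !rmorphD mulrDl.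
have -> : ptens eta eta b c = il b * ir c by rewrite ptensM mulr1 mul1r.
rewrite {1}(co_gen b) {1}(co_gen c) !rmorph_sum mulr_suml.
apply: eq_bigr => i _; rewrite mulr_sumr; apply: eq_bigr => j _.
rewrite co2E !rmorphM -[ir (eta _)]/(tinr eta eta _) -tinlr.
by rewrite -[tinl _ _ _]/(il _); ring.
Qed.

(** The comatrix is group-like, with the factors in the order in which matrices
    act on row vectors. *)
Lemma comul_comx m (r : 'I_n.+1 -> 'M[K]_m) : mx_data r ->
  map_mx (comul G) (comx r) = map_mx ir (comx r) *m map_mx il (comx r).
Proof.
move=> rP; apply/matrixP => p q; rewrite !mxE.
rewrite [LHS]co2_gen [RHS]co2_gen; apply: eq_bigr => i _; apply: eq_bigr => j _.
congr (il (eta _) * _); rewrite co2_comul co2_sum.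
under eq_bigr do rewrite co_comx.
under [RHS]eq_bigr do rewrite !mxE mulrC co2E !co_comx mulrC.
have := mxd_mul rP i j => /matrixP /(_ p q); rewrite mxE => ->.
by rewrite summxE; apply: eq_bigr => l _; rewrite mxE mulrC.
Qed.

Lemma counit_comx m (r : 'I_n.+1 -> 'M[K]_m) : mx_data r ->
  map_mx (counit G) (comx r) = 1%:M.
Proof.
move=> rP; rewrite -(mxd_one rP); apply/matrixP => p q.
rewrite mxE comxE summxE rmorph_sum; apply: eq_bigr => l _.
by rewrite rmorphM counit_str mxE mulrC.
Qed.

(** Hence the antipode inverts it. *)
Lemma antipode_comx m (r : 'I_n.+1 -> 'M[K]_m) : mx_data r ->
  comx r *m map_mx (antipode G) (comx r) = 1%:M.
Proof.
move=> rP; apply/matrixP => p q; rewrite mxE.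
have := antipodel (comx r p q).
have -> : counit G (comx r p q) = (p == q)%:R.
  by have /matrixP /(_ p q) := counit_comx rP; rewrite !mxE.
rewrite rmorph_nat !mxE => <-.
have bf : @balanced K (alg eta) (alg eta) A (fun b c => antipode G b * c).
  apply: balanced_ring => [b b' c|b c c'|s b c].
  - by rewrite rmorphD mulrDl.
  - by rewrite mulrDr.
  by rewrite rmorphM antipode_str mulrCA mulrA.
have /matrixP /(_ p q) := comul_comx rP; rewrite !mxE => ->.
rewrite (tlift_sum _ _ bf); apply: eq_bigr => c _; rewrite !mxE.
have -> : ir (comx r p c) * il (comx r c q) =
    ptens eta eta (comx r c q) (comx r p c).
  by rewrite mulrC /il /ir /= /tinl /tinr ptensM mulr1 mul1r.
by rewrite /ptens tlift_tens // mulrC.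
Qed.

Section HomData.
Variables (p q : nat) (r : 'I_n.+1 -> 'M[K]_p) (t : 'I_n.+1 -> 'M[K]_q).
Hypotheses (rP : mx_data r) (tP : mx_data t).
Let u := comx r.
Let v := map_mx (antipode G) u.
Let w := comx t.

(** The group acts on homomorphisms by conjugation; the comatrix of the source is
    inverted by the antipode. *)
Definition hom_comx (X : 'M[K]_(p, q)) : 'M[A]_(p, q) :=
  v *m map_mx eta X *m w.

Definition hom_rho l (X : 'M[K]_(p, q)) : 'M[K]_(p, q) :=
  map_mx (co l) (hom_comx X).

Let uv : u *m v = 1%:M. Proof. exact: antipode_comx. Qed.
Let vu : v *m u = 1%:M. Proof. exact: mulmx1C. Qed.

Lemma comul_antipode_comx :
  map_mx (comul G) v = map_mx il v *m map_mx ir v.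
Proof.
have H : map_mx il v *m map_mx ir v *m map_mx (comul G) u = 1%:M.
  rewrite comul_comx // mulmxA -[_ *m map_mx ir v *m _]mulmxA -map_mxM vu.
  by rewrite map_mx1 mulmx1 -map_mxM vu map_mx1.
transitivity (map_mx il v *m map_mx ir v *m
  (map_mx (comul G) u *m map_mx (comul G) v)); first by rewrite mulmxA H mul1mx.
by rewrite -map_mxM uv map_mx1 mulmx1.
Qed.

Lemma hom_comxD X Y : hom_comx (X + Y) = hom_comx X + hom_comx Y.
Proof. by rewrite /hom_comx map_mxD mulmxDr mulmxDl. Qed.

Lemma hom_comxZ s X : hom_comx (s *: X) = eta s *: hom_comx X.
Proof. by rewrite /hom_comx map_mxZ -scalemxAr -scalemxAl. Qed.

Lemma hom_rhoE l X b c : hom_rho l X b c = co l (hom_comx X b c).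
Proof. by rewrite /hom_rho mxE. Qed.

Lemma hom_rhoD l : {morph hom_rho l : X Y / X + Y}.
Proof.
move=> X Y; apply/matrixP => i j; rewrite hom_rhoE hom_comxD.
by rewrite [X in co l X]mxE coD [RHS]mxE !hom_rhoE.
Qed.

Lemma hom_rhoZ l s X : hom_rho l (s *: X) = s *: hom_rho l X.
Proof.
apply/matrixP => i j; rewrite hom_rhoE hom_comxZ [X in co l X]mxE coZ.
by rewrite [RHS]mxE hom_rhoE.
Qed.

Lemma hom_rho_mul i j X :
  hom_rho i (hom_rho j X) = \sum_l cst i j l *: hom_rho l X.
Proof.
apply/matrixP => b c; rewrite summxE.
transitivity (co2 i j (comul G (hom_comx X b c))); last first.
  by rewrite co2_comul; apply: eq_bigr => l _; rewrite [RHS]mxE hom_rhoE mulrC.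
have -> : comul G (hom_comx X b c) =
    (map_mx il v *m map_mx ir (hom_comx X) *m map_mx il w) b c.
  transitivity (map_mx (comul G) (hom_comx X) b c); first by rewrite [RHS]mxE.
  congr (fun_of_matrix _ b c).
  rewrite /hom_comx !map_mxM comul_antipode_comx comul_comx // !mulmxA.
  congr (_ *m _ *m _); rewrite -!mulmxA; congr (_ *m (_ *m _)).
  rewrite -!map_mx_comp; apply: eq_map_mx => s /=.
  by rewrite comul_str -[il _]/(tinl eta eta _) tinlr.
rewrite hom_rhoE.
have -> : hom_comx (hom_rho j X) b c = \sum_d \sum_e
    v b e * eta (co j (hom_comx X e d)) * w d c.
  rewrite {1}/hom_comx [LHS]mxE; apply: eq_bigr => d _.
  rewrite [X in X * _]mxE mulr_suml; apply: eq_bigr => e _.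
  by rewrite [X in _ * X * _]mxE hom_rhoE.
move: (hom_comx X) v w => Y v' w'.
rewrite [in RHS]mxE co2_sum co_sum.
apply: eq_bigr => d _; rewrite [X in co2 _ _ (X * _)]mxE !mulr_suml co2_sum co_sum.
apply: eq_bigr => e _.
rewrite [map_mx il v' b e]mxE [map_mx ir Y e d]mxE [map_mx il w' d c]mxE.
rewrite co2E3 [v' b e * _]mulrC -mulrA coZ mulrC //.
Qed.

Lemma hom_rho_one X : \sum_l counit G (a l) *: hom_rho l X = X.
Proof.
apply/matrixP => b c; rewrite summxE.
transitivity (counit G (hom_comx X b c)).
  have := ba_counit ba (hom_comx X b c); rewrite /= => ->.
  by apply: eq_bigr => l _; rewrite [LHS]mxE hom_rhoE mulrC.
transitivity (map_mx (counit G) (hom_comx X) b c); first by rewrite [RHS]mxE.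
congr (fun_of_matrix _ b c); rewrite /hom_comx !map_mxM [map_mx _ w]counit_comx //.
have -> : map_mx (counit G) v = 1%:M.
  have := congr1 (map_mx (counit G)) vu.
  by rewrite map_mxM [map_mx _ u]counit_comx // mulmx1 map_mx1.
rewrite mul1mx mulmx1 -map_mx_comp map_mx_id // => s.
exact: counit_str.
Qed.

(** The invariants of Hom(V, W) are the equivariant maps. *)
Lemma hom_rho_fixed X : (forall l, hom_rho l X = co l 1 *: X) <->
  forall l, r l *m X = X *m t l.
Proof.
have E1 : (forall l, hom_rho l X = co l 1 *: X) <-> hom_comx X = map_mx eta X.
  split=> [H|H l].
    apply/matrixP => b c; apply: co_inj => l.
    have /matrixP /(_ b c) := H l; rewrite hom_rhoE => ->.
    by rewrite [LHS]mxE; rewrite [map_mx eta X b c]mxE -[eta _]mulr1 coZ mulrC.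
  apply/matrixP => b c; rewrite hom_rhoE H [map_mx eta X b c]mxE [RHS]mxE.
  by rewrite -[eta _]mulr1 coZ mulrC.
have E2 : hom_comx X = map_mx eta X <-> map_mx eta X *m w = u *m map_mx eta X.
  split=> H; last by rewrite /hom_comx -mulmxA H mulmxA vu mul1mx.
  by rewrite -[in RHS]H /hom_comx !mulmxA uv mul1mx.
have E3 : map_mx eta X *m w = u *m map_mx eta X <->
    forall l, r l *m X = X *m t l.
  have L l b c : co l ((map_mx eta X *m w) b c) = (X *m t l) b c.
    rewrite !mxE co_sum; apply: eq_bigr => d _.
    by rewrite mxE coZ co_comx.
  have L' l b c : co l ((u *m map_mx eta X) b c) = (r l *m X) b c.
    rewrite !mxE co_sum; apply: eq_bigr => d _.
    by rewrite mxE mulrC coZ co_comx mulrC.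
  split=> [H l|H]; apply/matrixP => b c; first by rewrite -L -L' H.
  by apply: co_inj => l; rewrite L L' H.
by rewrite E1 E2 E3.
Qed.

End HomData.

End Comatrix.

(** * Linear reductivity and semisimplicity over fields *)

(** Linear reductivity over R bears on modules over a field K through K as an
    algebra over R: the comodules below are K-vector spaces regarded as
    R-modules. *)

Section ReductiveLift.
Variables (R : comPzRingType) (G : affGroup R).
Variables (S : comPzRingType) (phi : {rmorphism R -> S}).
Variables (n : nat) (a : 'I_n.+1 -> coord_ring G).
Variable chi : 'I_n.+1 -> coord_ring G -> S.
Hypothesis ba : basis_along phi a chi.
Variables (M M' : lmodType R) (sc : S -> M -> M) (sc' : S -> M' -> M').
Variables (rho : 'I_n.+1 -> M -> M) (rho' : 'I_n.+1 -> M' -> M').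
Hypotheses (scP : act_along phi sc) (scP' : act_along phi sc').
Hypotheses (rhoP : mod_data phi a chi sc rho).
Hypothesis rhoP' : mod_data phi a chi sc' rho'.
Variable f : {linear M -> M'}.
Hypothesis f_sc : forall s m, f (sc s m) = sc' s (f m).
Hypothesis f_rho : forall l m, f (rho l m) = rho' l (f m).

Definition ker_pred : {pred M} := fun m => f m == 0.

Lemma ker_submod : submod_closed ker_pred.
Proof.
split=> [|r m m']; rewrite !unfold_in ?linear0 //.
by move=> /eqP fm /eqP fm'; rewrite linearP fm fm' scaler0 addr0.
Qed.

HB.instance Definition _ := GRing.isSubmodClosed.Build R M ker_pred ker_submod.

Record kernel := Kernel { kval : M; _ : kval \in ker_pred }.
HB.instance Definition _ := [isSub for kval].
HB.instance Definition _ := [Choice of kernel by <:].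
HB.instance Definition _ := [SubChoice_isSubLmodule of kernel by <:].

Lemma kvalP (k : kernel) : f (kval k) = 0.
Proof. by apply/eqP; exact: (valP k). Qed.

Lemma sc_ker s (k : kernel) : sc s (kval k) \in ker_pred.
Proof. by rewrite unfold_in f_sc kvalP (act_0 scP'). Qed.

Lemma rho_ker l (k : kernel) : rho l (kval k) \in ker_pred.
Proof.
rewrite unfold_in f_rho kvalP; apply/eqP; apply: (addrI (rho' l 0)).
by rewrite -(md_add rhoP') !addr0.
Qed.

Definition ker_sc s k : kernel := Kernel (sc_ker s k).
Definition ker_rho l k : kernel := Kernel (rho_ker l k).

Lemma ker_act : act_along phi ker_sc.
Proof.
split=> *; apply: val_inj.
- exact: (act_addl scP).
- exact: (act_addr scP).
- exact: (act_scale scP).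
exact: (act_mul scP).
Qed.

Lemma ker_sum I r (F : I -> kernel) :
  kval (\sum_(i <- r) F i) = \sum_(i <- r) kval (F i).
Proof. exact: (raddf_sum (val : kernel -> M)). Qed.

Lemma ker_mod_data : mod_data phi a chi ker_sc ker_rho.
Proof.
split=> [l k k'|l s k|i j k|k]; apply: val_inj => /=.
- exact: (md_add rhoP).
- exact: (md_sc rhoP).
- by rewrite ker_sum; exact: (md_mul rhoP).
by rewrite ker_sum; exact: (md_one rhoP).
Qed.

(** Exactness of the functor of invariants on 0 -> ker f -> M -> M' -> 0. *)
Lemma reductive_lift : linearly_reductive G ->
  (forall m', exists m, f m = m') ->
  forall m', (forall l, rho' l m' = sc' (chi l 1) m') ->
  exists2 m, (forall l, rho l m = sc (chi l 1) m) & f m = m'.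
Proof.
move=> Gred fsurj m' m'P.
have kmor := @data_morphism _ _ _ _ _ _ _ ba _ _ _ _ ker_act scP _ _ ker_mod_data
  rhoP (val : {linear kernel -> M}) (fun l m => erefl).
have fmor := @data_morphism _ _ _ _ _ _ _ ba _ _ _ _ scP scP' _ _ rhoP rhoP' f f_rho.
have [|_ _ H] := Gred _ _ _ _ _ kmor fmor.
  split=> [v _ v0|v _|w _]; first exact: val_inj.
    split=> [/eqP fv|[k _ <-]]; last exact: kvalP.
    by exists (Kernel fv).
  by have [m <-] := fsurj w; exists m.
have [|m mP fm] := H m'; first exact/(data_invariant ba scP' rhoP').
by exists m => //; apply/(data_invariant ba scP rhoP).
Qed.

End ReductiveLift.

Section Maschke.
Variables (R : comPzRingType) (G : affGroup R).
Variables (S : comPzRingType) (phi : {rmorphism R -> S}).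
Variables (n : nat) (a : 'I_n.+1 -> coord_ring G).
Variable co : 'I_n.+1 -> coord_ring G -> S.
Hypothesis ba : basis_along phi a co.
Hypothesis Gred : linearly_reductive G.
Variables (K : fieldType) (y : {rmorphism S -> K}) (psi : {rmorphism R -> K}).
Hypothesis E : forall r, y (phi r) = psi r.

Local Notation GK := (base_change psi G).
Local Notation aK := (bc_basis psi a).
Local Notation coK := (bc_coef (chi := psi) y co).
Let baK : basis_along idfun aK coK := basis_along_bc E ba.
Let baR : basis_along psi a (fun l b => y (co l b)) := basis_along_comp E ba.

Lemma restr_act (V : lmodType K) :
  act_along psi (fun s (v : restr psi V) => s *: (v : V) : restr psi V).
Proof.
by split=> *; rewrite ?scalerDl ?scalerDr ?scalerA.
Qed.

Section HomComod.
Variables (p q : nat) (r : 'I_n.+1 -> 'M[K]_p) (t : 'I_n.+1 -> 'M[K]_q).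
Hypotheses (rP : mx_data aK coK r) (tP : mx_data aK coK t).

Lemma hom_mod_data : mod_data psi a (fun l b => y (co l b))
  (fun s (X : restr psi 'M[K]_(p, q)) => s *: (X : 'M_(p, q)) : restr psi 'M_(p, q))
  (fun l X => hom_rho aK coK r t l X).
Proof.
split=> [l X Y|l s X|i j X|X].
- exact: (hom_rhoD baK).
- exact: (hom_rhoZ baK).
- rewrite (hom_rho_mul baK rP tP); apply: eq_bigr => l _.
  by rewrite (ba_cst_bc E ba) ba_cst_comp.
rewrite -[RHS](hom_rho_one baK rP tP X); apply: eq_bigr => l _.
by rewrite counit_bc_basis.
Qed.

End HomComod.

(** A lift of the identity of W to an invariant of Hom(V, W), under the
    surjection Hom(V, W) -> Hom(W, W) of restriction to W in V. *)
Lemma maschke p q (r : 'I_n.+1 -> 'M[K]_p) (t : 'I_n.+1 -> 'M[K]_q)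
    (J : 'M_(q, p)) (J' : 'M_(p, q)) :
  mx_data aK coK r -> mx_data aK coK t -> J *m J' = 1%:M ->
  (forall l, t l *m J = J *m r l) ->
  exists2 X : 'M_(p, q), J *m X = 1%:M & forall l, r l *m X = X *m t l.
Proof.
move=> rP tP JJ' tJ.
have glin : linear (mulmx J : restr psi 'M[K]_(p, q) -> restr psi 'M[K]_q).
  by move=> s X Y; rewrite mulmxDr -scalemxAr.
pose gL := GRing.isLinear.Build R (restr psi 'M[K]_(p, q)) (restr psi 'M[K]_q)
  *:%R (mulmx J) glin.
pose g : {linear restr psi 'M[K]_(p, q) -> restr psi 'M[K]_q} :=
  HB.pack (mulmx J : restr psi 'M[K]_(p, q) -> restr psi 'M[K]_q) gL.
(* Restriction to the submodule is equivariant for the actions by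
   conjugation. *)
have JE : map_mx (antipode GK) (comx aK t) *m map_mx (str GK) J =
          map_mx (str GK) J *m map_mx (antipode GK) (comx aK r).
  have uJ : comx aK t *m map_mx (str GK) J = map_mx (str GK) J *m comx aK r.
    apply/matrixP => i j; rewrite !mxE.
    under eq_bigr do rewrite mxE comxE mulr_suml.
    under [RHS]eq_bigr do rewrite mxE comxE mulr_sumr.
    rewrite exchange_big [RHS]exchange_big; apply: eq_bigr => l _ /=.
    have /matrixP /(_ i j) := tJ l; rewrite !mxE => tJl.
    transitivity (str GK (\sum_j0 t l i j0 * J j0 j) * aK l).
      by rewrite rmorph_sum mulr_suml; apply: eq_bigr => d _; rewrite rmorphM; ring.
    rewrite tJl rmorph_sum mulr_suml; apply: eq_bigr => d _.
    by rewrite rmorphM; ring.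
  have := antipode_comx baK rP; set v := map_mx _ _ => uv.
  have := antipode_comx baK tP; set v' := map_mx _ _ => uv'.
  rewrite -[map_mx _ J in LHS]mulmx1 -uv !mulmxA -[v' *m _ *m _]mulmxA -uJ.
  by rewrite !mulmxA (mulmx1C uv') mul1mx.
have g_rho l X : g (hom_rho aK coK r t l X) = hom_rho aK coK t t l (g X).
  apply/matrixP => i j; rewrite [RHS]hom_rhoE /= /hom_comx map_mxM !mulmxA JE.
  rewrite -!mulmxA [X in coK l X]mxE (co_sum baK) [LHS]mxE; apply: eq_bigr => d _.
  by rewrite hom_rhoE /hom_comx !mulmxA [map_mx _ J i d]mxE (ba_scale baK).
have [||X Xinv gX] := @reductive_lift _ _ _ _ _ _ _ baR _ _ _ _ _ _
    (restr_act _) (restr_act _) (hom_mod_data rP tP) (hom_mod_data tP tP) g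
    (fun s m => esym (scalemxAr _ _ _)) g_rho Gred _ 1%:M.
- by move=> Y; exists (J' *m Y); rewrite /= mulmxA JJ' mul1mx.
- have H : forall l, hom_rho aK coK t t l 1%:M = coK l 1 *: 1%:M.
    by apply/(hom_rho_fixed baK t tP) => l; rewrite mulmx1 mul1mx.
  by move=> l; rewrite [LHS]H (bc_coef1 E ba).
exists X => //; apply/(hom_rho_fixed baK t rP) => l.
by rewrite [LHS]Xinv (bc_coef1 E ba).
Qed.

Local Notation D := (fdext (dual_alg ba) y).
Local Notation bK l := (@fdb S (dual_alg ba) K y l).

Lemma fdL_mx_data : mx_data aK coK (fun l => fdL (bK l)).
Proof.
split=> [i j|].
  rewrite -fdLM fdbM fdL_sum; apply: eq_bigr => l _.
  by rewrite !mxE (ba_cst_bc E ba).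
have -> : 1%:M = fdL (1 : fdext (dual_alg ba) y).
  by apply: (@fd_mx_eq _ (dual_alg ba) _ y) => z; rewrite mul_fdL mulmx1 mul1r.
rewrite fdL_sum; apply: eq_bigr => l _.
by rewrite counit_bc_basis !mxE E.
Qed.

(** The left ideal D x has an equivariant retraction by Maschke, and an
    equivariant endomorphism of D is the multiplication on the right by some
    w'. Since w' is in D x, it is w x, and x w x = x. *)
Theorem reductive_vnr : vnr (dual_alg ba) y.
Proof.
move=> x.
set J := row_base (fdR x); have Jfree : row_free J := row_base_free _.
pose J' := pinvmx J.
have JJ' : J *m J' = 1%:M by exact: mulmxVp.
have sJ l : (J *m fdL (bK l) <= J)%MS.
  rewrite eq_row_base (eqmxMr _ (eq_row_base _)) -fdLR.
  exact: submxMl.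
pose t l := J *m fdL (bK l) *m J'.
have tJ l : t l *m J = J *m fdL (bK l) by exact: mulmxKpV.
have rP := fdL_mx_data; have tP : mx_data aK coK t.
  split=> [i j|].
    transitivity (t j *m J *m fdL (bK i) *m J'); first by rewrite !mulmxA.
    rewrite tJ -[J *m _ *m _]mulmxA (mxd_mul rP) mulmx_sumr mulmx_suml.
    by apply: eq_bigr => l _; rewrite -scalemxAr -scalemxAl.
  transitivity (J *m (\sum_l counit GK (aK l) *: fdL (bK l)) *m J').
    rewrite mulmx_sumr mulmx_suml; apply: eq_bigr => l _.
    by rewrite -scalemxAr -scalemxAl.
  by rewrite (mxd_one rP) mulmx1.
have [X JX rX] := maschke rP tP JJ' tJ.
have XJ l : fdL (bK l) *m (X *m J) = X *m J *m fdL (bK l).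
  by rewrite mulmxA [fdL _ *m X]rX -[X *m t l *m J]mulmxA tJ mulmxA.
pose w' : D := (1 : D) *m (X *m J).
have XJw (z : D) : z *m (X *m J) = z * w'.
  have zE := mul_fdL z (1 : D); rewrite mulr1 in zE.
  rewrite -[in LHS]zE -[RHS](mul_fdL z w') /w' -[LHS]mulmxA -[RHS]mulmxA.
  congr (_ *m _); rewrite fdL_sum mulmx_suml mulmx_sumr; apply: eq_bigr => l _.
  by rewrite -scalemxAl -scalemxAr XJ.
have /submxP [w wE] : ((w' : 'rV_n.+1) <= fdR x)%MS.
  by rewrite /w' mulmxA (submx_trans (submxMl _ _)) // eq_row_base.
have /submxP [z zE] : ((x : 'rV_n.+1) <= J)%MS.
  have xE := mul_fdR x (1 : D); rewrite mul1r in xE.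
  by rewrite eq_row_base -{1}xE submxMl.
exists w; rewrite -mulrA -(mul_fdR x (w : D)) -wE -XJw.
by rewrite [x in x *m _]zE -[z *m J *m _]mulmxA [J *m _]mulmxA JX mul1mx -zE.
Qed.

End Maschke.

(** * Finite flat algebras of finite presentation are locally free *)

Section Generates.
Variables (R A : comPzRingType) (eta : {rmorphism R -> A}).

Definition generates (S : comPzRingType) (phi : {rmorphism R -> S}) N
    (a : 'I_N -> A) :=
  forall b, exists c : 'I_N -> S,
    ptens phi eta 1 b = \sum_l ptens phi eta (c l) (a l).

Section Comp.
Variables (S T : comPzRingType) (phi : {rmorphism R -> S}).
Variables (psi : {rmorphism S -> T}) (chi : {rmorphism R -> T}).
Hypothesis E : forall r, psi (phi r) = chi r.

Lemma ptens_comp I r (c : I -> S) (a : I -> A) s b :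
  ptens phi eta s b = \sum_(l <- r) ptens phi eta (c l) (a l) ->
  ptens chi eta (psi s) b = \sum_(l <- r) ptens chi eta (psi (c l)) (a l).
Proof.
have fg q : (tinl chi eta \o psi) (phi q) = tinr chi eta (eta q).
  by rewrite /= E tinlr.
have fE s' b' : tring_lift fg (ptens phi eta s' b') = ptens chi eta (psi s') b'.
  by rewrite [LHS]tring_liftE /= /tinl /tinr ptensM mulr1 mul1r.
move=> H; rewrite -fE H rmorph_sum.
by apply: eq_bigr => l _; exact: fE.
Qed.

Lemma generates_comp N (a : 'I_N -> A) : generates phi a -> generates chi a.
Proof.
move=> ga b; have [c cE] := ga b; exists (fun l => psi (c l)).
by rewrite -(ptens_comp cE) rmorph1.
Qed.

End Comp.

(** A relation with an invertible coefficient eliminates a generator. *)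
Lemma generates_drop (S : comPzRingType) (phi : {rmorphism R -> S}) n
    (a : 'I_n.+1 -> A) (r : 'I_n.+1 -> S) j u :
  generates phi a -> \sum_l ptens phi eta (r l) (a l) = 0 -> r j * u = 1 ->
  generates phi (fun l => a (lift j l)).
Proof.
move=> ga r0 ru b; have [c cE] := ga b.
exists (fun l => c (lift j l) - c j * u * r (lift j l)).
have sE s t d : ptens phi eta (s * t) d = tinl phi eta s * ptens phi eta t d.
  by rewrite /tinl ptensM mul1r.
have /eqP := congr1 (fun t => tinl phi eta (c j * u) * t) r0.
rewrite mulr0 mulr_sumr (bigD1_ord j) //= -sE mulrAC -mulrA ru mulr1.
rewrite addr_eq0 => /eqP jE.
rewrite cE (bigD1_ord j) //= jE -sumrN -big_split; apply: eq_bigr => l _ /=.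
rewrite ptensDl addrC; congr (_ + _); rewrite -sE; apply: (addrI (ptens phi eta
  (c j * u * r (lift j l)) (a (lift j l)))); rewrite subrr -ptensDl subrr.
by apply: (addrI (ptens phi eta 0 (a (lift j l)))); rewrite -ptensDl !addr0.
Qed.

End Generates.

(** The minimal number of generators of A over neighbourhoods of x is n.+1. It
    is positive, the counit being a point of every fibre. *)
Definition min_generated (R A : comPzRingType) (eta : {rmorphism R -> A})
    (K : fieldType) (x : {rmorphism R -> K}) n :=
  near x (fun S phi y => exists a : 'I_n.+1 -> A, generates eta phi a) /\
  ~ near x (fun S phi y => exists a : 'I_n -> A, generates eta phi a).

Lemma exists_min_generated (R : comNzRingType) (A : comPzRingType)
    (eta : {rmorphism R -> A}) (K : fieldType) (x : {rmorphism R -> K})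
    (y : {rmorphism A -> K}) :
  (forall r, y (eta r) = x r) -> finite_hom eta ->
  exists n, min_generated eta x n.
Proof.
move=> yx [N [e eP]].
pose Q n := near x (fun S phi y => exists a : 'I_n -> A, generates eta phi a).
have QN : Q N.
  apply: near_id; exists e => b; have [c ->] := eP b; exists c.
  have D : {morph ptens (idfun : {rmorphism R -> R}) eta 1 : u v / u + v}.
    by move=> u v; exact: ptensDr.
  have D0 : ptens (idfun : {rmorphism R -> R}) eta 1 0 = 0.
    by apply: (addrI (ptens idfun eta 1 0)); rewrite -ptensDr !addr0.
  by rewrite (big_morph _ D D0); apply: eq_bigr => l _; rewrite -ptensZ mulr1.
have ex : exists n, `[< Q n >] by exists N; apply/asboolP.
case: (ex_minnP ex) => -[|n] /asboolP Qn nmin; last first.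
  by exists n; split=> // /asboolP /nmin; rewrite ltnn.
have [S [phi [z [_ zx [a ga]]]]] := Qn; have [c] := ga 1.
rewrite big_ord0 => t0; have fg r : z (phi r) = y (eta r) by rewrite zx yx.
have := congr1 (tring_lift fg) t0; rewrite tring_liftE !rmorph1 mulr1 rmorph0.
by move/eqP; rewrite oner_eq0.
Qed.

Section Relations.
Variables (R A : comPzRingType) (eta : {rmorphism R -> A}).
Hypothesis eta_flat : flat_hom eta.
Variables (K : fieldType) (x : {rmorphism R -> K}) (n : nat).
Hypothesis minn : ~ near x (fun S phi y => exists a : 'I_n -> A, generates eta phi a).
Variables (S : comNzRingType) (phi : {rmorphism R -> S}) (y : {rmorphism S -> K}).
Hypothesis fe : flat_etale phi.
Hypothesis yx : forall r, y (phi r) = x r.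
Variable a : 'I_n.+1 -> A.
Hypothesis ga : generates eta phi a.

(** Otherwise a generator could be eliminated over a smaller neighbourhood. *)
Lemma relation_in_ker (r : 'I_n.+1 -> S) :
  \sum_l ptens phi eta (r l) (a l) = 0 -> forall j, y (r j) = 0.
Proof.
move=> r0 j; apply: contrapT => /eqP yr; apply: minn.
have [T [psi [z [fe' zy [u ru]]]]] := near_inv yr.
exists T, (psi \o phi), z; split; first exact: flat_etale_comp.
  by move=> q; rewrite /= zy yx.
exists (fun l => a (lift j l)).
have E q : psi (phi q) = (psi \o phi) q by [].
apply: (generates_drop (r := fun l => psi (r l)) (u := u)) => //.
  exact: generates_comp ga.
have := @ptens_comp _ _ eta _ _ _ psi _ E _ (index_enum 'I_n.+1) r a 0 0.
rewrite r0 rmorph0 => <- //.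
  by apply: (addrI (ptens (psi \o phi) eta 0 0)); rewrite -ptensDr !addr0.
by apply: (addrI (ptens phi eta 0 0)); rewrite -ptensDr !addr0.
Qed.

Section OneRelation.
Variable r : 'I_n.+1 -> S.
Hypothesis r0 : \sum_l ptens phi eta (r l) (a l) = 0.

Definition rel_ideal : pred (alg phi) :=
  fun s => `[< exists c : 'I_n.+1 -> S, s = \sum_l c l * r l >].

Lemma rel_ideal_submod : submod_closed rel_ideal.
Proof.
split=> [|p s t /asboolP [c ->] /asboolP [d ->]]; apply/asboolP.
  by exists (fun=> 0); rewrite big1 // => l _; rewrite mul0r.
exists (fun l => phi p * c l + d l); rewrite alg_scaleE mulr_sumr -big_split.
by apply: eq_bigr => l _ /=; rewrite mulrDl mulrA.
Qed.

HB.instance Definition _ :=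
  GRing.isSubmodClosed.Build R (alg phi) rel_ideal rel_ideal_submod.

Record relI := RelI { relI_val : alg phi; _ : relI_val \in rel_ideal }.
HB.instance Definition _ := [isSub for relI_val].
HB.instance Definition _ := [Choice of relI by <:].
HB.instance Definition _ := [SubChoice_isSubLmodule of relI by <:].

(** The subgroup q I, with q the kernel of y and I the ideal of the r l. *)
Definition qI : pred S :=
  fun s => `[< exists2 c : 'I_n.+1 -> S, s = \sum_l c l * r l &
    forall l, y (c l) = 0 >].

Lemma qI_closed : zmod_closed qI.
Proof.
split=> [|s t /asboolP [c -> yc] /asboolP [d -> yd]]; apply/asboolP.
  by exists (fun=> 0) => [|l]; rewrite ?rmorph0 ?big1 // => l _; rewrite mul0r.
exists (fun l => c l - d l) => [|l]; last by rewrite rmorphB yc yd subrr.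
by rewrite -sumrB; apply: eq_bigr => l _; rewrite mulrBl.
Qed.

HB.instance Definition _ := GRing.isZmodClosed.Build S qI qI_closed.
Definition qI_sub : zmodClosed S := GRing.ZmodClosed.clone S qI _.
Local Notation SqI := (@Quotient.quot S qI_sub).

Lemma qI_eq (s t : S) : \pi_SqI s = \pi_SqI t <-> qI (s - t).
Proof.
by split=> [/eqP|H]; [|apply/eqP]; rewrite -Quotient.idealrBE.
Qed.

Let coef b : 'I_n.+1 -> S := projT1 (cid (ga b)).
Let coefE b : ptens phi eta 1 b = \sum_l ptens phi eta (coef b l) (a l).
Proof. exact: projT2 (cid (ga b)). Qed.

Let coef_uniq b (c : 'I_n.+1 -> S) j :
  ptens phi eta 1 b = \sum_l ptens phi eta (c l) (a l) ->
  y (coef b j - c j) = 0.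
Proof.
move=> cE; apply: (@relation_in_ker (fun l => coef b l - c l)).
apply: (addIr (\sum_l ptens phi eta (c l) (a l))); rewrite -big_split add0r.
rewrite -cE coefE; apply: eq_bigr => l _ /=.
by rewrite -ptensDl subrK.
Qed.

Let qI_mul (s t i : S) : rel_ideal i -> y (s - t) = 0 ->
  \pi_SqI (s * i) = \pi_SqI (t * i).
Proof.
move=> /asboolP [c ->] yst; apply/qI_eq/asboolP.
exists (fun l => (s - t) * c l) => [|l]; last by rewrite rmorphM yst mul0r.
by rewrite -mulrBl mulr_sumr; apply: eq_bigr => l _; rewrite mulrA.
Qed.

Let coordI j (i : relI) (b : alg eta) : SqI :=
  \pi_SqI (coef b j * (relI_val i : S)).

Let coordI_balanced j : balanced (coordI j).
Proof.
split=> [i i' b|i b b'|p i b].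
- by rewrite /coordI -raddfD -mulrDr.
- rewrite /coordI -raddfD -mulrDl; apply: qI_mul; first exact: (valP i).
  apply: (@coef_uniq (b + b') (fun l => coef b l + coef b' l)).
  by rewrite ptensDr !coefE -big_split; apply: eq_bigr => l _; rewrite ptensDl.
rewrite /coordI [relI_val _]/(phi p * relI_val i) mulrCA mulrA.
apply/esym; apply: qI_mul; first exact: (valP i).
apply: (@coef_uniq (eta p * b) (fun l => phi p * coef b l)).
rewrite -ptensZ mulr1.
have sE s t d : ptens phi eta (s * t) d = tinl phi eta s * ptens phi eta t d.
  by rewrite /tinl ptensM mul1r.
rewrite -[phi p]mulr1 sE coefE mulr_sumr; apply: eq_bigr => l _.
by rewrite -sE mulr1.
Qed.

Lemma rel_ideal_gen l : rel_ideal (r l).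
Proof.
apply/asboolP; exists (fun k => (k == l)%:R).
rewrite (bigD1 l) //= eqxx mul1r big1 ?addr0 // => k /negPf ->.
by rewrite mul0r.
Qed.

(** Let I be the ideal of the coefficients of the relation and q the kernel of
    y. By flatness the relation holds already in I (x) A. The coordinates of the
    elements of A are well defined modulo q, by relation_in_ker, so that taking
    the j-th coordinate is a map I (x) A -> S / q I; it sends the relation to
    the class of r_j, which is therefore in q I. Nakayama's lemma then kills I by some s outside q. *)
Lemma relation_killed : exists2 s, y s != 0 & forall l, s * r l = 0.
Proof.
pose i l := RelI (rel_ideal_gen l).
pose t : tensor relI (alg eta) := \sum_l i l *t (a l : alg eta).
have binc : balanced (fun (m : relI) (b : alg eta) => relI_val m *t b).
  split=> [m m' b|m b b'|p m b]; first exact: tensDl.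
    exact: tensDr.
  exact: tensZ.
have t0 : t = 0.
  apply: (eta_flat (f := (val : {linear relI -> alg phi}))); first exact: val_inj.
  rewrite tlift_sum // tlift0 // -[RHS]r0; apply: eq_bigr => l _.
  by rewrite tlift_tens.
have rq j : qI (r j).
  have : tlift (coordI j) t = 0.
    by rewrite t0 tlift0 //; exact: coordI_balanced.
  rewrite tlift_sum; last exact: coordI_balanced.
  under eq_bigr => l _.
    rewrite tlift_tens; last exact: coordI_balanced.
    rewrite /coordI (@qI_mul _ (l == j)%:R); last 2 first.
    - exact: rel_ideal_gen.
    - apply: (@coef_uniq (a l) (fun k => (l == k)%:R)).
      rewrite (bigD1 l) //= eqxx big1 ?addr0 // => k; rewrite eq_sym => /negPf ->.
      by apply: (addrI (ptens phi eta 0 (a k))); rewrite -ptensDl !addr0.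
    over.
  rewrite (bigD1 j) //= eqxx mul1r big1 ?addr0 => [|l /negPf ->]; last first.
    by rewrite mul0r raddf0.
  by move=> H; have := (qI_eq (r j) 0).1; rewrite subr0 raddf0; apply.
have /choice [q qP] j : exists c : 'I_n.+1 -> S,
    r j = \sum_l c l * r l /\ forall l, y (c l) = 0.
  by have /asboolP [c ? ?] := rq j; exists c.
pose Q : 'M[S]_n.+1 := \matrix_(j, l) q j l.
exists (\det (1%:M - Q)).
  rewrite -det_map_mx map_mxB map_mx1.
  have -> : map_mx y Q = 0 by apply/matrixP => j l; rewrite !mxE (qP j).2.
  by rewrite subr0 det1 oner_eq0.
move=> l; pose c : 'cV[S]_n.+1 := \col_j r j.
have c0 : (1%:M - Q) *m c = 0.
  apply/matrixP => j k; rewrite mulmxBl mul1mx !mxE {1}(qP j).1.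
  by apply/eqP; rewrite subr_eq0; apply/eqP/eq_bigr => d _; rewrite !mxE.
have : \det (1%:M - Q) *: c = 0.
  by rewrite -mul_scalar_mx -mul_adj_mx -mulmxA c0 mulmx0.
by move=> /matrixP /(_ l 0); rewrite !mxE.
Qed.

End OneRelation.

End Relations.

(** ** From generators to a basis *)

Section CommutativeExt.
Variables (R : comPzRingType) (B : fdalg R).
Hypothesis acstC : forall i j, @acst _ B i j = acst j i.
Variables (S : comPzRingType) (phi : {rmorphism R -> S}).

Lemma fd_mulC : commutative (@GRing.mul (fdext B phi)).
Proof.
move=> u v; rewrite -[LHS]/(fdmul u v) -[RHS]/(fdmul v u) /fdmul exchange_big.
by apply: eq_bigr => j _; apply: eq_bigr => i _; rewrite acstC mulrC.
Qed.

Definition fdcom of (forall i j, @acst _ B i j = acst j i) : Type :=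
  fdext B phi.

HB.instance Definition _ := GRing.PzRing.copy (fdcom acstC) (fdext B phi).
HB.instance Definition _ :=
  GRing.PzRing_hasCommutativeMul.Build (fdcom acstC) fd_mulC.

Definition fdcst (s : S) : fdcom acstC := s *: (1 : fdext B phi).

Lemma fdcst_zmod : zmod_morphism fdcst.
Proof. by move=> s t; exact: scalerBl. Qed.

Lemma fdcst_monoid : monoid_morphism fdcst.
Proof.
split=> [|s t]; first exact: scale1r.
rewrite -[RHS]/((s *: (1 : fdext B phi)) * (t *: (1 : fdext B phi))).
by rewrite fd_scalerAl fd_scalerAr mulr1 scalerA.
Qed.

HB.instance Definition _ := GRing.isZmodMorphism.Build S (fdcom acstC) fdcst
  fdcst_zmod.
HB.instance Definition _ := GRing.isMonoidMorphism.Build S (fdcom acstC) fdcst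
  fdcst_monoid.

Lemma fdcst_mul s (v : fdcom acstC) : fdcst s * v = s *: (v : fdext B phi).
Proof.
rewrite -[LHS]/((s *: (1 : fdext B phi)) * (v : fdext B phi)).
by rewrite fd_scalerAl mul1r.
Qed.

End CommutativeExt.

Section Evaluation.
Variables (R A : comPzRingType) (eta : {rmorphism R -> A}).
Variables (S : comPzRingType) (phi : {rmorphism R -> S}).
Variables (n : nat) (a : 'I_n.+1 -> A).
Local Notation il := (tinl phi eta).
Local Notation ir := (tinr phi eta).

Lemma ptens_il_ir s b : ptens phi eta s b = il s * ir b.
Proof. by rewrite /tinl /tinr ptensM mul1r mulr1. Qed.

Definition row_eval (v : 'rV[S]_n.+1) : tring phi eta :=
  \sum_l ptens phi eta (v 0 l) (a l).
Local Notation ev := row_eval.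

Lemma row_evalB : {morph ev : u v / u - v}.
Proof.
move=> u v; rewrite /ev -sumrB; apply: eq_bigr => l _.
by rewrite !ptens_il_ir !mxE rmorphB mulrBl.
Qed.

HB.instance Definition _ :=
  GRing.isZmodMorphism.Build 'rV[S]_n.+1 (tring phi eta) ev row_evalB.

Lemma row_evalZ s v : ev (s *: v) = il s * ev v.
Proof.
rewrite /ev mulr_sumr; apply: eq_bigr => l _.
by rewrite !ptens_il_ir mxE rmorphM mulrA.
Qed.

Lemma row_eval_delta l : ev (delta_mx 0 l) = ir (a l).
Proof.
rewrite /ev (bigD1 l) //= mxE !eqxx big1 ?addr0 // => k /negPf kl.
by rewrite mxE kl andbF ptens_il_ir rmorph0 mul0r.
Qed.

Lemma row_eval_sum (v : 'rV_n.+1) (c : 'I_n.+1 -> 'rV[S]_n.+1) b :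
  (forall l, ev (c l) = ir (b * a l)) ->
  ev (\sum_l v 0 l *: c l) = ir b * ev v.
Proof.
move=> cE; rewrite raddf_sum mulr_sumr; apply: eq_bigr => l _.
by rewrite /= row_evalZ cE ptens_il_ir rmorphM mulrCA.
Qed.

End Evaluation.

(** The module of relations is killed one finite family at a time: its finite
    generation is a consequence of near_basis and comes too late. *)
Lemma near_relations (R A : comPzRingType) (eta : {rmorphism R -> A})
    (K : fieldType) (x : {rmorphism R -> K}) n (S : comNzRingType)
    (phi : {rmorphism R -> S}) (y : {rmorphism S -> K}) (a : 'I_n.+1 -> A)
    (I : finType) (v : I -> 'rV[S]_n.+1) :
  flat_hom eta ->
  ~ near x (fun S phi y => exists a : 'I_n -> A, generates eta phi a) ->
  flat_etale phi -> (forall r, y (phi r) = x r) -> generates eta phi a ->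
  (forall i, row_eval eta phi a (v i) = 0) ->
  near y (fun T psi z => forall i, map_mx psi (v i) = 0).
Proof.
move=> eta_flat minn fe yx ga v0.
have /choice [s sP] i : exists s, y s != 0 /\ forall l, s * v i 0 l = 0.
  have [s ys sv] := relation_killed eta_flat minn fe yx ga (v0 i).
  by exists s.
apply: near_mono (near_inv_all (fun i => (sP i).1)) _ => T psi z _ su i.
have [u ru] := su i; apply/rowP => l; rewrite !mxE -[LHS]mul1r -ru mulrAC.
by rewrite -rmorphM (sP i).2 rmorph0 mul0r.
Qed.


Section MultiplicationTable.
Variables (R : comNzRingType) (G : affGroup R).
Local Notation A := (coord_ring G).
Local Notation eta := (str G).
Hypothesis Gflat : flat_hom eta.
Variables (K : fieldType) (x : {rmorphism R -> K}) (n : nat).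
Hypothesis minn : ~ near x (fun S phi y => exists a : 'I_n -> A, generates eta phi a).
Variables (S : comNzRingType) (phi : {rmorphism R -> S}) (y : {rmorphism S -> K}).
Hypotheses (fe : flat_etale phi) (yx : forall r, y (phi r) = x r).
Variable a : 'I_n.+1 -> A.
Hypothesis ga : generates eta phi a.
Local Notation ev := (row_eval eta phi a).
Local Notation ir := (tinr phi eta).

Variables (c : 'I_n.+1 -> 'I_n.+1 -> 'rV[S]_n.+1) (u : 'rV[S]_n.+1).
Hypothesis cA : forall i j k,
  \sum_l c j k 0 l *: c i l = \sum_l c i j 0 l *: c l k.
Hypothesis c1l : forall i, \sum_l u 0 l *: c l i = delta_mx 0 i.
Hypothesis c1r : forall i, \sum_l u 0 l *: c i l = delta_mx 0 i.
Hypothesis cC : forall i j, c i j = c j i.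
Hypothesis cE : forall i j, ev (c i j) = ir (a i * a j).
Hypothesis uE : ev u = ir 1.

Let B := FdAlg cA c1l c1r.
Let BC : forall i j, @acst _ B i j = acst j i := cC.
Let D : comPzRingType := fdcom idfun BC.

Let ev_mul : monoid_morphism (ev : D -> tring phi eta).
Proof.
split.
  have -> : (1 : D) = u by apply/rowP => l; rewrite mxE.
  exact: uE.
have evb (v w : D) : ev (v * w : D) = ev v * ev w; last by [].
rewrite -[v * w]/(fdmul (v : fdext B idfun) w) /fdmul raddf_sum [in RHS]/row_eval mulr_suml.
apply: eq_bigr => i _; rewrite raddf_sum mulr_sumr.
apply: eq_bigr => j _; rewrite /= row_evalZ !ptens_il_ir map_mx_id // cE !rmorphM.
by ring.
Qed.

Let evM : {rmorphism D -> tring phi eta}.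
Proof.
pose hZ := GRing.isZmodMorphism.Build D (tring phi eta) ev (@row_evalB _ _ _ _ _ _ a).
pose hR := GRing.isMonoidMorphism.Build D (tring phi eta) ev ev_mul.
exact: (HB.pack (ev : D -> tring phi eta) hZ hR).
Defined.

(** The generators and relations of A give finitely many equations which make
    the multiplication table c the target of a ring homomorphism h from A with
    h (a_l) the l-th basis vector. The coordinates of h are those of a basis:
    h turns a relation among the a_l into one among the basis vectors. *)
Lemma near_basis_table : finitely_presented_hom eta ->
  near y (fun T psi z => exists co : 'I_n.+1 -> A -> T,
    basis_along (psi \o phi) a co).
Proof.
case/finitely_presentedP => N [X [m [P XP]]].
have [Xs _] := represents_presents XP.
have /choice [Q QE] l := Xs (a l).
have /choice [xi xiE] t : exists v : D, ev v = ir (X t).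
  have [d dE] := ga (X t); exists (\row_l d l).
  by rewrite /row_eval [RHS]dE; apply: eq_bigr => l _; rewrite mxE.
pose beta : {rmorphism R -> D} := fdcst BC idfun \o phi.
have evbeta r : ev (beta r) = ir (eta r).
  by rewrite [LHS]row_evalZ [X in _ * X](ev_mul.1) mulr1; exact: tinlr.
have evP p : ev (fpoly_eval beta xi p) = ir (fpoly_eval eta X p).
  rewrite -[LHS]/(evM _) (fpoly_eval_comp (beta := ir \o eta)) //.
  rewrite [RHS](fpoly_eval_comp (beta := ir \o eta)) //.
  by apply: eq_fpoly_eval => t; exact: xiE.
pose v (k : 'I_m + 'I_n.+1) : 'rV[S]_n.+1 := match k with
  | inl j => fpoly_eval beta xi (P j)
  | inr l => (fpoly_eval beta xi (Q l) : 'rV_n.+1) - delta_mx 0 l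
  end.
have v0 k : ev (v k) = 0.
  case: k => [j|l]; first by rewrite evP (rep_sol XP) rmorph0.
  by rewrite [LHS]row_evalB evP QE row_eval_delta subrr.
apply: near_mono (near_relations Gflat minn fe yx ga v0) _ => T psi z zy vT.
have E s : psi (idfun s) = psi s by [].
pose D' : comPzRingType := fdcom psi BC.
pose f : {rmorphism D -> D'} := fdmap E.
pose beta' : {rmorphism R -> D'} := fdcst BC psi \o (psi \o phi).
have fbeta r : f (beta r) = beta' r.
  have f1 : fdmap E (1 : fdext B idfun) = 1 := rmorph1 (fdmap E).
  by have := fdmapZ E (phi r) (1 : fdext B idfun); rewrite f1.
have fP p : f (fpoly_eval beta xi p) = fpoly_eval beta' (fun t => f (xi t)) p.
  exact: fpoly_eval_comp.
have [|h [h1 h2]] := rep_ex XP (beta := beta') (y := fun t => f (xi t)).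
  by move=> j; rewrite -fP; exact: (vT (inl j)).
have ha l : h (a l) = delta_mx 0 l.
  rewrite -(QE l) (fpoly_eval_comp (beta := beta')) // (eq_fpoly_eval _ _ h2) -fP.
  have /eqP := vT (inr l); rewrite map_mxB subr_eq0 => /eqP H.
  by rewrite [LHS]H map_delta_mx.
pose co l b : T := (h b : 'rV_n.+1) 0 l.
have fg r : fdcst BC psi ((psi \o phi) r) = h (eta r) by rewrite h1.
exists co; split.
- by move=> l b b'; rewrite /co rmorphD mxE.
- by move=> l r b; rewrite /co rmorphM -fg fdcst_mul mxE.
- by move=> l k; rewrite /co ha mxE eqxx.
move=> b; have [d dE] := generates_comp (fun r => erefl ((psi \o phi) r)) ga b.
suff dco l : d l = co l b by rewrite dE; apply: eq_bigr => l _; rewrite dco.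
have := congr1 (tring_lift fg) dE; rewrite tring_liftE rmorph1 mul1r /co => ->.
rewrite rmorph_sum; transitivity ((\sum_k d k *: delta_mx 0 k : 'rV_n.+1) 0 l).
  rewrite summxE (bigD1 l) //= !mxE !eqxx mulr1 big1 ?addr0 // => k /negPf kl.
  by rewrite !mxE eq_sym kl andbF mulr0.
congr (fun_of_matrix _ 0 l); apply: eq_bigr => k _.
by rewrite [RHS]tring_liftE ha fdcst_mul.
Qed.

End MultiplicationTable.

Section LocallyFree.
Variables (R : comNzRingType) (G : affGroup R).
Local Notation A := (coord_ring G).
Local Notation eta := (str G).
Hypotheses (Gfin : finite_hom eta) (Gflat : flat_hom eta).
Hypothesis Gfp : finitely_presented_hom eta.
Variables (K : fieldType) (x : {rmorphism R -> K}).

(** Local freeness of A at x. A multiplication table of the generators is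
    associative and unital up to finitely many relations, and is exactly so
    over a smaller neighbourhood. *)
Theorem near_basis : near x (fun S phi y =>
  exists n (a : 'I_n.+1 -> A) (co : 'I_n.+1 -> A -> S), basis_along phi a co).
Proof.
have [|n [[S [phi [y [fe yx [a ga]]]]] minn]] :=
    @exists_min_generated R A eta K x (x \o counit G) _ Gfin.
  by move=> r /=; rewrite counit_str.
pose ev := row_eval eta phi a.
have /choice [d dE] b : exists v, ev v = tinr phi eta b.
  have [d dE] := ga b; exists (\row_l d l).
  by rewrite /ev /row_eval [RHS]dE; apply: eq_bigr => l _; rewrite mxE.
pose c i j := d (a i * a j); pose u := d 1.
have cC i j : c i j = c j i by rewrite /c mulrC.
have evc b (w : 'rV_n.+1) : ev (\sum_l w 0 l *: d (b * a l)) = tinr phi eta b * ev w.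
  by apply: row_eval_sum => l; exact: dE.
pose v (k : 'I_n.+1 * 'I_n.+1 * 'I_n.+1 + 'I_n.+1) : 'rV[S]_n.+1 := match k with
  | inl (i, j, k) => \sum_l c j k 0 l *: c i l - \sum_l c i j 0 l *: c l k
  | inr i => \sum_l u 0 l *: c l i - delta_mx 0 i
  end.
have v0 k : ev (v k) = 0.
  case: k => [[[i j] k]|i]; rewrite /ev [LHS]row_evalB -/ev.
    under [X in _ - ev X]eq_bigr do rewrite (cC _ k).
    by rewrite !evc !dE -!rmorphM mulrA [a i * a j * a k]mulrC subrr.
  under eq_bigr do rewrite (cC _ i).
  by rewrite evc dE -rmorphM mulr1 /ev row_eval_delta subrr.
have [T [psi [z [fe' zy vT]]]] := near_relations Gflat minn fe yx ga v0.
pose c' i j := map_mx psi (c i j); pose u' := map_mx psi u.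
have mapE (w : 'rV_n.+1) (e : 'I_n.+1 -> 'rV[S]_n.+1) :
    \sum_l (map_mx psi w : 'rV_n.+1) 0 l *: map_mx psi (e l) =
    map_mx psi (\sum_l w 0 l *: e l).
  by rewrite raddf_sum; apply: eq_bigr => l _; rewrite /= map_mxZ mxE.
have c'A i j k : \sum_l c' j k 0 l *: c' i l = \sum_l c' i j 0 l *: c' l k.
  rewrite !mapE; apply/eqP; rewrite -subr_eq0 -map_mxB; apply/eqP.
  exact: (vT (inl (i, j, k))).
have c'1l i : \sum_l u' 0 l *: c' l i = delta_mx 0 i.
  rewrite mapE -(map_delta_mx psi); apply/eqP; rewrite -subr_eq0 -map_mxB.
  by apply/eqP; exact: (vT (inr i)).
have c'C i j : c' i j = c' j i by rewrite /c' cC.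
have c'1r i : \sum_l u' 0 l *: c' i l = delta_mx 0 i.
  by rewrite -[RHS]c'1l; apply: eq_bigr => l _; rewrite c'C.
have zx r : z ((psi \o phi) r) = x r by rewrite /= zy yx.
have E r : psi (phi r) = (psi \o phi) r by [].
have ga' : generates eta (psi \o phi) a := generates_comp E ga.
have fe2 := flat_etale_comp fe fe'.
have ev' b : row_eval eta (psi \o phi) a (map_mx psi (d b)) = tinr (psi \o phi) eta b.
  rewrite /tinr -(rmorph1 psi) (ptens_comp E (esym (dE b))).
  by apply: eq_bigr => l _; rewrite mxE.
have := near_basis_table Gflat minn fe2 zx ga' c'A c'1l c'1r c'C _ _ Gfp.
case=> [i j||T' [psi' [z' [fe3 zz [co ba]]]]]; [exact: ev'|exact: ev'|].
exists T', (psi' \o (psi \o phi)), z'; split.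
- exact: flat_etale_comp.
- by move=> r; rewrite -zx -zz.
by exists n, a, co.
Qed.

End LocallyFree.

(** * Points with values in fields *)

Lemma domain_embeds (Q : comNzRingType) :
  (forall a b : Q, a * b = 0 -> (a == 0) || (b == 0)) ->
  exists (K : fieldType) (f : {rmorphism Q -> K}), injective f.
Proof.
move=> Qdom; pose invertible (a : Q) := exists b, b * a = 1.
pose unit : pred Q := fun a => `[< invertible a >].
pose inv (a : Q) : Q :=
  if pselect (invertible a) is left ex then projT1 (cid ex) else a.
have invV : {in unit, left_inverse 1 inv *%R}.
  by move=> a /asboolP ua; rewrite /inv; case: pselect => // ex; case: cid.
have unitPl a b : b * a = 1 -> unit a by move=> ba; apply/asboolP; exists b.
have inv_out : {in [predC unit], inv =1 id}.
  move=> a; rewrite inE => /negP ua; rewrite /inv; case: pselect => // ex.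
  by case: ua; apply/asboolP.
pose U : comUnitRingType := HB.pack (GRing.ComNzRing.sort Q)
  (GRing.ComNzRing.class Q)
  (GRing.ComNzRing_hasMulInverse.Build Q invV unitPl inv_out).
pose D : idomainType := HB.pack (GRing.ComUnitRing.sort U)
  (GRing.ComUnitRing.class U)
  (GRing.ComUnitRing_isIntegral.Build U Qdom).
exists {fraction D}, (@FracField.tofrac D : {rmorphism D -> {fraction D}}).
by move=> a b /eqP; rewrite tofrac_eq => /eqP.
Qed.

(** The fraction field of R / p. *)
Lemma prime_ideal_point (R : comNzRingType) (p : R -> Prop) : prime_ideal p ->
  exists (K : fieldType) (x : {rmorphism R -> K}), forall r, x r = 0 <-> p r.
Proof.
case=> p0 pD pM p1 pP; pose P : pred R := fun r => `[< p r >].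
have Pid : idealr_closed P.
  split; first exact/asboolP.
    by apply/negP => /asboolP.
  by move=> a u v /asboolP pu /asboolP pv; apply/asboolP/pD => //; exact: pM.
have Pprime : prime_idealr_closed P.
  by move=> u v /asboolP /pP [?|?]; apply/orP; [left|right]; apply/asboolP.
pose I : prime_idealr R := HB.pack P (isIdealr.Build R P Pid)
  (isPrimeIdealrClosed.Build R P Pprime).
have [K [f finj]] := domain_embeds (@Quotient.rquot_IdomainAxiom R I).
exists K, (f \o \pi_{ideal_quot I}) => r /=.
have piE : (\pi_{ideal_quot I} r = 0) <-> p r.
  rewrite -(raddf0 (\pi_{ideal_quot I})).
  split=> [/eqP|pr]; [|apply/eqP]; rewrite -Quotient.idealrBE subr0.
    by move/asboolP.
  exact/asboolP.
rewrite -piE; split=> [|->]; last exact: rmorph0.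
by rewrite -(rmorph0 f); exact: finj.
Qed.

(** * Comodules as modules over the dual algebra *)

Section ModuleAction.
Variables (S k : comPzRingType) (B : fdalg S) (phi : {rmorphism S -> k}).
Variables (G : affGroup k) (a : 'I_(adim B) -> coord_ring G).
Variable co : 'I_(adim B) -> coord_ring G -> k.
Local Notation id_k := (idfun : {rmorphism k -> k}).
Local Notation eta := (str G).
Local Notation D := (fdext B phi).
Hypothesis ba : basis_along id_k a co.
Hypothesis cstE : forall i j l, ba_cst a co i j l = phi (acst i j 0 l).
Hypothesis oneE : forall l, counit G (a l) = phi (aone B 0 l).

Section Action.
Variable W : comod G.
Local Notation rho := (comod_rho co (W := W)).
Let rhoP := comod_mod_data ba W.

Definition fd_act (d : D) (w : W) : W := \sum_l (d : 'rV_(adim B)) 0 l *: rho l w.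

Lemma fd_actDl d d' w : fd_act (d + d') w = fd_act d w + fd_act d' w.
Proof.
by rewrite -big_split; apply: eq_bigr => l _ /=; rewrite mxE scalerDl.
Qed.

Lemma fd_actDr d w w' : fd_act d (w + w') = fd_act d w + fd_act d w'.
Proof.
rewrite -big_split; apply: eq_bigr => l _ /=.
by rewrite (md_add rhoP) scalerDr.
Qed.

Lemma fd_actZl s d w : fd_act (s *: d) w = s *: fd_act d w.
Proof.
by rewrite scaler_sumr; apply: eq_bigr => l _; rewrite mxE scalerA.
Qed.

Lemma fd_actZr s d w : fd_act d (s *: w) = s *: fd_act d w.
Proof.
rewrite scaler_sumr; apply: eq_bigr => l _.
by rewrite (md_sc rhoP) !scalerA mulrC.
Qed.

Lemma fd_act0l w : fd_act 0 w = 0.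
Proof. by apply: (addrI (fd_act 0 w)); rewrite -fd_actDl !addr0. Qed.

Lemma fd_act0r d : fd_act d 0 = 0.
Proof. by apply: (addrI (fd_act d 0)); rewrite -fd_actDr !addr0. Qed.

Lemma fd_act_suml I r (P : pred I) (F : I -> D) w :
  fd_act (\sum_(i <- r | P i) F i) w = \sum_(i <- r | P i) fd_act (F i) w.
Proof.
apply: (big_morph (fd_act^~ w)) => [d d'|]; [exact: fd_actDl|exact: fd_act0l].
Qed.

Lemma fd_act_sumr I r (P : pred I) (F : I -> W) d :
  fd_act d (\sum_(i <- r | P i) F i) = \sum_(i <- r | P i) fd_act d (F i).
Proof.
apply: (big_morph (fd_act d)) => [w w'|]; [exact: fd_actDr|exact: fd_act0r].
Qed.

Lemma fd_act_basis l w : fd_act (fdb phi l) w = rho l w.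
Proof.
rewrite /fd_act (bigD1 l) //= mxE !eqxx scale1r big1 ?addr0 // => j /negPf jl.
by rewrite mxE jl andbF scale0r.
Qed.

Lemma fd_act_mul d d' w : fd_act (d * d') w = fd_act d (fd_act d' w).
Proof.
rewrite {1}(fdb_sum d) {1}(fdb_sum d') mulr_suml fd_act_suml.
apply: eq_bigr => i _; rewrite mulr_sumr fd_act_suml.
rewrite -fd_act_basis fd_act_sumr scaler_sumr; apply: eq_bigr => j _.
rewrite fd_scalerAl fd_scalerAr !fd_actZl fd_actZr fdbM fd_act_basis.
congr (_ *: (_ *: _)); rewrite (md_mul rhoP); apply: eq_bigr => l _.
by rewrite mxE cstE.
Qed.

Lemma fd_act1 w : fd_act 1 w = w.
Proof.
rewrite -[RHS](md_one rhoP); apply: eq_bigr => l _.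
by rewrite mxE /= oneE.
Qed.

End Action.

Lemma morphism_act (W W' : comod G) (f : {linear W -> W'}) :
  comod_morphism f <-> forall d w, f (fd_act d w) = fd_act d (f w).
Proof.
have scP' := act_scaler_id W'.
split=> [fm d w|fm w].
  rewrite linear_sum; apply: eq_bigr => l _; rewrite linearZ; congr (_ *: _).
  rewrite /comod_rho fm /tcoord.
  rewrite (tlift_additive (h := f)); last exact: linearD.
  rewrite (tlift_tlift _ _ (balanced_tcoord ba scP' l)).
  apply: eq_tlift => m b; rewrite linearZ.
  by rewrite (tlift_tens _ _ (balanced_tcoord ba scP' l)).
rewrite (comod_rhoE ba (f w)) (comod_rhoE ba w) tlift_sum; last first.
  split=> [m m' b|m b b'|s m b].
  - by rewrite linearD tensDl.
  - exact: tensDr.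
  by rewrite linearZ tensZ.
apply: eq_bigr => l _; rewrite tlift_tens; last first.
  split=> [m m' b|m b b'|s m b].
  - by rewrite linearD tensDl.
  - exact: tensDr.
  by rewrite linearZ tensZ.
by rewrite -!fd_act_basis fm.
Qed.

(** P is isomorphic to the left ideal D e. *)
Record left_ideal_comod (e : D) (P : comod G) (theta : P -> D) : Prop := {
  lic_linear : linear theta;
  lic_act : forall d p, theta (fd_act d p) = d * theta p;
  lic_inj : injective theta;
  lic_image : forall d, d * e = d <-> exists p, theta p = d
}.

End ModuleAction.

(** Left ideals generated by rank-one idempotents, one from each block, are the
    simple modules. The three lemmas that follow use only elements: irreducible
    since every nonzero element generates, pairwise not isomorphic by
    orthogonality, and exhaustive since the idempotents generate the unit
    ideal. *)

Section SplitModules.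
Variables (S : comPzRingType) (k : fieldType) (B : fdalg S).
Variable phi : {rmorphism S -> k}.
Variables (G : affGroup k) (a : 'I_(adim B) -> coord_ring G).
Variable co : 'I_(adim B) -> coord_ring G -> k.
Local Notation D := (fdext B phi).
Hypothesis ba : basis_along (idfun : {rmorphism k -> k}) a co.
Hypothesis cstE : forall i j l, ba_cst a co i j l = phi (acst i j 0 l).
Hypothesis oneE : forall l, counit G (a l) = phi (aone B 0 l).
Local Notation act := (fd_act co).

Variables (r : nat) (e : 'I_r -> D).
Hypothesis e_idem : forall i, e i * e i = e i.
Hypothesis e_corner : forall i d, exists c : k, e i * d * e i = c *: e i.
Hypothesis e_neq0 : forall i, e i != 0.
Hypothesis e_orth : forall i j, i <> j -> forall z, e i * z * e j = 0.
Hypothesis e_cover : exists s (f : 'I_s -> 'I_r) (b c : 'I_s -> D),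
  1 = \sum_t b t * e (f t) * c t.

(** Writing 1 as the sum of the b e_f c, some e_f c d is nonzero. By
    orthogonality f = i, and e_i c d = e_i (c d) e_i is a nonzero multiple of
    e_i. *)
Lemma left_ideal_gen i d : d * e i = d -> d != 0 -> exists d', d' * d = e i.
Proof.
move=> de d0; have [s [f [b [c one]]]] := e_cover.
have [t tP] : exists t, e (f t) * c t * d != 0.
  apply: contrapT => H; move: d0; rewrite -[d]mul1r one mulr_suml big1 ?eqxx // => t _.
  rewrite -!mulrA [e _ * _]mulrA.
  have [-> |tn] := eqVneq (e (f t) * c t * d) 0; first by rewrite mulr0.
  by case: H; exists t.
have fi : f t = i.
  by apply: contrapT => /e_orth H; move: tP; rewrite -de mulrA -[_ * _ * d]mulrA H eqxx.
have [q qE] := e_corner i (c t * d).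
have H : e i * c t * d = q *: e i by rewrite -qE -{1}de !mulrA.
have q0 : q != 0.
  by apply: contraNneq tP => q0; rewrite fi H q0 scale0r.
exists (q^-1 *: (e i * c t)).
by rewrite fd_scalerAl H scalerA mulVf // scale1r.
Qed.

Variables (P : 'I_r -> comod G) (theta : forall i, P i -> D).
Hypothesis PP : forall i, left_ideal_comod co (e i) (@theta i).

Let thD i (p q : P i) : theta (p + q) = theta p + theta q.
Proof. by have := lic_linear (PP i) 1 p q; rewrite !scale1r. Qed.

Let th0 i : theta (0 : P i) = 0.
Proof. by apply: (addrI (theta (0 : P i))); rewrite -thD !addr0. Qed.

Let gen_ex i : exists p : P i, theta p = e i.
Proof. exact/(lic_image (PP i)). Qed.

Lemma left_ideal_irreducible i : irreducible_comod (P i).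
Proof.
have [p0 p0E] := gen_ex i.
split.
  by exists p0 => p00; move: (e_neq0 i); rewrite -p0E p00 th0 eqxx.
move=> W f /(morphism_act phi ba) fm finj.
have [W0|nW0] := pselect (forall w : W, w = 0); [by left|right=> v].
have [w w0] : exists w : W, w <> 0.
  by apply: contrapT => H; apply: nW0 => w; apply: contrapT => wn; apply: H; exists w.
have d0 : theta (f w) != 0.
  apply/eqP => fw0; apply: w0; apply: finj; apply: (lic_inj (PP i)).
  by rewrite fw0 linear0 th0.
have [d' d'E] : exists d', d' * theta (f w) = e i.
  by apply: left_ideal_gen d0; apply/(lic_image (PP i)); exists (f w).
exists (act (theta v * d') w); rewrite fm; apply: (lic_inj (PP i)).
rewrite (lic_act (PP i)) -mulrA d'E.
by apply/(lic_image (PP i)); exists v.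
Qed.

Lemma left_ideal_iso i j : comod_iso (P i) (P j) -> i = j.
Proof.
case=> f [/(morphism_act phi ba) fm /bij_inj finj]; apply: contrapT => ij.
have [p0 p0E] := gen_ex i.
have ep0 : act (e i) p0 = p0.
  by apply: (lic_inj (PP i)); rewrite (lic_act (PP i)) p0E e_idem.
have q0 : theta (f p0) = 0.
  have qe : theta (f p0) * e j = theta (f p0).
    by apply/(lic_image (PP j)); exists (f p0).
  by rewrite -ep0 fm (lic_act (PP j)) -qe mulrA e_orth.
move: (e_neq0 i); rewrite -p0E; have -> : p0 = 0; last by rewrite th0 eqxx.
by apply: finj; apply: (lic_inj (PP j)); rewrite linear0 q0 th0.
Qed.

(** Some e_i moves a vector of W to a nonzero w', and z |-> z w' is then an
    isomorphism from D e_i. *)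
Lemma irreducible_left_ideal (W : comod G) : irreducible_comod W ->
  exists i, comod_iso (P i) W.
Proof.
case=> [[w w0]] Wirr; have [s [f [b [c one]]]] := e_cover.
have actM := fd_act_mul ba cstE.
have [t tP] : exists t, act (e (f t)) (act (c t) w) <> 0.
  apply: contrapT => H; apply: w0.
  rewrite -[w](fd_act1 ba oneE) one fd_act_suml big1 // => t _.
  rewrite !actM; have [-> |] := pselect (act (e (f t)) (act (c t) w) = 0).
    exact: (fd_act0r ba).
  by move=> tn; case: H; exists t.
set i := f t in tP; set w' := act (e i) _ in tP.
have ew' : act (e i) w' = w' by rewrite -actM e_idem.
pose g (p : P i) : W := act (theta p) w'.
have glin : linear g.
  move=> q p p'; rewrite /g (lic_linear (PP i)) fd_actDl.
  by rewrite fd_actZl.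
pose gL := GRing.isLinear.Build k (P i) W *:%R g glin.
pose h : {linear P i -> W} := HB.pack g gL.
have hm : comod_morphism h.
  apply/(morphism_act phi ba) => d p.
  by rewrite /h /= /g (lic_act (PP i)) actM.
have hinj : injective h.
  apply: raddf_inj => p hp; apply: (lic_inj (PP i)); rewrite th0.
  apply/eqP; apply: contrapT => /negP d0.
  have [d' d'E] : exists d', d' * theta p = e i.
    by apply: left_ideal_gen d0; apply/(lic_image (PP i)); exists p.
  by apply: tP; rewrite -ew' -d'E actM [act _ w']hp (fd_act0r ba).
exists i, h; split=> //.
have [p0 p0E] := gen_ex i.
have [H|H] := Wirr _ h hm hinj.
  by case: tP; rewrite -ew' -p0E (H p0) th0 fd_act0l.
have [h' h'E] := choice H.
by exists h' => // p; apply: hinj; rewrite h'E.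
Qed.

End SplitModules.

(** * The representations attached to a splitting *)

(** The left ideal D e of an idempotent with free image, as the free module of
    rows v, identified with v J in D e. It commutes with base change, so that
    its fibre at a point is the left ideal of the fibre of e. *)

Section LeftIdealComod.
Variables (S T : comPzRingType) (B : fdalg S) (phi : {rmorphism S -> T}).
Variables (G : affGroup T) (a : 'I_(adim B) -> coord_ring G).
Variable co : 'I_(adim B) -> coord_ring G -> T.
Local Notation N := (adim B).
Local Notation D := (fdext B phi).
Hypothesis ba : basis_along (idfun : {rmorphism T -> T}) a co.
Hypothesis cstE : forall i j l, ba_cst a co i j l = phi (acst i j 0 l).
Hypothesis oneE : forall l, counit G (a l) = phi (aone B 0 l).

Variables (e : D) (n : nat) (J : 'M[T]_(n, N)) (L : 'M[T]_(N, n)).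
Hypotheses (JL : J *m L = 1%:M) (LJ : L *m J = fdR e).

Let JE (v : 'rV[T]_n) : (v *m J : D) * e = v *m J.
Proof. by rewrite -mul_fdR -LJ !mulmxA -[v *m J *m L]mulmxA JL mulmx1. Qed.

Definition ideal_rho l (v : 'rV[T]_n) : 'rV[T]_n :=
  ((fdb phi l * (v *m J : D) : D) : 'rV_N) *m L.

Let rhoJ l (v : 'rV[T]_n) : ideal_rho l v *m J = fdb phi l * (v *m J : D).
Proof. by rewrite /ideal_rho -mulmxA LJ mul_fdR -mulrA JE. Qed.

Let J_inj (v w : 'rV[T]_n) : v *m J = w *m J -> v = w.
Proof. by move=> vw; rewrite -[v]mulmx1 -JL mulmxA vw -mulmxA JL mulmx1. Qed.

Lemma ideal_mod_data :
  mod_data (idfun : {rmorphism T -> T}) a co ( *:%R : T -> 'rV[T]_n -> 'rV[T]_n)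
    ideal_rho.
Proof.
have mD (u v w : D) : u * (v + w) = u * v + u * w by exact: mulrDr.
split=> [l v w|l s v|i j v|v]; apply: J_inj.
- by rewrite mulmxDl !rhoJ mulmxDl; exact: mD.
- by rewrite -scalemxAl !rhoJ -scalemxAl; exact: fd_scalerAr.
- rewrite rhoJ rhoJ mulmx_suml mulrA fdbM (fdb_sum (map_mx _ _)) mulr_suml.
  by apply: eq_bigr => l _; rewrite -scalemxAl rhoJ fd_scalerAl mxE cstE.
rewrite mulmx_suml -[RHS](mul1r (v *m J : D)) [in RHS](fdb_sum (1 : D)) mulr_suml.
by apply: eq_bigr => l _; rewrite -scalemxAl rhoJ fd_scalerAl mxE /= oneE.
Qed.

Definition ideal_comod : comod G :=
  data_comod ba (act_scaler_id 'rV[T]_n) ideal_mod_data.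

Section Point.
Variables (k : comPzRingType) (x : {rmorphism T -> k}).
Local Notation phix := (x \o phi).
Let E s : x (phi s) = phix s. Proof. by []. Qed.
Local Notation V := (ext x 'rV[T]_n).
Local Notation cox := (bc_coef (chi := x) x co).

Lemma comod_rho_etens l s v :
  comod_rho cox l (etens x s v : base_change_comod x ideal_comod) =
  etens x s (ideal_rho l v).
Proof.
have Ei r : x (idfun r) = x r by [].
have bax := basis_along_bc Ei ba.
rewrite /comod_rho [coact _ _]bc_coactE data_coactE.
rewrite tlift_sum; last exact: balanced_bc_coact.
under eq_bigr => j _.
  rewrite tlift_tens; last exact: balanced_bc_coact.
  over.
exact: (tcoord_basis bax (act_scaler_id V) l (fun j => etens x s (ideal_rho j v))).
Qed.

Definition ideal_theta (p : base_change_comod x ideal_comod) : fdext B phix :=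
  @tlift T (alg x) 'rV[T]_n (fdext B phix)
    (fun s v => s *: fdmap E (v *m J : D)) p.
Local Notation theta := ideal_theta.

Let balanced_theta : @balanced T (alg x) 'rV[T]_n (fdext B phix)
    (fun s v => s *: fdmap E (v *m J : D)).
Proof.
split=> [s s' v|s v v'|r s v].
- exact: scalerDl.
- by rewrite mulmxDl rmorphD scalerDr.
by rewrite alg_scaleE -scalemxAl fdmapZ scalerA mulrC.
Qed.

Let thetaE s v : theta (etens x s v) = s *: fdmap E (v *m J : D).
Proof. exact: tlift_tens balanced_theta. Qed.

Let thetaD : {morph theta : p q / p + q}.
Proof. by move=> p q; exact: tliftD balanced_theta. Qed.

(* The inverse of theta on the left ideal: coordinates are read off by L. *)
Let kappa (d : fdext B phix) : V :=
  \sum_j etens x (((d : 'rV_N) *m map_mx x L) 0 j) (delta_mx 0 j).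

Let kappaD : {morph kappa : d d' / d + d'}.
Proof.
move=> d d'; rewrite /kappa -big_split; apply: eq_bigr => j _.
by rewrite /= mulmxDl mxE etensDl.
Qed.

Let thetaK : cancel theta kappa.
Proof.
apply: ext_eq => [p q|//|s v]; first by rewrite thetaD kappaD.
rewrite thetaE /kappa [in RHS](row_sum_delta v).
rewrite (big_morph (etens x s) (id1 := 0) (op1 := +%R)); last 2 first.
- by move=> u w; exact: etensDr.
- by apply: (addrI (etens x s 0)); rewrite -etensDr !addr0.
apply: eq_bigr => j _; rewrite -etensZ; congr etens.
rewrite -scalemxAl -map_mxM -mulmxA JL mulmx1 !mxE mulrC.
by [].
Qed.

Let theta0 : theta 0 = 0.
Proof. by apply: (addrI (theta 0)); rewrite -thetaD !addr0. Qed.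

Let thetaZ s p : theta (s *: p) = s *: theta p.
Proof.
move: p; apply: ext_eq => [p q|p q|s' v].
- by rewrite scalerDr thetaD.
- by rewrite thetaD scalerDr.
by rewrite scale_etens !thetaE scalerA.
Qed.

Let theta_rho l p : theta (comod_rho cox l p) = fdb phix l * theta p.
Proof.
have Ei r : x (idfun r) = x r by [].
have rhoP := comod_mod_data (basis_along_bc Ei ba) (base_change_comod x ideal_comod).
move: p; apply: ext_eq => [p q|p q|s v].
- by rewrite (md_add rhoP) thetaD.
- by rewrite thetaD mulrDr.
rewrite comod_rho_etens !thetaE rhoJ fd_scalerAr; congr (_ *: _).
rewrite [LHS]rmorphM; congr (_ * _); exact: fdmapb.
Qed.

Lemma ideal_left_ideal : left_ideal_comod cox (fdmap E e) theta.
Proof.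
split=> [s p q|d p||d].
- by rewrite thetaD thetaZ.
- rewrite (big_morph theta thetaD theta0) {2}(fdb_sum d) mulr_suml.
  by apply: eq_bigr => l _; rewrite thetaZ theta_rho fd_scalerAl.
- exact: can_inj thetaK.
split=> [de|[p <-]].
  exists (kappa d); rewrite -[RHS]de -mul_fdR -map_fdR -LJ map_mxM mulmxA.
  rewrite (big_morph theta thetaD theta0) [in RHS](row_sum_delta (_ *m map_mx x L)).
  rewrite mulmx_suml; apply: eq_bigr => j _.
  by rewrite thetaE -scalemxAl -(map_delta_mx x) -map_mxM.
move: p; apply: ext_eq => [p q|p q|s v].
- by rewrite thetaD mulrDl.
- exact: thetaD.
by rewrite thetaE fd_scalerAl; congr (_ *: _); rewrite -[LHS]rmorphM JE.
Qed.

End Point.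

End LeftIdealComod.

Lemma locally_free_row (T : comPzRingType) n : locally_free ('rV[T]_n : lmodType T).
Proof.
move=> p [_ _ _ p1 _]; exists 1; split=> //.
exists T, idfun, n; split.
  split=> [|t|t t0].
  - by exists 1; rewrite mulr1.
  - by exists t, 0%N; rewrite expr0 mul1r.
  by exists 0%N; rewrite expr0 mul1r.
pose E := ext idfun ('rV[T]_n : lmodType T).
have bm : @balanced T (alg idfun) 'rV[T]_n 'rV[T]_n (fun s m => s *: m).
  split=> [s s' m|s m m'|r s m].
  - exact: scalerDl.
  - exact: scalerDr.
  by rewrite alg_scaleE scalerA mulrC.
pose mu (t : E) : 'rV[T]_n := @tlift T (alg idfun) 'rV[T]_n 'rV[T]_n (fun s m => s *: m) t.
have muE s m : mu (etens idfun s m) = s *: m by exact: tlift_tens bm.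
have muD : {morph mu : t u / t + u} by move=> t u; exact: tliftD bm.
have mu0 : mu 0 = 0 by apply: (addrI (mu 0)); rewrite -muD !addr0.
have muK (t : E) : t = etens idfun 1 (mu t).
  move: t; apply: ext_eq => [//|t u|s m]; first by rewrite muD etensDr.
  by rewrite muE -etensZ mulr1.
have eD : {morph (etens idfun (1 : T) : 'rV[T]_n -> E) : m m' / m + m'}.
  by move=> m m'; exact: etensDr.
have e0 : (etens idfun (1 : T) : 'rV[T]_n -> E) 0 = 0.
  by apply: (addrI (etens idfun (1 : T) (0 : 'rV[T]_n))); rewrite -eD !addr0.
exists (fun i => etens idfun 1 (delta_mx 0 i)) => v.
exists [ffun i => mu v 0 i]; split.
  rewrite {1}(muK v) {1}(row_sum_delta (mu v)) (big_morph _ eD e0).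
  by apply: eq_bigr => i _; rewrite ffunE scale_etens -etensZ.
move=> c vE; apply/ffunP => i; rewrite ffunE vE (big_morph mu muD mu0) summxE.
rewrite (bigD1 i) //= big1 ?addr0 => [|j /negPf ji].
  by rewrite scale_etens muE !mxE !eqxx !mulr1.
by rewrite scale_etens muE !mxE eq_sym ji mulr0.
Qed.

(** A splitting datum persists under base change, so that at every geometric
    point the left ideals of its idempotents are the simple modules over the
    dual algebra, that is, the irreducible representations. *)
Theorem split_good (S : comNzRingType) (T : comPzRingType) (B : fdalg S) (phi : {rmorphism S -> T})
    (G : affGroup T) (a : 'I_(adim B) -> coord_ring G)
    (co : 'I_(adim B) -> coord_ring G -> T) :
  basis_along (idfun : {rmorphism T -> T}) a co ->
  (forall i j l, ba_cst a co i j l = phi (acst i j 0 l)) ->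
  (forall l, counit G (a l) = phi (aone B 0 l)) ->
  split_datum B phi -> good_representation_theory G.
Proof.
move=> ba cstE oneE [r [e [pe orth [s [f [b [c cover]]]]]]].
pose fi i : free_image (fdR (e i)) := let: And4 _ _ _ H := pe i in H.
pose n i := projT1 (cid (fi i)).
pose J i : 'M_(n i, _) := projT1 (cid (projT2 (cid (fi i)))).
pose L i : 'M_(_, n i) := projT1 (cid (projT2 (cid (projT2 (cid (fi i)))))).
have JL i : J i *m L i = 1%:M.
  by case: (projT2 (cid (projT2 (cid (projT2 (cid (fi i))))))).
have LJ i : L i *m J i = fdR (e i).
  by case: (projT2 (cid (projT2 (cid (projT2 (cid (fi i))))))).
exists r, (fun i => ideal_comod ba cstE oneE (JL i) (LJ i)).
split=> [i|k x]; first exact: locally_free_row.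
have Ei q : x (idfun q) = x q by [].
have bax := basis_along_bc Ei ba.
pose E q : x (phi q) = (x \o phi) q := erefl.
have cstx i j l : ba_cst (bc_basis x a) (bc_coef (chi := x) x co) i j l =
    (x \o phi) (acst i j 0 l).
  by rewrite (ba_cst_bc Ei ba) cstE.
have onex l : counit (base_change x G) (bc_basis x a l) = (x \o phi) (aone B 0 l).
  by rewrite counit_bc_basis oneE.
have pex i : prim_idem (fdmap E (e i)) by exact: prim_idem_map.
have x_idem i : fdmap E (e i) * fdmap E (e i) = fdmap E (e i) by case: (pex i).
have x_corner i d : exists q, fdmap E (e i) * d * fdmap E (e i) = q *: fdmap E (e i).
  exact: prim_idemP.
have x_neq0 i : fdmap E (e i) != 0 by apply/eqP; exact: prim_idem_neq0 (pex i).
have x_orth i j : i <> j -> forall z, fdmap E (e i) * z * fdmap E (e j) = 0.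
  move=> ij z; rewrite (fdb_sum z) mulr_sumr mulr_suml big1 // => l _.
  rewrite fd_scalerAr fd_scalerAl -(fdmapb E) -!rmorphM orth // rmorph0.
  exact: scaler0.
have x_cover : exists s (g : 'I_s -> 'I_r) (b' c' : 'I_s -> fdext B (x \o phi)),
    1 = \sum_t b' t * fdmap E (e (g t)) * c' t.
  exists s, f, (fun t => fdmap E (b t)), (fun t => fdmap E (c t)).
  rewrite -(rmorph1 (fdmap E)) cover rmorph_sum; apply: eq_bigr => t _.
  by rewrite !rmorphM.
have PP i := ideal_left_ideal ba cstE oneE (JL i) (LJ i) x.
split.
- move=> i; exact: (left_ideal_irreducible bax x_idem x_corner x_neq0 x_orth x_cover PP).
- by move=> i j; exact: (left_ideal_iso bax x_idem x_neq0 x_orth PP).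
exact: (irreducible_left_ideal bax cstx onex x_idem x_corner x_orth x_cover PP).
Qed.

(** * Etale neighbourhoods with a good representation theory *)

Lemma prime_ker (T : comPzRingType) (K : fieldType) (z : {rmorphism T -> K}) :
  prime_ideal (fun t => z t = 0).
Proof.
split=> [|s t zs zt|s t zt||s t /eqP]; first exact: rmorph0.
- by rewrite rmorphD zs zt addr0.
- by rewrite rmorphM zt mulr0.
- by apply/eqP; rewrite rmorph1 oner_eq0.
by rewrite rmorphM mulf_eq0 => /orP [] /eqP; [left|right].
Qed.

(** Near the generic point of p, the coordinate ring is free, the fibre of its
    dual algebra is semisimple and the dual algebra splits. The field of values
    is enlarged on the way, which does not change the prime ideal below it. *)
Lemma good_neighbourhood (R : comNzRingType) (G : affGroup R) (p : R -> Prop) :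
  finite_hom (str G) -> flat_hom (str G) -> finitely_presented_hom (str G) ->
  linearly_reductive G -> prime_ideal p ->
  exists (T : comPzRingType) (chi : {rmorphism R -> T}),
    [/\ flat_etale chi, good_representation_theory (base_change chi G) &
      exists q : T -> Prop, prime_ideal q /\ forall r, p r <-> q (chi r)].
Proof.
move=> Gfin Gflat Gfp Gred /prime_ideal_point [K [x xp]].
have [S [phi [y [fe yx [n [a [co ba]]]]]]] := near_basis Gfin Gflat Gfp x.
have [|L [y' [[i iE] [T [psi [z [fe' zy sd]]]]]]] :=
    @near_split S (dual_alg ba) K y.
  move=> L y' _; have E r : y' (phi r) = (y' \o phi) r by [].
  exact: (reductive_vnr Gred E).
have E r : psi (phi r) = (psi \o phi) r by [].
exists T, (psi \o phi); split; first exact: flat_etale_comp.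
  apply: (@split_good S T (dual_alg ba) psi (base_change (psi \o phi) G)
    (bc_basis _ a) (bc_coef psi co) (basis_along_bc E ba) _ _ sd) => [j k l|l].
    by rewrite (ba_cst_bc E ba) mxE.
  by rewrite counit_bc_basis mxE.
exists (fun t => z t = 0); split; first exact: prime_ker.
move=> r; rewrite -xp -yx /= zy -iE.
by split=> [->|/eqP]; rewrite ?rmorph0 // fmorph_eq0 => /eqP.
Qed.

(** One neighbourhood for each prime ideal; the zero ring, over which there is
    none, is covered by the empty family. *)
Lemma good_covering (R : comPzRingType) (G : affGroup R) :
  finite_hom (str G) -> flat_hom (str G) -> finitely_presented_hom (str G) ->
  linearly_reductive G ->
  exists U : affine_family R, jointly_surjective U /\
    forall i : fam_index U, flat_etale (fam_map i) /\
      good_representation_theory (base_change (fam_map i) G).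
Proof.
move: G; move: R; apply: comPzRing_ind => R.
  move=> R0 G _ _ _ _.
  exists (@AffineFamily R False (fun=> R) (fun=> idfun)).
  by split=> [p [p0 _ _ []]|[]]; rewrite R0.
move=> G Gfin Gflat Gfp Gred.
pose nb (p : {p : R -> Prop | prime_ideal p}) :=
  cid (good_neighbourhood Gfin Gflat Gfp Gred (proj2_sig p)).
exists (AffineFamily (fun p => projT1 (cid (projT2 (nb p))))).
split=> [p pP|p] /=; last by case: cid => chi /= [].
exists (exist _ p pP) => /=; case: cid => chi /= [_ _ [q [qP pq]]].
by exists q.
Qed.

Theorem proposition1p15 (R : comPzRingType) (G : affGroup R)
    (Gfin : finite_hom (str G)) (Gflat : flat_hom (str G))
    (Gfp : finitely_presented_hom (str G)) (Gred : linearly_reductive G) :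
  (exists U : affine_family R, fppf_covering U /\
    forall i : fam_index U,
      good_representation_theory (base_change (fam_map i) G)) /\
  (etale_hom (str G) ->
    exists U : affine_family R, etale_covering U /\
      forall i : fam_index U,
        good_representation_theory (base_change (fam_map i) G)).
Proof.
have [U [Usurj UP]] := good_covering Gfin Gflat Gfp Gred.
split=> [|_]; exists U.
  split=> [|i]; last exact: (UP i).2.
  by split=> // i; have [[Uflat [Ufp _]] _] := UP i.
split=> [|i]; last exact: (UP i).2.
by split=> // i; have [[_ Uet] _] := UP i.
Qed.
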